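(* Let $\mathfrak S$ be a symmetrically-normed ideal of $\mathcal B(\mathbf H^1)$. The following assertions hold: (i) $\mathcal C_N$ is a complete Finsler manifold with the structure given by $\|XV\|_V:=\|XV\|_{\mathfrak S}$ for $XV\in(T\mathcal C_N)_V$. (ii) $\mathcal G_N$ is a complete Finsler manifold with the structure given by $\|XP-PX\|_P:=\|XP-PX\|_{\mathfrak S}$ for $XP-PX\in(T\mathcal G_N)_P$.
   Context: $L^2=L^2(\mathbb R^3)$ has inner product $\langle\phi,\psi\rangle_{L^2}=\int\phi\,\overline{\psi}\,dx$; $\mathbf H^1=\mathbf H^1(\mathbb R^3)$ is the Sobolev space of order one, a complex Hilbert space with inner product $\langle\phi,\psi\rangle_{\mathbf H^1}=\langle\phi,\psi\rangle_{L^2}+\sum_{i=1}^3\langle\partial_i\phi,\partial_i\psi\rangle_{L^2}$. $\mathcal B(\mathbf H^1)$ is the algebra of bounded operators on $\mathbf H^1$ with operator norm $\|\cdot\|$. A symmetrically-normed ideal of $\mathcal B(\mathbf H^1)$ is a (nonzero) two-sided ideal $\mathfrak S$ with a norm $\|\cdot\|_{\mathfrak S}$ such that: $(\mathfrak S,\|\cdot\|_{\mathfrak S})$ is a Banach space; $\|XYZ\|_{\mathfrak S}\le\|X\|\|Y\|_{\mathfrak S}\|Z\|$ for $X,Z\in\mathcal B(\mathbf H^1)$, $Y\in\mathfrak S$; and $\|X\|_{\mathfrak S}=\|X\|$ when $X$ has rank one. Such an ideal contains all finite rank operators. $\mathfrak u:=\{X\in\mathcal B(\mathbf H^1):\langle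 X\phi,\psi\rangle_{L^2}=-\langle\phi,X\psi\rangle_{L^2}\ \forall\phi,\psi\in\mathbf H^1\}$. Fix $N\in\mathbb N$ and an $N$-dimensional subspace $S\subset\mathbf H^1$. The Stiefel manifold $\mathcal C_N$ is the set of $V\in\mathcal B(\mathbf H^1)$ such that $\ker V=\{\xi\in\mathbf H^1:\langle\xi,s\rangle_{L^2}=0\ \forall s\in S\}$ and $\|V\xi\|_{L^2}=\|\xi\|_{L^2}$ for all $\xi\in S$. The Grassmann manifold $\mathcal G_N$ is the set of rank $N$ operators $P\in\mathcal B(\mathbf H^1)$ with $P^2=P$ and $\langle P\xi,\eta\rangle_{L^2}=\langle\xi,P\eta\rangle_{L^2}$ for all $\xi,\eta\in\mathbf H^1$. Both consist of finite rank operators, are contained in $\mathfrak S$, and are regarded as real analytic submanifolds of $\mathfrak S$ (as a real Banach space), with tangent spaces $(T\mathcal C_N)_V=\{XV:X\in\mathfrak u\}$ and $(T\mathcal G_N)_P=\{XP-PX:X\in\mathfrak u\}$. Finsler manifolds (in the sense of Palais): let $M$ be a $C^1$ manifold modeled on a Banach space $\mathcal X$. A Finsler structure is a function $\|\cdot\|:TM\to\mathbb R$, written $\|w\|_m$ for $w\in(TM)_m$, such that (a) for each $m\in M$, $\|\cdot\|_m$ is a norm on $(TM)_m$ defining its topology; (b) for each $m_0\in M$, chart $(\mathcal W,\Phi)$ with $m_0\in\mathcal W$, and $k>1$, there is an open neighborhood $\mathcal W_{m_0}\subseteq\mathcal W$ of $m_0$ with $\frac1k\|d\Phi^{-1}_{\Phi(m)}(v)\|_m\le\|d\Phi^{-1}_{\Phi(m_0)}(v)\|_{m_0}\le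 k\|d\Phi^{-1}_{\Phi(m)}(v)\|_m$ for all $m\in\mathcal W_{m_0}$, $v\in\mathcal X$. The length of a $C^1$ curve is $L(\gamma)=\int_0^1\|\dot\gamma(t)\|_{\gamma(t)}dt$, and $d(m_0,m_1)$ is the infimum of lengths of $C^1$ curves in $M$ joining $m_0$ to $m_1$ (on each connected component). $M$ is a complete Finsler manifold if it is complete for $d$. *)

(* Defs.v *)
From HB Require Import structures.
From mathcomp Require Import all_boot all_order all_algebra.
From mathcomp Require Import generic_quotient ring_quotient complex.
From mathcomp Require Import all_classical all_reals all_analysis.
From mathcomp Require Import measurable_realfun.

Set Implicit Arguments.
Unset Strict Implicit.
Unset Printing Implicit Defensive.

Import Order.TTheory GRing.Theory Num.Theory numFieldNormedType.Exports.
Local Open Scope classical_set_scope.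
Local Open Scope ring_scope.
Local Open Scope quotient_scope.

Notation R3 R := (R * R * R)%type (only parsing).

Notation leb3 R :=
  ((@lebesgue_measure R \x @lebesgue_measure R) \x @lebesgue_measure R)%E.

Section SobolevFunctions.
Variable R : realType.
Implicit Types (f g h : R3 R -> R[i]^o) (eta : R3 R -> R) (i : 'I_3).

Definition dir i : R3 R :=
  ((val i == 0%N)%:R, (val i == 1%N)%:R, (val i == 2%N)%:R).

Definition pderiv i eta : R3 R -> R := fun x => 'D_(dir i) eta x.

(* C^infinity: the iterated partial derivatives along every word of directions
   exist and are continuous. *)
Definition smooth eta := forall s : seq 'I_3,
  let g := foldr pderiv eta s in
  continuous g /\ forall i x, derivable g x (dir i).

(* Real-valued test functions suffice: the pairing with a complex-valued one is
   a complex linear combination of pairings with real ones. *)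
Definition test_function eta :=
  smooth eta /\ compact (closure [set x | eta x != 0]).

Definition cint h : R[i] :=
  ((\int[leb3 R]_x complex.Re (h x)) +i* (\int[leb3 R]_x complex.Im (h x)))%C.

(* Square-integrable functions, not yet identified almost everywhere. Integrals
   of complex functions are taken on real and imaginary parts. *)
Definition L2 : set (R3 R -> R[i]^o) := [set f |
  (fun x => complex.Re (f x)) \in Lfun (leb3 R) 2%:E /\
  (fun x => complex.Im (f x)) \in Lfun (leb3 R) 2%:E].

Definition L2dot f g : R[i] := cint (fun x => f x * ((g x)^*)%C).

Definition weak_partial i f g := forall eta, test_function eta ->
  cint (fun x => f x * ((pderiv i eta x)%:C)%C) =
  - cint (fun x => g x * ((eta x)%:C)%C).

Definition H1fun : {pred R3 R -> R[i]^o} := fun f =>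
  `[< L2 f /\ forall i, exists2 g, L2 g & weak_partial i f g >].

(* A weak derivative, which is unique almost everywhere, so that integrals do
   not depend on the choice made here. *)
Definition wderiv i f : R3 R -> R[i]^o :=
  xget (cst 0) [set g | L2 g /\ weak_partial i f g].

Lemma open_measurable3 (U : set (R3 R)) : open U -> measurable U.
Proof.
move=> oU.
pose c (q : rat * rat * rat) : R3 R := (ratr q.1.1, ratr q.1.2, ratr q.2).
pose B (k : rat * rat * rat * nat) := ball (c k.1) (k.2.+1%:R^-1 : R).
have mB k : measurable (B k).
  have -> : B k = (ball (ratr k.1.1.1 : R) (k.2.+1%:R^-1) `*`
     ball (ratr k.1.1.2 : R) (k.2.+1%:R^-1)) `*`
     ball (ratr k.1.2 : R) (k.2.+1%:R^-1) by [].
  by apply: measurableX; [apply: measurableX|]; exact: measurable_ball.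
have -> : U = \bigcup_(n in [set: nat])
    (if unpickle n is Some k then if `[< B k `<=` U >] then B k else set0
     else set0).
  apply/seteqP; split => [[[x y] z] Ux|x [n _]]; last first.
    by case: unpickle => // k; case: asboolP => // BU Bx; exact: BU.
  have /nbhs_ballP[e /= e0 eU] := open_nbhs_nbhs (conj oU Ux).
  have [n hn] : exists n, n.+1%:R^-1 < e / 2 :> R.
    exists (Num.trunc (e / 2)^-1).
    rewrite invf_plt ?posrE ?divr_gt0//; exact: truncnS_gt.
  have n0 : 0 < n.+1%:R^-1 :> R by rewrite invr_gt0.
  have H (t : R) : exists q, ball (ratr q : R) (n.+1%:R^-1) t.
    have /(@dense_rat R)/(_ (ball_open t _))[r [tq [q _ qE]]] :
      ball t (n.+1%:R^-1) !=set0 by exists t; exact: ballxx.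
    by exists q; apply: ball_sym; rewrite qE.
  have [q1 h1] := H x; have [q2 h2] := H y; have [q3 h3] := H z.
  have [k [Bx BU]] : exists k, B k (x, y, z) /\ B k `<=` U.
    exists (q1, q2, q3, n).
    have Bx : B (q1, q2, q3, n) (x, y, z) by split; [split|].
    split=> [|w Bw]; first exact: Bx.
    apply: eU; apply: (@le_ball _ _ _ (n.+1%:R^-1 + n.+1%:R^-1)).
      by rewrite [leRHS]splitr lerD// ltW.
    apply: ball_triangle Bw; apply: ball_sym; exact: Bx.
  exists (pickle k); first exact: I.
  by rewrite pickleK (asboolT BU).
apply: bigcupT_measurable => n; case: unpickle => // k.
by case: asboolP.
Qed.

Lemma cont_compact_Lfun eta : continuous eta ->
  compact (closure [set x | eta x != 0]) -> eta \in Lfun (leb3 R) 2%:E.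
Proof.
move=> ceta cK; set K := closure _ in cK.
have meta : measurable_fun setT eta.
  apply: (measurability _ (RGenOInfty.measurableE R)) => //=.
  move=> _ [_ [a ->]] <-; rewrite setTI; apply: open_measurable3.
  by move/continuousP : ceta; apply; rewrite set_itvoy; exact: open_gt.
have [M0 [_ HM]] := compact_bounded cK.
pose M := `|M0| + 1; have M0M : M0 < M by rewrite ltr_pwDr// ler_norm.
have {M0M}HM x : K x -> `|x| <= M by apply: HM.
have [N0 [_ HN]] :=
  compact_bounded (continuous_compact (continuous_subspaceT ceta) cK).
pose N := `|N0| + 1; have N0N : N0 < N by rewrite ltr_pwDr// ler_norm.
have {N0N}HN x : K x -> `|eta x| <= N.
  by move=> Kx; apply: HN => //; exists x.
have NN : 0 <= N by rewrite addr_ge0.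
have MM : 0 < M + 1 by rewrite addr_gt0// ltr_wpDl.
pose B : set (R3 R) := (ball (0 : R) (M + 1) `*` ball (0 : R) (M + 1)) `*` ball (0 : R) (M + 1).
have mb : measurable (ball (0 : R) (M + 1)) by exact: measurable_ball.
have mbb : measurable (ball (0 : R) (M + 1) `*` ball (0 : R) (M + 1)) by exact: measurableX.
have mB : measurable B by exact: measurableX.
have KB x : K x -> B x.
  move=> Kx.
  have : ball (0 : R3 R) (M + 1) x.
    by rewrite -ball_normE /= sub0r normrN (le_lt_trans (HM _ Kx))// ltrDl.
  by [].
rewrite inE; apply/andP; split; rewrite inE//=.
rewrite /finite_norm unlock /Lnorm poweR_lty//=.
apply: (@le_lt_trans _ _ (\int[leb3 R]_(x in B) (N `^ 2)%:E)%E).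
  rewrite [leRHS]integral_mkcond; apply: ge0_le_integral => //=.
  - apply/measurable_EFinP.
    apply/(@measurableT_comp _ _ _ _ _ _ (fun x : R => x `^ 2)%R) => //.
    exact/measurableT_comp.
  - apply/(measurable_restrictT _ mB); exact: measurable_cst.
  - move=> x _; rewrite patchE.
    have [xK|/= xK] := pselect (K x).
      rewrite mem_set ?lee_fin; last exact: KB.
      by rewrite ge0_ler_powR// ?nnegrE// HN.
    have -> : eta x = 0.
      by apply/eqP/negPn/negP => e0; apply: xK; exact: subset_closure.
    rewrite normr0 powR0// ?pnatr_eq0//.
    by case: ifP => // _; rewrite lee_fin powR_ge0.
have lb : lebesgue_measure (ball (0 : R) (M + 1)) \is a fin_num.
  by rewrite lebesgue_measure_ball// ltW.
have lB : (leb3 R) B \is a fin_num.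
  have -> := product_measure1E (lebesgue_measure \x lebesgue_measure)%E
    lebesgue_measure mbb mb.
  rewrite fin_numM//.
  have := product_measure1E lebesgue_measure lebesgue_measure mb mb.
  by move=> /(congr1 (fun z => z \is a fin_num)); rewrite fin_numM// => ->.
by rewrite integral_cst// ltey_eq fin_numM.
Qed.

Lemma near_pderiv_eq0 eta i x :
  ~ closure [set x | eta x != 0] x -> pderiv i eta x = 0.
Proof.
move=> Kx; rewrite /pderiv.
have /open_nbhs_nbhs : open_nbhs x (~` closure [set x | eta x != 0]).
  by split => //; exact/closed_openC/closed_closure.
move=> nx; rewrite (@near_eq_derive _ _ _ eta (cst 0)); first exact: derive_cst.
by apply: filterS nx => y /= Ky; apply/eqP/negPn/negP => ?; apply: Ky;
  exact: subset_closure.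
Qed.

Lemma test_Lfun eta : test_function eta -> eta \in Lfun (leb3 R) 2%:E.
Proof. by move=> [s c]; apply: cont_compact_Lfun => //; exact: (s [::]).1. Qed.

Lemma test_pderiv_Lfun eta i :
  test_function eta -> pderiv i eta \in Lfun (leb3 R) 2%:E.
Proof.
move=> [s c]; apply: cont_compact_Lfun; first exact: (s [:: i]).1.
have clK : closed (closure [set x | eta x != 0]) by exact: closed_closure.
apply: (subclosed_compact _ c); first exact: closed_closure.
rewrite [X in _ `<=` X]((closure_id _).1 clK).
apply: closure_subset => x /= /eqP e0; apply: contrapT.
by move/near_pderiv_eq0 => /(_ i).
Qed.

Lemma cReM (x y : R[i]) : complex.Re (x * y) =
  complex.Re x * complex.Re y - complex.Im x * complex.Im y.
Proof. by case: x; case: y. Qed.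

Lemma cImM (x y : R[i]) : complex.Im (x * y) =
  complex.Re x * complex.Im y + complex.Im x * complex.Re y.
Proof. by case: x => a b; case: y. Qed.

Lemma cReD (x y : R[i]) : complex.Re (x + y) = complex.Re x + complex.Re y.
Proof. by case: x; case: y. Qed.

Lemma cImD (x y : R[i]) : complex.Im (x + y) = complex.Im x + complex.Im y.
Proof. by case: x; case: y. Qed.

Definition Lp (p : \bar R) f :=
  (fun x => complex.Re (f x)) \in Lfun (leb3 R) p /\
  (fun x => complex.Im (f x)) \in Lfun (leb3 R) p.

Lemma LfunE p (u v : R3 R -> R) : u \in Lfun (leb3 R) p -> u =1 v ->
  v \in Lfun (leb3 R) p.
Proof. by move=> up /funext <-. Qed.

Lemma Lp_lin p a f g : (1 <= p)%E -> Lp p f -> Lp p g -> Lp p (a *: f + g).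
Proof.
move=> p1 [fr fi] [gr gi].
have [_ LD] := Lfun_submod_closed (leb3 R) p1.
split.
- have := LD (complex.Re a) _ _ fr (LD (- complex.Im a) _ _ fi gr).
  move/LfunE; apply => x.
  rewrite [RHS]cReD [X in _ = X + _]cReM -addrA; congr (_ + _).
  by rewrite -mulNr.
- have := LD (complex.Re a) _ _ fi (LD (complex.Im a) _ _ fr gi).
  move/LfunE; apply => x.
  by rewrite [RHS]cImD [X in _ = X + _]cImM -addrA.
Qed.

Lemma Lp0 p : (1 <= p)%E -> Lp p 0.
Proof.
by move=> p1; have [L0 _] := Lfun_submod_closed (leb3 R) p1; split; exact: L0.
Qed.

Lemma cint_lin a f g : Lp 1 f -> Lp 1 g ->
  cint (a *: f + g) = a * cint f + cint g.
Proof.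
move=> [fr fi] [gr gi].
have [_ LD] := Lfun_submod_closed (leb3 R) (lexx 1%E).
have I1 u : u \in Lfun (leb3 R) 1 -> (leb3 R).-integrable setT (EFin \o u).
  by move/Lfun1_integrable.
have L r (u v : R3 R -> R) : u \in Lfun (leb3 R) 1 -> v \in Lfun (leb3 R) 1 ->
  \int[leb3 R]_x (r * u x + v x) = r * (\int[leb3 R]_x u x) + \int[leb3 R]_x v x.
  move=> ul vl; have [L0 _] := Lfun_submod_closed (leb3 R) (lexx 1%E).
  have lru : (fun x => r * u x) \in Lfun (leb3 R) 1.
    by have := LD r u 0 ul L0; rewrite addr0.
  have [iu iru iv] := And3 (I1 _ ul) (I1 _ lru) (I1 _ vl).
  by rewrite RintegralD// RintegralZl.
apply/eqP; rewrite eq_complex cReD cImD cReM cImM /=; apply/andP; split; apply/eqP.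
- rewrite -addrA -mulNr -L// -L//.
    by apply: eq_Rintegral => x _; rewrite cReD cReM mulNr addrA.
  exact: (LD (- complex.Im a) _ _ fi gr).
- rewrite -addrA -L// -L//.
    by apply: eq_Rintegral => x _; rewrite cImD cImM addrA.
  exact: (LD (complex.Im a) _ _ fr gi).
Qed.

Lemma L2M f eta : L2 f -> eta \in Lfun (leb3 R) 2%:E ->
  Lp 1 (fun x => f x * ((eta x)%:C)%C).
Proof.
move=> [fr fi] e; split.
- have := Lfun2_mul_Lfun1 fr e; move/LfunE; apply => x /=.
  by rewrite cReM /= mulr0 subr0.
- have := Lfun2_mul_Lfun1 fi e; move/LfunE; apply => x /=.
  by rewrite cImM /= mulr0 add0r.
Qed.

Lemma H1funP f :
  reflect (L2 f /\ forall i, exists2 g, L2 g & weak_partial i f g) (f \in H1fun).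
Proof. exact: asboolP. Qed.

Lemma H1fun_submod : submod_closed H1fun.
Proof.
have le12 : (1 <= 2%:E :> \bar R)%E by rewrite lee_fin ler1n.
split=> [|a f f'].
  apply/H1funP; split=> [|i]; first exact: Lp0.
  exists 0; first exact: Lp0.
  move=> eta _.
  have E u : (fun x => (0 : R3 R -> R[i]^o) x * ((u x)%:C)%C) = cst 0 :> (_ -> R[i]^o).
    by apply/funext => x; rewrite mul0r.
  rewrite !E; apply/eqP; rewrite eq_complex /=.
  by rewrite /Rintegral integral0 /= oppr0 eqxx.
move=> /H1funP[fL fw] /H1funP[fL' fw']; apply/H1funP.
split=> [|i]; first exact: Lp_lin.
have [g gL gw] := fw i; have [g' gL' gw'] := fw' i.
exists (a *: g + g'); first exact: Lp_lin.
move=> eta te.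
have E (h h' : R3 R -> R[i]^o) u : (fun x => (a *: h + h') x * ((u x)%:C)%C) =
    a *: (fun x => h x * ((u x)%:C)%C) + (fun x => h' x * ((u x)%:C)%C) :> (_ -> R[i]^o).
  apply/funext => x; rewrite [LHS]mulrDl; congr (_ + _); exact: esym (mulrA _ _ _).
have [e0 e1] := conj (test_Lfun te) (test_pderiv_Lfun i te).
rewrite !E (cint_lin _ (L2M fL e1) (L2M fL' e1)).
rewrite (cint_lin _ (L2M gL e0) (L2M gL' e0)).
by rewrite gw// gw'// mulrN opprD.
Qed.

HB.instance Definition _ :=
  GRing.isSubmodClosed.Build _ _ H1fun H1fun_submod.

Definition ae_zero f := {ae leb3 R, forall x, f x = 0}.

Record h1fun := H1Fun { h1fun_val :> R3 R -> R[i]^o; _ : h1fun_val \in H1fun }.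
HB.instance Definition _ := [isSub for h1fun_val].
HB.instance Definition _ := [Choice of h1fun by <:].
HB.instance Definition _ := [SubChoice_isSubLmodule of h1fun by <:].

Definition h1null : {pred h1fun} := fun f : h1fun => `[< ae_zero f >].

Lemma h1null_submod : submod_closed h1null.
Proof.
have P (f : h1fun) : reflect (ae_zero f) (f \in h1null) by exact: asboolP.
split=> [|a f g /P f0 /P g0]; apply/P; first exact: aeW.
have F := ae_filter_ringOfSetsType (leb3 R).
by apply: filterS2 f0 g0 => x fx gx;
  rewrite [LHS](_ : _ = a *: h1fun_val f x + h1fun_val g x)// fx gx scaler0 addr0.
Qed.

HB.instance Definition _ :=
  GRing.isSubmodClosed.Build _ _ h1null h1null_submod.

End SobolevFunctions.

Section Sobolev.
Variable R : realType.

(* H^1(R^3) is the space of square-integrable functions with square-integrable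
   weak first derivatives, modulo equality almost everywhere. *)
Definition H1 : Type := Quotient.quot (@h1null R).
HB.instance Definition _ := GRing.Zmodule.on H1.
HB.instance Definition _ := EqQuotient.on H1.

Definition h1scale (a : R[i]) (phi : H1) : H1 := \pi_H1 (a *: repr phi).

Lemma pi_h1scale a (f : h1fun R) : \pi_H1 (a *: f) = h1scale a (\pi f).
Proof.
apply/eqP; rewrite -Quotient.idealrBE -scalerBr.
apply: rpredZ; rewrite Quotient.idealrBE; apply/eqP.
by rewrite reprK.
Qed.

Lemma pi_h1D (f g : h1fun R) : \pi_H1 (f + g) = \pi_H1 f + \pi_H1 g.
Proof. exact: (Quotient.pi_add (@h1null R)). Qed.

Lemma h1scaleA a b phi : h1scale a (h1scale b phi) = h1scale (a * b) phi.
Proof. by rewrite -[phi]reprK -(pi_h1scale b) -!pi_h1scale scalerA. Qed.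

Lemma h1scale1 : left_id 1 h1scale.
Proof. by move=> phi; rewrite -[phi]reprK -pi_h1scale scale1r. Qed.

Lemma h1scaleDr : right_distributive h1scale +%R.
Proof.
move=> a phi psi; rewrite -[phi]reprK -[psi]reprK.
by rewrite -pi_h1D -!pi_h1scale -pi_h1D scalerDr.
Qed.

Lemma h1scaleDl phi : {morph h1scale^~ phi : a b / a + b}.
Proof.
by move=> a b; rewrite -[phi]reprK -!pi_h1scale -pi_h1D scalerDl.
Qed.

HB.instance Definition _ := GRing.Zmodule_isLmodule.Build R[i] H1
  h1scaleA h1scale1 h1scaleDr h1scaleDl.


Implicit Types (phi psi xi eta : H1) (X Y Z : H1 -> H1) (A S : set H1).

(* The representative chosen by repr is immaterial. *)
Definition l2dot phi psi : R[i] := L2dot (repr phi) (repr psi).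

Definition h1dot phi psi : R[i] := l2dot phi psi +
  \sum_(i < 3) L2dot (wderiv i (repr phi)) (wderiv i (repr psi)).

Definition l2norm phi : R := Num.sqrt (complex.Re (l2dot phi phi)).

Definition h1norm phi : R := Num.sqrt (complex.Re (h1dot phi phi)).

Definition lin_indep n (b : 'I_n -> H1) :=
  forall c : 'I_n -> R[i], \sum_i c i *: b i = 0 -> forall i, c i = 0.

Definition lspan n (b : 'I_n -> H1) : set H1 :=
  range (fun c : 'I_n -> R[i] => \sum_i c i *: b i).

Definition has_dim n A := exists2 b : 'I_n -> H1, lin_indep b & A = lspan b.

Definition has_rank n X := has_dim n (range X).

Definition bounded_op : set (H1 -> H1) := [set X |
  linear X /\ exists M, forall phi, h1norm (X phi) <= M * h1norm phi].

Definition opnorm X : R := sup [set h1norm (X phi) | phi in [set phi | h1norm phi <= 1]].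

(* sni_norm is only meaningful on sni_set. Closure under scalars and sums is
   stated with sni_lin, and completeness with Cauchy sequences. *)
Record sn_ideal := SNIdeal {
  sni_set :> set (H1 -> H1);
  sni_norm : (H1 -> H1) -> R;
  sni_bounded : sni_set `<=` bounded_op;
  sni_neq0 : exists2 X, sni_set X & X <> 0;
  sni_lin : forall (a : R[i]) X Y,
    sni_set X -> sni_set Y -> sni_set (a *: X + Y);
  sni_mull : forall X Y, bounded_op X -> sni_set Y -> sni_set (X \o Y);
  sni_mulr : forall Y Z, sni_set Y -> bounded_op Z -> sni_set (Y \o Z);
  sni_norm_eq0 : forall X, sni_set X -> sni_norm X = 0 -> X = 0;
  sni_normZ : forall (a : R[i]) X, sni_set X ->
    sni_norm (a *: X) = complex.Re `|a| * sni_norm X;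
  sni_normD : forall X Y, sni_set X -> sni_set Y ->
    sni_norm (X + Y) <= sni_norm X + sni_norm Y;
  sni_complete : forall u : nat -> (H1 -> H1), (forall n, sni_set (u n)) ->
    (forall e, 0 < e -> exists n0, forall p q, (n0 <= p)%N -> (n0 <= q)%N ->
      sni_norm (u p - u q) < e) ->
    exists2 X, sni_set X & sni_norm (u n - X) @[n --> \oo] --> (0 : R);
  sni_norm_mul : forall X Y Z, bounded_op X -> sni_set Y -> bounded_op Z ->
    sni_norm (X \o Y \o Z) <= opnorm X * sni_norm Y * opnorm Z;
  sni_norm_rank1 : forall X, sni_set X -> has_rank 1 X -> sni_norm X = opnorm X
}.

Definition skew_op : set (H1 -> H1) := [set X | bounded_op X /\
  forall phi psi, l2dot (X phi) psi = - l2dot phi (X psi)].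

(* The kernel is the L^2-orthogonal complement of S in H^1. *)
Definition stiefel S : set (H1 -> H1) := [set V | [/\ bounded_op V,
  [set xi | V xi = 0] = [set xi | forall s, S s -> l2dot xi s = 0] &
  forall xi, S xi -> l2norm (V xi) = l2norm xi]].

Definition grassmann n : set (H1 -> H1) := [set P | [/\ bounded_op P,
  has_rank n P, P \o P = P &
  forall xi eta, l2dot (P xi) eta = l2dot xi (P eta)]].

End Sobolev.

Section IdealSpace.
Variables (R : realType) (I : sn_ideal R).

Definition sni_pred : {pred H1 R -> H1 R} := fun X => `[< sni_set I X >].

Lemma sni_predP (X : H1 R -> H1 R) : reflect (sni_set I X) (X \in sni_pred).
Proof. exact: asboolP. Qed.

Lemma sni_pred_zmod : zmod_closed sni_pred.
Proof.
have [X0 IX0 _] := sni_neq0 I.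
split=> [|X Y /sni_predP IX /sni_predP IY]; apply/sni_predP.
  by have := sni_lin (-1) IX0 IX0; rewrite scaleN1r addNr.
by have := sni_lin (-1) IY IX; rewrite scaleN1r addrC.
Qed.

HB.instance Definition _ := GRing.isZmodClosed.Build _ sni_pred sni_pred_zmod.

(* The ideal as a real Banach space: scalars are restricted from R[i] to R. *)
Record ideal_space := IdealElt {
  ideal_op :> H1 R -> H1 R; _ : ideal_op \in sni_pred }.

HB.instance Definition _ := [isSub for ideal_op].
HB.instance Definition _ := [Choice of ideal_space by <:].
HB.instance Definition _ := [SubChoice_isSubZmodule of ideal_space by <:].

Lemma ideal_opP (X : ideal_space) : sni_set I X.
Proof. exact/sni_predP/(valP X). Qed.

Lemma ideal_scale_subproof (a : R) (X : ideal_space) :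
  (a%:C)%C *: (X : H1 R -> H1 R) \in sni_pred.
Proof.
apply/sni_predP; have I0 : sni_set I 0 by apply/sni_predP/rpred0.
by have := sni_lin ((a%:C)%C) (ideal_opP X) I0; rewrite addr0.
Qed.

Definition ideal_scale (a : R) (X : ideal_space) : ideal_space :=
  IdealElt (ideal_scale_subproof a X).

Lemma ideal_scaleA a b X : ideal_scale a (ideal_scale b X) = ideal_scale (a * b) X.
Proof. by apply: val_inj; rewrite /= scalerA -rmorphM. Qed.

Lemma ideal_scale1 : left_id 1 ideal_scale.
Proof. by move=> X; apply: val_inj; rewrite /= scale1r. Qed.

Lemma ideal_scaleDr : right_distributive ideal_scale +%R.
Proof. by move=> a X Y; apply: val_inj; rewrite /= scalerDr. Qed.

Lemma ideal_scaleDl X : {morph ideal_scale^~ X : a b / a + b}.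
Proof. by move=> a b; apply: val_inj; rewrite /= rmorphD scalerDl. Qed.

HB.instance Definition _ := GRing.Zmodule_isLmodule.Build R ideal_space
  ideal_scaleA ideal_scale1 ideal_scaleDr ideal_scaleDl.

Definition ideal_norm (X : ideal_space) : R := sni_norm I X.

Lemma ideal_normD X Y : ideal_norm (X + Y) <= ideal_norm X + ideal_norm Y.
Proof. exact: (sni_normD (ideal_opP X) (ideal_opP Y)). Qed.

Lemma ideal_normZ (a : R) X : ideal_norm (a *: X) = `|a| * ideal_norm X.
Proof.
by rewrite /ideal_norm /= (sni_normZ _ (ideal_opP X)) normc_def /= expr0n /= addr0
  sqrtr_sqr.
Qed.

Lemma ideal_norm_eq0 X : ideal_norm X = 0 -> X = 0.
Proof. by move=> X0; apply: val_inj; exact: (sni_norm_eq0 (ideal_opP X)). Qed.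

HB.instance Definition _ := @Lmodule_isNormed.Build R ideal_space
  ideal_norm ideal_normD ideal_normZ ideal_norm_eq0.

Lemma ideal_complete (F : set_system ideal_space) :
  ProperFilter F -> cauchy F -> cvg F.
Proof.
move=> PF /cauchyP Fc.
have n0 n : 0 < n.+1%:R^-1 :> R by rewrite invr_gt0.
have /choice[u Fu] : forall n, exists x : ideal_space, F (ball x (n.+1%:R^-1)).
  by move=> n; exact: Fc.
have near e : 0 < e -> exists k, forall n, (k <= n)%N -> n.+1%:R^-1 < e :> R.
  move=> e0; exists (Num.trunc e^-1) => n kn.
  rewrite invf_plt ?posrE//; apply: lt_le_trans (truncnS_gt _) _.
  by rewrite ler_nat ltnS.
have uu p q : `|u p - u q| < p.+1%:R^-1 + q.+1%:R^-1.
  have [z []] := filter_ex (filterI (Fu p) (Fu q)).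
  rewrite -!ball_normE /= => zp zq.
  rewrite -(subrKA z) (le_lt_trans (ler_normD _ _))// ltrD//.
  by rewrite distrC.
have [||X IX uX] := @sni_complete _ I (fun n => u n : H1 R -> H1 R).
- by move=> n; exact: ideal_opP.
- move=> e e0; have [k kP] := near (e / 2) (divr_gt0 e0 (ltr0Sn R 1)).
  exists k => p q kp kq; apply: lt_trans (uu p q) _.
  by rewrite [ltRHS]splitr ltrD// kP.
pose Y := @IdealElt X (introT (sni_predP X) IX).
have {}uX : `|u n - Y| @[n --> \oo] --> (0 : R) by exact: uX.
apply/cvg_ex; exists Y; apply/cvgrPdist_lt => e e0.
have e20 : 0 < e / 2 by rewrite divr_gt0.
have [k kP] := near _ e20.
move/cvgrPdist_lt : uX => /(_ _ e20)[k' _ k'P].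
have := Fu (maxn k k'); apply: filterS => z; rewrite -ball_normE /= => uz.
rewrite -(subrKA (u (maxn k k'))) (le_lt_trans (ler_normD _ _))//.
rewrite [ltRHS]splitr ltrD//; last first.
  by rewrite (lt_trans uz)// kP// leq_maxl.
by have := k'P _ (leq_maxr k k'); rewrite /= sub0r normrN normr_id distrC.
Qed.

HB.instance Definition _ := Uniform_isComplete.Build ideal_space ideal_complete.

End IdealSpace.

Section Finsler.
Variable R : realType.

(* On an open set D: f is differentiable with derivative continuous for the
   operator norm. *)
Definition c1_on (E G : normedModType R) (D : set E) (f : E -> G) :=
  forall x, D x -> differentiable f x /\
    forall e, 0 < e -> \forall y \near x, forall v,
      `|'d f y v - 'd f x v| <= e * `|v|.

Variable B : completeNormedModType R.
Implicit Types (M W : set B) (T : B -> set B) (F : B -> B -> R).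

Section Charts.
Variable X : completeNormedModType R.

(* A chart (W, Phi) of M, regarded as a C^1 submanifold of B modeled on X, with
   inverse phi. The last clause says that Phi is C^1 on a subset of B, i.e. is
   locally the restriction of a C^1 map Psi on an open subset of B. Since
   Psi \o phi is the identity, phi is then an immersion with complemented range
   and a homeomorphism onto W, so these are exactly the charts of the maximal
   C^1 atlas of a (split) submanifold. *)
Definition c1_chart M W (Phi : B -> X) (phi : X -> B) := [/\
  exists2 U, open U & W = M `&` U,
  open (Phi @` W),
  forall m, W m -> phi (Phi m) = m,
  c1_on (Phi @` W) phi &
  forall m, W m -> exists U (Psi : B -> X), [/\ open U, U m, c1_on U Psi &
    forall m', (W `&` U) m' -> Psi m' = Phi m']].

Definition c1_submanifold M := forall m, M m ->
  exists W Phi phi, c1_chart M W Phi phi /\ W m.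

(* The tangent space at m, as a subspace of B, is the range of the derivative
   at Phi m of the inverse of any chart around m. *)
Definition tangent_spaces M T := forall W Phi phi, c1_chart M W Phi phi ->
  forall m, W m -> range ('d phi (Phi m)) = T m.

Definition fiber_norm M T F := forall m, M m ->
  [/\ forall w, T m w -> 0 <= F m w,
      forall w, T m w -> F m w = 0 -> w = 0,
      forall a w, T m w -> F m (a *: w) = `|a| * F m w &
      forall w w', T m w -> T m w' -> F m (w + w') <= F m w + F m w'].

(* F m defines the topology of the tangent space at m, which is carried over
   from X by the derivative of the inverse of a chart. *)
Definition fiber_topology M F := forall W Phi phi, c1_chart M W Phi phi ->
  forall m, W m -> forall (v : X) (A : set X), nbhs v A <->
    exists2 e, 0 < e & [set u | F m ('d phi (Phi m) (u - v)) < e] `<=` A.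

Definition fiber_continuity M F :=
  forall W Phi phi, c1_chart M W Phi phi ->
  forall m0, W m0 -> forall k, 1 < k ->
  exists U, [/\ open U, U m0, M `&` U `<=` W &
    forall m, (M `&` U) m -> forall v : X,
      k^-1 * F m ('d phi (Phi m) v) <= F m0 ('d phi (Phi m0) v) /\
      F m0 ('d phi (Phi m0) v) <= k * F m ('d phi (Phi m) v)].

End Charts.

(* A C^1 curve on [0, 1] extends to a C^1 curve on R in the Banach space B, so
   two-sided derivatives at 0 and 1 are no restriction: only the part over
   [0, 1] is required to lie in M. *)
Definition c1_curve M (gamma : R -> B) :=
  (forall t, t \in `[0, 1] -> M (gamma t) /\ derivable gamma t 1) /\
  {within `[0, 1], continuous (derive1 gamma)}.

Definition curve_length F (gamma : R -> B) : R :=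
  \int[lebesgue_measure]_(t in `[0, 1]) F (gamma t) (derive1 gamma t).

(* The distance is +oo between points that no curve joins, so that Cauchy and
   convergent sequences eventually remain in one connected component. *)
Definition finsler_dist M F (m0 m1 : B) : \bar R :=
  ereal_inf [set (curve_length F gamma)%:E | gamma in
    [set gamma | [/\ c1_curve M gamma, gamma 0 = m0 & gamma 1 = m1]]].

Definition finsler_complete M F := forall u : nat -> B,
  (forall n, M (u n)) ->
  (forall e, 0 < e -> exists n0, forall p q, (n0 <= p)%N -> (n0 <= q)%N ->
    (finsler_dist M F (u p) (u q) < e%:E)%E) ->
  exists2 m, M m & finsler_dist M F (u n) m @[n --> \oo] --> 0%E.

Definition complete_finsler_manifold M T F :=
  exists X : completeNormedModType R,
    [/\ c1_submanifold X M, tangent_spaces X M T,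
        [/\ fiber_norm M T F, fiber_topology X M F & fiber_continuity X M F] &
        finsler_complete M F].

End Finsler.

(* Main.v *)
(* Both manifolds are homogeneous: an operator that is unitary for the L^2
   inner product and bounded on H^1 together with its inverse acts on C_N by
   V |-> U V and on G_N by P |-> U P U^-1, and finite products of complex
   reflections, which are such operators, make the actions transitive. One
   chart at the base point e, the orthogonal projection onto S, therefore
   yields an atlas. For C_N it is a Cayley transform, for G_N the
   parametrization of projections by graphs; both have an explicit inverse that
   extends to an open subset of the ideal, and both only invert elements of the
   corner e I e close to e, by a Neumann series. Tangent vectors are velocities
   of curves, and they are read off the equations that define the manifolds.

   Both sets are moreover closed in the ideal I. The length of a curve is at
   least the distance of its ends for the norm of I, so a Cauchy sequence for
   the Finsler distance converges in I, to a point of the manifold; a chart at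
   this point sends segments to curves whose length is at most a constant times
   the norm distance of their ends, so convergence also holds for the Finsler
   distance.

   That l2dot and h1dot are inner products rests on the almost everywhere
   uniqueness of weak derivatives, for which enough test functions are needed:
   the functions exp (-1/x) give bounded sequences of test functions converging
   to indicators of boxes. *)

(* The operators are bounded for the norm of H^1, while the conditions that define both manifolds
   use the L^2 product, and an operator bounded on H^1 need not have an L^2-adjoint that is bounded
   there. Adjoints are therefore taken only after composing on the right with the base projection
   [e]: the adjoint of [A \o e] has finite rank, and [star] is a bounded real-linear map of the
   ideal. This is why the charts are block formulas relative to [e]. The symmetry of a general
   projection is tested instead by a family of rank-one equations.

   The Finsler norm is everywhere the norm of the ambient ideal, so the fiber conditions, which
   quantify over all charts, hold for every submanifold: the local extension of a chart is a left
   inverse of the parametrization, whose derivative is therefore bounded below.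

   The rank-one axiom of the norm enters twice: it makes the ideal norm dominate the operator norm,
   which turns the ideal into a Banach algebra, and it bounds the rank-one terms of [star]. *)
Require Import Defs.
From HB Require Import structures.
From mathcomp Require Import all_boot all_order all_algebra.
From mathcomp Require Import generic_quotient ring_quotient complex.
From mathcomp Require Import all_classical all_reals all_analysis.
From mathcomp Require Import measurable_realfun.
From mathcomp Require Import ring lra.
Import Order.TTheory GRing.Theory Num.Theory numFieldNormedType.Exports.
Local Open Scope classical_set_scope.
Local Open Scope ring_scope.

Set Implicit Arguments.
Unset Strict Implicit.
Unset Printing Implicit Defensive.

(** * Linear identities in modules *)

Section ModuleExpressions.
Variables (K : comPzRingType) (V : lmodType K).

(** Reflection: an expression is determined by its coefficients on the atoms listed in an
    environment, so an identity in [V] reduces to finitely many identities in [K]. *)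
Inductive mexpr :=
  MVar of nat | MZero | MAdd of mexpr & mexpr | MOpp of mexpr | MScale of K & mexpr.

Fixpoint meval (env : seq V) e : V :=
  match e with
  | MVar n => nth 0 env n
  | MZero => 0
  | MAdd e1 e2 => meval env e1 + meval env e2
  | MOpp e => - meval env e
  | MScale k e => k *: meval env e
  end.

Fixpoint mcoef e i : K :=
  match e with
  | MVar n => if eqn n i then 1 else 0
  | MZero => 0
  | MAdd e1 e2 => mcoef e1 i + mcoef e2 i
  | MOpp e => - mcoef e i
  | MScale k e => k * mcoef e i
  end.

Lemma mevalE env e : meval env e = \sum_(i < size env) mcoef e i *: nth 0 env i.
Proof.
elim: e => [n||e1 IH1 e2 IH2|e IH|k e IH] /=.
- have [nl|nl] := ltnP n (size env).
    rewrite (bigD1 (Ordinal nl))//= eqnE eqxx scale1r big1 ?addr0// => i ni.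
    rewrite ifF ?scale0r//; apply: contraNF ni => /eqP ni.
    by apply/eqP/val_inj; rewrite /= ni.
  rewrite nth_default// big1// => i _; rewrite eqnE ifF ?scale0r//.
  by apply/eqP => ni; move: (ltn_ord i); rewrite -ni ltnNge nl.
- by rewrite big1// => i _; rewrite scale0r.
- by rewrite IH1 IH2 -big_split /=; apply: eq_bigr => i _; rewrite scalerDl.
- by rewrite IH -sumrN; apply: eq_bigr => i _; rewrite scaleNr.
- by rewrite IH scaler_sumr; apply: eq_bigr => i _; rewrite scalerA.
Qed.

(** Unrolled by recursion instead of quantified over the index, so that [cbn] leaves one scalar
    equation per atom. *)
Fixpoint mcoef_eq n e1 e2 : Prop :=
  if n is n'.+1 then mcoef e1 n' = mcoef e2 n' /\ mcoef_eq n' e1 e2 else True.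

Lemma meval_eq env e1 e2 : mcoef_eq (size env) e1 e2 -> meval env e1 = meval env e2.
Proof.
move=> h; rewrite !mevalE; apply: eq_bigr => i _; congr (_ *: _).
case: i => i /= il; elim: (size env) il h => // n IH; rewrite ltnS leq_eqVlt /=.
by move=> /predU1P[-> []//|il [_]]; exact: IH.
Qed.

End ModuleExpressions.

(** Atoms are compared syntactically by [constr_eq]; the [match] on the dummy [Set] turns its
    failure into a fall-through to the next branch. *)
Ltac madd x env :=
  lazymatch env with
  | nil => constr:(cons x nil)
  | cons ?y ?env' =>
    match constr:(Set) with
    | _ => let _ := constr:(ltac:(constr_eq x y; exact I) : True) in env
    | _ => let r := madd x env' in constr:(cons y r)
    end
  end.

Ltac mindex x env :=
  lazymatch env with
  | cons ?y ?env' =>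
    match constr:(Set) with
    | _ => let _ := constr:(ltac:(constr_eq x y; exact I) : True) in constr:(O)
    | _ => let n := mindex x env' in constr:(S n)
    end
  end.

Ltac mvars t env :=
  lazymatch t with
  | (?x + ?y)%R => let e := mvars x env in mvars y e
  | (- ?x)%R => mvars x env
  | (?k *: ?x)%R => mvars x env
  | 0%R => env
  | ?x => madd x env
  end.

Ltac mreify K t env :=
  lazymatch t with
  | (?x + ?y)%R => let a := mreify K x env in let b := mreify K y env in constr:(@MAdd K a b)
  | (- ?x)%R => let a := mreify K x env in constr:(@MOpp K a)
  | (?k *: ?x)%R => let a := mreify K x env in constr:(@MScale K k a)
  | 0%R => constr:(@MZero K)
  | ?x => let n := mindex x env in constr:(@MVar K n)
  end.

(* Decides linear identities in a module over a commutative ring, the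
   coefficients being compared by [ring] or [field]. *)
Ltac module K V :=
  lazymatch goal with
  | |- ?l = ?r =>
    let env := mvars l (@nil V) in
    let env := mvars r env in
    let a := mreify K l env in
    let b := mreify K r env in
    let h := fresh in
    pose proof (@meval_eq K V env a b) as h;
    cbn [meval nth] in h; refine (h _); clear h; cbn [mcoef mcoef_eq size eqn];
    do ?[split]; first [ring | field]
  end.

(** * Test functions *)

Section Bump.
Variable R : realType.

(** The power of 1/x makes the family stable under derivation: the derivative of [bump k] is a
    combination of [bump k.+1] and [bump k.+2], at 0 as well. *)
Definition bump (k : nat) (x : R) : R :=
  if 0 < x then x^-1 ^+ k * expR (- x^-1) else 0.

Lemma bump_ge0 k x : 0 <= bump k x.
Proof.
rewrite /bump; case: ifPn => // x0.
by rewrite mulr_ge0 ?expR_ge0// exprn_ge0// invr_ge0 ltW.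
Qed.

(** With y = 1/x and m = k + 2, the inequality exp (y/m) >= 1 + y/m gives exp y >= (y/m)^m, so y^k
    exp (-y) is at most m^m y^-2. This settles differentiability at the gluing point 0. *)
Lemma bump_quadratic k x : `|bump k x| <= k.+2%:R ^+ k.+2 * x ^+ 2.
Proof.
rewrite ger0_norm ?bump_ge0// /bump; case: ifPn => x0; last first.
  by rewrite mulr_ge0 ?sqr_ge0// exprn_ge0.
set y := x^-1; have y0 : 0 < y by rewrite invr_gt0.
have m0 : 0 < k.+2%:R :> R by rewrite ltr0n.
have ym : (y / k.+2%:R) ^+ k.+2 <= expR y.
  have -> : expR y = expR (y / k.+2%:R) ^+ k.+2.
    by rewrite -expRM_natl mulrC divfK// gt_eqF.
  rewrite lerXn2r ?nnegrE ?expR_ge0 ?divr_ge0 ?ltW//.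
  by rewrite (lt_le_trans _ (expR_ge1Dx _))// ltrDr.
rewrite expRN ler_pdivrMr ?expR_gt0//.
have -> : y ^+ k = k.+2%:R ^+ k.+2 * x ^+ 2 * (y / k.+2%:R) ^+ k.+2.
  rewrite expr_div_n; set M := _ ^+ k.+2; have M0 : M != 0 by rewrite expf_neq0// gt_eqF.
  rewrite [y ^+ k.+2]exprS [y ^+ k.+1]exprS; move: (y ^+ k) => Y; rewrite /y.
  by field; rewrite M0 gt_eqF.
by rewrite ler_wpM2l// mulr_ge0 ?sqr_ge0// exprn_ge0.
Qed.

Lemma quadratic_is_derive0 (f : R -> R) C :
  (forall x, `|f x| <= C * x ^+ 2) -> is_derive (0 : R) 1 f 0.
Proof.
move=> fC; have f0 : f 0 = 0.
  by apply/eqP; rewrite -normr_le0 (le_trans (fC 0))// expr0n mulr0.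
have fl : h^-1 *: (f (h *: 1 + 0) - f 0) @[h --> 0^'] --> (0 : R).
  apply/cvgr0Pnorm_le => /= e e0.
  have C0 : 0 < `|C| + 1 by rewrite ltr_wpDl.
  near=> h.
  have hn : h != 0 by near: h; exact: nbhs_dnbhs_neq.
  rewrite f0 subr0 addr0 normrZ normfV scaler1.
  rewrite ler_pdivrMl ?normr_gt0// (le_trans (fC h))//.
  rewrite -(real_normK (num_real h)) expr2 mulrCA ler_wpM2l//.
  apply: (@le_trans _ _ ((`|C| + 1) * `|h|)).
    by rewrite ler_wpM2r// (le_trans (ler_norm _))// lerDl.
  rewrite -ler_pdivlMl// ltW//.
  near: h; apply: dnbhs0_lt; rewrite mulr_gt0// ?invr_gt0//.
apply: DeriveDef; first by apply/cvg_ex; exists 0.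
exact/cvg_lim.
Unshelve. all: by end_near. Qed.

Lemma is_derive_bump (k : nat) (x : R) :
  is_derive x (1 : R) (bump k) (- k%:R * bump k.+1 x + bump k.+2 x).
Proof.
have [x0|x0|<-] := ltgtP 0 x.
- apply: (@near_eq_is_derive R R R (fun x : R => x^-1 ^+ k * expR (- x^-1))).
    near=> y; rewrite /bump ifT//.
    by near: y; exact: lt_nbhsr.
  have dV : is_derive x (1 : R) (fun x : R => x^-1) (- x ^- 2).
    have xn0 : id x != 0 by rewrite /= gt_eqF.
    apply: DeriveDef; first exact: derivableV.
    by rewrite deriveV// derive_id [LHS]mulr1.
  have dX := is_deriveX k dV.
  have dE := @is_derive1_comp _ expR _ _ _ _ (is_derive_expR _) (is_deriveN dV).
  rewrite exprfctE in dX.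
  have := is_deriveM dX dE; set d := (X in is_derive _ _ _ X).
  suff -> : d = - k%:R * bump k.+1 x + bump k.+2 x by [].
  rewrite /d /bump x0 (_ : (- [eta GRing.inv]) x = - x^-1)// opprK.
  rewrite /GRing.scale /=; case: k {d dX} => [|k] /=.
    by rewrite !expr0 !mul0r mulr0 addr0 oppr0 mul0r add0r mul1r mulrC exprVn.
  rewrite !exprS; field.
  by rewrite gt_eqF.
- apply: (@near_eq_is_derive R R R (cst 0)).
    near=> y; rewrite /bump ifF//; apply/negbTE; rewrite -leNgt.
    by near: y; exact: lt_le_nbhsl.
  have : is_derive x (1 : R) (cst (0 : R)) 0 by exact: is_derive_cst.
  by rewrite /bump ltNge (ltW x0) /= mulr0 addr0.
- have := quadratic_is_derive0 (bump_quadratic k).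
  by rewrite /bump ltxx mulr0 addr0.
Unshelve. all: by end_near. Qed.

Lemma bump0_itv x : 0 <= bump 0 x <= 1.
Proof.
rewrite bump_ge0 /bump; case: ifPn => x0; last by rewrite ler01.
by rewrite expr0 mul1r -expR0 ler_expR oppr_le0 invr_ge0 ltW.
Qed.

Lemma bump_eq0 k x : x <= 0 -> bump k x = 0.
Proof. by rewrite /bump ltNge => ->. Qed.

Lemma cvg_bump0 (x : R) :
  bump 0 (n.+1%:R * x) @[n --> \oo] --> ((0 < x)%R%:R : R).
Proof.
have [x0|x0] := ltP 0 x; last first.
  apply: cvg_near_cst; apply: nearW => n.
  by rewrite bump_eq0// mulr_ge0_le0.
have : expR (- (x^-1 * n.+1%:R^-1)) @[n --> \oo] --> expR (- (x^-1 * 0)).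
  apply: continuous_cvg; first exact: continuous_expR.
  by apply: cvgN; apply: cvgMr; exact: cvg_harmonic.
rewrite mulr0 oppr0 expR0; apply: cvg_trans; apply: near_eq_cvg.
apply: nearW => n; rewrite /bump pmulr_rgt0// x0 expr0 mul1r invfM mulrC.
by [].
Qed.
End Bump.

Section Bumpy.
Variable R : realType.

Definition crd (i : 'I_3) (x : R3 R) : R :=
  if val i == 0%N then x.1.1 else if val i == 1%N then x.1.2 else x.2.

(* A class containing [box_bump] and closed under partial derivatives, so that
   smoothness follows from continuity and differentiability in the class. *)
Inductive bumpy : (R3 R -> R) -> Prop :=
| bumpy_bump k i c d : bumpy (fun x => bump k (c * crd i x + d))
| bumpy_cst a : bumpy (cst a)
| bumpyD f g : bumpy f -> bumpy g -> bumpy (f + g)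
| bumpyM f g : bumpy f -> bumpy g -> bumpy (f * g).

Lemma crd_line i (h : R) (v x : R3 R) : crd i (h *: v + x) = h * crd i v + crd i x.
Proof. by rewrite /crd; case: ifP => // _; case: ifP. Qed.

Lemma continuous_crd i : continuous (crd i).
Proof.
rewrite /crd; case: (val i == 0%N) => [x|].
  by apply: (cvg_comp fst fst); [exact: cvg_fst|exact: cvg_fst].
case: (val i == 1%N) => x; last exact: cvg_snd.
by apply: (cvg_comp fst snd); [exact: cvg_fst|exact: cvg_snd].
Qed.

Lemma is_derive_line (f : R3 R -> R) (x v : R3 R) (l : R) :
  is_derive (0 : R) 1 (fun h : R => f (h *: v + x)) l -> is_derive x v f l.
Proof.
move=> [df <-]; apply: DeriveDef; first exact/derivable1P.
rewrite /derive; set g1 := fun h => h^-1 *: _; set g2 := fun h => h^-1 *: _.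
suff -> : g1 = g2 by []; apply/funext => h; rewrite /g1 /g2 /=.
by rewrite addr0 scale0r add0r [h *: 1]mulr1.
Qed.

Lemma is_derive_bump_crd k i c d (x v : R3 R) :
  is_derive x v (fun x => bump k (c * crd i x + d))
   (c * crd i v * (- k%:R * bump k.+1 (c * crd i x + d) + bump k.+2 (c * crd i x + d))).
Proof.
apply: is_derive_line.
pose l (h : R) := (c * crd i v) * h + (c * crd i x + d).
have dl : is_derive (0 : R) 1 l (c * crd i v).
  have := is_deriveD (is_deriveZ (c * crd i v) (is_derive_id (0 : R) 1))
    (is_derive_cst (c * crd i x + d) (0 : R) 1).
  by rewrite addr0 [_ *: 1]mulr1.
have := @is_derive1_comp _ (bump k) l 0 _ _ (is_derive_bump k _) dl.
rewrite mulrC /l mulr0 add0r; congr is_derive; apply/funext => h /=.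
congr bump; rewrite crd_line; ring.
Qed.

Lemma bumpy_derive f i x : bumpy f -> derivable f x (dir R i).
Proof.
elim=> [k j c d|a|g h _ dg _ dh|g h _ dg _ dh].
- exact: (@ex_derive _ _ _ _ _ _ _ (is_derive_bump_crd k j c d x (dir R i))).
- exact: derivable_cst.
- exact: derivableD.
- exact: derivableM.
Qed.

Lemma bumpy_pderiv f i : bumpy f -> bumpy (pderiv i f).
Proof.
elim=> [k j c d|a|g h bg dg bh dh|g h bg dg bh dh].
- have -> : pderiv i (fun x => bump k (c * crd j x + d)) =
    cst (c * crd j (dir R i)) * (cst (- k%:R) * (fun x => bump k.+1 (c * crd j x + d)) +
      (fun x => bump k.+2 (c * crd j x + d))).
    by apply/funext => x; have [_] := is_derive_bump_crd k j c d x (dir R i).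
  do ![apply: bumpyM|apply: bumpyD|exact: bumpy_cst|exact: bumpy_bump].
- have -> : pderiv i (cst a) = cst 0 by apply/funext => x; exact: derive_cst.
  exact: bumpy_cst.
- have -> : pderiv i (g + h) = pderiv i g + pderiv i h.
    by apply/funext => x; apply: deriveD; exact: bumpy_derive.
  exact: bumpyD.
- have -> : pderiv i (g * h) = g * pderiv i h + h * pderiv i g.
    by apply/funext => x; apply: deriveM; exact: bumpy_derive.
  by apply: bumpyD; exact: bumpyM.
Qed.

Lemma continuous_bump k : continuous (@bump R k).
Proof.
move=> x; apply/differentiable_continuous/derivable1_diffP.
exact: (@ex_derive _ _ _ _ _ _ _ (is_derive_bump k x)).
Qed.

Lemma bumpy_continuous f : bumpy f -> continuous f.
Proof.
elim=> [k j c d|a|g h _ dg _ dh|g h _ dg _ dh] x.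
- apply: (@continuous_comp _ _ _ (fun x => c * crd j x + d) (bump k));
    last exact: continuous_bump.
  apply: cvgD; last exact: cvg_cst.
  apply: cvgM; [exact: cvg_cst|exact: continuous_crd].
- exact: cvg_cst.
- by apply: cvgD; [exact: dg|exact: dh].
- by apply: cvgM; [exact: dg|exact: dh].
Qed.

Lemma bumpy_smooth f : bumpy f -> smooth f.
Proof.
move=> bf s; have {bf}bs : bumpy (foldr (@pderiv R) f s).
  by elim: s => //= i s; exact: bumpy_pderiv.
by split=> [|i x]; [exact: bumpy_continuous|exact: bumpy_derive].
Qed.

(* Converges pointwise to the indicator of the box of corners [a] and [b]. *)
Definition box_bump (a b : R3 R) (n : nat) (x : R3 R) : R :=
  \prod_(i < 3) (bump 0 (n.+1%:R * (crd i x - crd i a)) *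
                 bump 0 (n.+1%:R * (crd i b - crd i x))).

Definition box (a b : R3 R) : set (R3 R) :=
  [set x | forall i, crd i a < crd i x < crd i b].

Lemma box_bumpE a b n x : box_bump a b n x =
  \prod_(i < 3) (bump 0 (n.+1%:R * crd i x + - (n.+1%:R * crd i a)) *
                 bump 0 (- n.+1%:R * crd i x + n.+1%:R * crd i b)).
Proof. by apply: eq_bigr => i _; congr (bump _ _ * bump _ _); ring. Qed.

Lemma bumpy_box a b n : bumpy (box_bump a b n).
Proof.
rewrite (_ : box_bump a b n = \prod_(i < 3)
  ((fun x => bump 0 (n.+1%:R * crd i x + - (n.+1%:R * crd i a))) *
   (fun x => bump 0 (- n.+1%:R * crd i x + n.+1%:R * crd i b)))).
  by elim/big_ind: _ => [|f g bf bg|i _]; [exact: (bumpy_cst 1)|exact: bumpyM|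
    apply: bumpyM; exact: bumpy_bump].
by apply/funext => x; rewrite box_bumpE fct_prodE.
Qed.

Lemma box_bump_itv a b n x : 0 <= box_bump a b n x <= 1.
Proof.
rewrite /box_bump; elim/big_ind : _ => [|r s /andP[r0 r1] /andP[s0 s1]|i _].
- by rewrite ler01 lexx.
- by rewrite mulr_ge0// mulr_ile1.
- by rewrite mulr_ge0 ?mulr_ile1 ?bump_ge0//; case/andP: (bump0_itv (n.+1%:R * (crd i x - crd i a)));
    case/andP: (bump0_itv (n.+1%:R * (crd i b - crd i x))).
Qed.

Lemma box_bump_out a b n x : ~ box a b x -> box_bump a b n x = 0.
Proof.
move=> /existsNP[i /negP]; rewrite negb_and -!leNgt => ab.
rewrite /box_bump (bigD1 i)//=.
have [ai|ib] := orP ab.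
  by rewrite bump_eq0 ?mul0r// mulr_ge0_le0// subr_le0.
by rewrite (@bump_eq0 _ _ (_ * (crd i b - _))) ?mulr0 ?mul0r// mulr_ge0_le0// subr_le0.
Qed.

Lemma cvg_box_bump a b x :
  box_bump a b n x @[n --> \oo] --> (\1_(box a b) x : R).
Proof.
have [xab|xab] := pselect (box a b x); last first.
  rewrite indicE memNset//; apply: cvg_near_cst; apply: nearW => n.
  by rewrite box_bump_out.
rewrite indicE mem_set//=.
have H i : bump 0 (n.+1%:R * (crd i x - crd i a)) *
    bump 0 (n.+1%:R * (crd i b - crd i x)) @[n --> \oo] --> (1 : R).
  have /andP[ai ib] := xab i; rewrite -[X in _ --> X]mul1r.
  by apply: cvgM; [have := @cvg_bump0 R (crd i x - crd i a)|
    have := @cvg_bump0 R (crd i b - crd i x)]; rewrite subr_gt0 ?ai ?ib.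
rewrite (_ : 1%:R = 1 * (1 * (1 * 1)) :> R)%R; last by rewrite !mulr1.
under eq_fun do rewrite /box_bump !big_ord_recl big_ord0.
by do ![apply: cvgM; first exact: H]; exact: cvg_cst.
Qed.

Lemma boxE a b : box a b =
  (`]a.1.1, b.1.1[%classic `*` `]a.1.2, b.1.2[%classic) `*` `]a.2, b.2[%classic.
Proof.
apply/seteqP; split=> [x xab|[[x y] z] [[/= xi yi] zi] i].
  by split; [split|]; rewrite /= in_itv/=; [have := xab 0|have := xab 1|have := xab 2].
by move: xi yi zi; rewrite !in_itv/= /crd; case: i => [[|[|[|]]]].
Qed.

Lemma box_bump_test a b n : test_function (box_bump a b n).
Proof.
split; first exact/bumpy_smooth/bumpy_box.
pose K : set (R3 R) :=
  (`[a.1.1, b.1.1]%classic `*` `[a.1.2, b.1.2]%classic) `*` `[a.2, b.2]%classic.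
have cK : compact K by do 2?apply: compact_setX; exact: segment_compact.
apply: (subclosed_compact _ cK); first exact: closed_closure.
have clK : closed K by exact: compact_closed.
rewrite [X in _ `<=` X]((closure_id _).1 clK).
apply: closure_subset => x /= /eqP xn0.
have : box a b x by apply: contrapT => /(box_bump_out n).
rewrite boxE => -[[x1 x2] x3]; split; [split|];
  exact: subset_itvW x1 || exact: subset_itvW x2 || exact: subset_itvW x3.
Qed.

End Bumpy.

(** * Uniqueness of weak derivatives *)

Section BoxMeasure.
Variable R : realType.
Implicit Types (a b x : R3 R).

Lemma measurable_box a b : measurable (box a b).
Proof. by rewrite boxE; apply: measurableX; [apply: measurableX|]; exact: measurable_itv. Qed.

Lemma leb3_box_fin_num a b : (leb3 R) (box a b) \is a fin_num.
Proof.
have m (r s : R) : measurable `]r, s[%classic by exact: measurable_itv.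
have l (r s : R) : (@lebesgue_measure R) `]r, s[%classic \is a fin_num.
  by rewrite lebesgue_measure_itv /=; case: ifP.
rewrite boxE.
have -> := product_measure1E (lebesgue_measure \x lebesgue_measure)%E
  lebesgue_measure (measurableX (m _ _) (m _ _)) (m _ _).
apply: fin_numM.
- have := product_measure1E (@lebesgue_measure R) lebesgue_measure (m a.1.1 b.1.1) (m a.1.2 b.1.2).
  move=> /(congr1 (fun z => z \is a fin_num)) E; apply: (etrans E).
  by apply: fin_numM; exact: l.
- exact: l.
Qed.

(** Badly ordered corners describe the empty box, so disjoint boxes need no separate case. *)
Lemma setI_closed_box : setI_closed (range (fun ab : R3 R * R3 R => box ab.1 ab.2)).
Proof.
move=> _ _ [[a b] _ <-] [[a' b'] _ <-] /=.
pose c : R3 R := (Num.max a.1.1 a'.1.1, Num.max a.1.2 a'.1.2, Num.max a.2 a'.2).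
pose d : R3 R := (Num.min b.1.1 b'.1.1, Num.min b.1.2 b'.1.2, Num.min b.2 b'.2).
have cE i : crd i c = Num.max (crd i a) (crd i a').
  by rewrite /crd; case: ifP => // _; case: ifP.
have dE i : crd i d = Num.min (crd i b) (crd i b').
  by rewrite /crd; case: ifP => // _; case: ifP.
exists (c, d) => //; apply/seteqP; split=> [x xcd|x [xab xab'] i] /=.
  by split=> i; have := xcd i; rewrite /= cE dE gt_max lt_min => /andP[/andP[? ?] /andP[? ?]]; apply/andP.
by rewrite cE dE gt_max lt_min; have /andP[-> ->] := xab i; have /andP[-> ->] := xab' i.
Qed.

Definition cube (n : nat) : set (R3 R) :=
  box (- n.+1%:R, - n.+1%:R, - n.+1%:R) (n.+1%:R, n.+1%:R, n.+1%:R).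

Lemma cubeP n x : (forall i, `|crd i x| < n.+1%:R) -> cube n x.
Proof. by move=> xn i; have := xn i; rewrite ltr_norml /crd/=; case: i => [[|[|[|]]]]. Qed.

Lemma cube_cover : \bigcup_n cube n = setT.
Proof.
apply/seteqP; split=> // x _.
pose m := Num.max `|crd 0 x| (Num.max `|crd 1 x| `|crd 2 x|).
exists (Num.trunc m) => //; apply: cubeP => i.
apply: le_lt_trans (truncnS_gt m).
rewrite /m !le_max; case: i => [[|[|[|//]]]] ?; apply/orP;
  [left|right; apply/orP; left|right; apply/orP; right]; rewrite le_eqVlt; apply/orP; left; apply/eqP;
  congr `|crd _ x|; exact/val_inj.
Qed.

(** For the hard inclusion, the identity out of the sigma-algebra generated by boxes is measurable
    because each coordinate is: the preimage of an interval is the union of the boxes that have this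
    interval as one side and growing intervals as the others. *)
Lemma measurable_boxE :
  (measurable : set (set (R3 R))) = <<s range (fun ab : R3 R * R3 R => box ab.1 ab.2) >>.
Proof.
set G := range _; apply/seteqP; split; last first.
  apply: smallest_sub; first exact: sigma_algebra_measurable.
  by move=> _ [[a b] _ <-]; exact: measurable_box.
pose T := g_sigma_algebraType G.
have mc i : measurable_fun [set: T] (crd i : T -> R).
  apply: (measurability _ (RGenOpens.measurableE R)) => _ [_ [r [s ->] <-]].
  pose a n : R3 R := (if i == 0 then r else - n.+1%:R, if i == 1 then r else - n.+1%:R,
    if i == 2 then r else - n.+1%:R).
  pose b n : R3 R := (if i == 0 then s else n.+1%:R, if i == 1 then s else n.+1%:R,
    if i == 2 then s else n.+1%:R).
  rewrite setTI (_ : _ @^-1` _ = \bigcup_n (box (a n) (b n) : set T)).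
    by apply: bigcupT_measurable => n; apply: sub_sigma_algebra; exists (a n, b n).
  have aE n j : crd j (a n) = if i == j then r else - n.+1%:R.
    by rewrite /a /crd; case: j => [[|[|[|//]]]] ? /=; congr (if i == _ then _ else _); exact: val_inj.
  have bE n j : crd j (b n) = if i == j then s else n.+1%:R.
    by rewrite /b /crd; case: j => [[|[|[|//]]]] ? /=; congr (if i == _ then _ else _); exact: val_inj.
  apply/seteqP; split=> [x xrs|x [n _ /(_ i)]]; last first.
    by rewrite /= in_itv /= aE bE eqxx.
  have [n _ xn] : (\bigcup_n cube n) (x : R3 R) by rewrite cube_cover.
  exists n => // j.
  rewrite aE bE; case: eqP => [<-|_]; first by move: xrs; rewrite /= in_itv.
  by have := xn j; rewrite /crd /=; case: j => [[|[|[|]]]].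
have mid : measurable_fun [set: T] (id : T -> R3 R).
  apply/measurable_fun_pairP; split; [apply/measurable_fun_pairP; split|].
  - exact: (mc 0).
  - exact: (mc 1).
  - exact: (mc 2).
by move=> A mA; have := mid measurableT _ mA; rewrite setTI.
Qed.

End BoxMeasure.

Section NngDensity.
Context d (T : measurableType d) (R : realType) (mu : {measure set T -> \bar R}).
Variable f : T -> \bar R.
Hypotheses (mf : measurable_fun setT f) (f0 : forall x, (0 <= f x)%E).

(** The two proofs are arguments so that the measure structure, which depends on them, can be
    inferred from the term. *)
Definition nng_density of measurable_fun setT f & (forall x, (0 <= f x)%E) :=
  fun A : set T => (\int[mu]_(t in A) f t)%E.

Let nng_density0 : nng_density mf f0 set0 = 0%E.
Proof. exact: integral_set0. Qed.

Let nng_density_ge0 A : (0 <= nng_density mf f0 A)%E.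
Proof. by apply: integral_ge0 => x _; exact: f0. Qed.

Let nng_density_sigma_additive : semi_sigma_additive (nng_density mf f0).
Proof. exact: semi_sigma_additive_nng_induced. Qed.

HB.instance Definition _ := isMeasure.Build d T R (nng_density mf f0)
  nng_density0 nng_density_ge0 nng_density_sigma_additive.

End NngDensity.

Section VanishingIntegrals.
Context d (T : measurableType d) (R : realType) (mu : {measure set T -> \bar R}).
Variable u : T -> R.
Hypothesis mu_u : measurable_fun setT u.

Lemma patch_indic (B : set T) : (EFin \o u) \_ B = EFin \o (u \* \1_B).
Proof.
apply/funext => x; rewrite patchE /= indicE; case: ifP => _ /=.
  by rewrite mulr1.
by rewrite mulr0.
Qed.

Lemma integrable_mul_indic (B : set T) : measurable B ->
  mu.-integrable setT (EFin \o (u \* \1_B)) -> mu.-integrable B (EFin \o u).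
Proof. by move=> mB; rewrite -patch_indic => /(integrable_mkcond _ mB). Qed.

(** Dominated convergence, with |u| times the indicator of [B] as the dominating function. *)
Lemma integral_indic_limit_eq0 (B : set T) (eta : nat -> T -> R) :
  measurable B -> mu.-integrable setT (EFin \o (u \* \1_B)) ->
  (forall n, measurable_fun setT (eta n)) ->
  (forall n x, `|eta n x| <= \1_B x) ->
  (forall x, eta n x @[n --> \oo] --> (\1_B x : R)) ->
  (forall n, mu.-integrable setT (EFin \o (u \* eta n))) ->
  (forall n, \int[mu]_x (u x * eta n x) = 0) ->
  (\int[mu]_(x in B) (u x)%:E = 0)%E.
Proof.
move=> mB iB meta etaB cveta ieta int0.
rewrite integral_mkcond (_ : _ \_ _ = EFin \o (u \* \1_B)); last exact: patch_indic.
pose f_ n x := (u x * eta n x)%:E.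
pose g x := (`|u x * \1_B x|)%:E.
have [|||||_ _ h] := @dominated_convergence _ _ _ mu setT measurableT f_
  (EFin \o (u \* \1_B)) g.
- by move=> n; apply/measurable_EFinP/measurable_funM.
- exact: measurable_int iB.
- apply: aeW => x _; apply: cvg_EFin; first exact: nearW.
  by apply: cvgM; [exact: cvg_cst|exact: cveta].
- exact: integrable_abse iB.
- apply: aeW => x n _; rewrite lee_fin !normrM ler_wpM2l//.
  by rewrite (le_trans (etaB n x))// ler_norm.
suff h0 : [sequence (\int[mu]_x f_ n x)%E]_n = cst 0%E.
  by rewrite h0 in h; apply: cvg_unique h _ => //; exact: cvg_cst.
(* A vanishing real-valued integral could hide an infinite one, which integrability excludes. *)
apply/funext => n /=; have := int0 n; rewrite /Rintegral.
have /(integrable_fin_num measurableT) := ieta n; rewrite /f_ /=.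
by move: (integral _ _ _) => [r||]//= _ ->.
Qed.

(** The positive and negative parts of [u] are densities of two measures that are finite and equal
    on the pi-system [G], hence equal on all measurable sets. The covering by the [g n] keeps the
    argument within sets of finite measure. *)
Lemma ae_eq0_pi_system (G : set (set T)) (g : nat -> set T) :
  measurable = <<s G >> -> setI_closed G -> (forall n, G (g n)) ->
  \bigcup_n g n = setT ->
  (forall B, G B -> mu.-integrable B (EFin \o u)) ->
  (forall B, G B -> (\int[mu]_(x in B) (u x)%:E = 0)%E) ->
  {ae mu, forall x, u x = 0}.
Proof.
move=> mG GI Gg gT iG int0; have mG' B : G B -> measurable B.
  by move=> GB; rewrite mG; exact: sub_sigma_algebra.
pose f := EFin \o u.
have mf : measurable_fun setT f by exact/measurable_EFinP.
have mp : measurable_fun setT f^\+%E by exact: measurable_funepos.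
have mn : measurable_fun setT f^\-%E by exact: measurable_funeneg.
pose m1 := nng_density mu mp (funepos_ge0 f).
pose m2 := nng_density mu mn (funeneg_ge0 f).
have fin1 B : G B -> m1 B \is a fin_num.
  move=> GB; apply: integrable_fin_num; first exact: mG'.
  by apply: integrable_funepos (iG _ GB); exact: mG'.
have fin2 B : G B -> m2 B \is a fin_num.
  move=> GB; apply: integrable_fin_num; first exact: mG'.
  by apply: integrable_funeneg (iG _ GB); exact: mG'.
have m12 A : measurable A -> m1 A = m2 A.
  apply: (measure_unique G g) => // [B GB|n]; last by rewrite ltey_eq fin1.
  have := int0 _ GB; rewrite integralE => h; change (m1 B = m2 B).
  have {h} : (m1 B - m2 B = 0)%E by exact: h.
  have := fin1 _ GB; have := fin2 _ GB.
  case: (m1 B) (m2 B) => [x||] [y||]// _ _ /eqP.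
  by rewrite -EFinB eqe subr_eq0 => /eqP ->.
(* Equality of the two measures says that [u] has zero integral over every measurable subset of
   [g n]. *)
have aeB n : ae_eq mu (g n) f (cst 0%E).
  apply: integral_ae_eq => //; [exact: mG'|exact: iG|].
  move=> E Eg mE; rewrite integral0 integralE.
  rewrite [X in (X - _)%E](_ : _ = m1 E)// (m12 E mE) subee//.
  apply: integrable_fin_num => //; apply: integrable_funeneg => //.
  by apply: integrableS (iG _ (Gg n)) => //; exact: mG'.
have : {ae mu, forall x n, g n x -> f x = cst 0%E x} by exact/ae_foralln.
apply: filterS => x fx; have [n _ xn] : (\bigcup_n g n) x by rewrite gT.
by have [] := fx n xn.
Qed.

End VanishingIntegrals.

Section FundamentalLemma.
Variable R : realType.
Variable u : R3 R -> R.
Hypothesis uL : u \in Lfun (leb3 R) 2%:E.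
Hypothesis u_test : forall eta, test_function eta ->
  \int[leb3 R]_x (u x * eta x) = 0.

Lemma indic_box_Lfun (a b : R3 R) : \1_(box a b) \in Lfun (leb3 R) 2%:E.
Proof.
rewrite inE; apply/andP; split; rewrite inE/=.
  by apply: measurable_indic; exact: measurable_box.
rewrite /finite_norm unlock /Lnorm poweR_lty//=.
apply: (@le_lt_trans _ _ (\int[leb3 R]_x (\1_(box a b) x)%:E)%E).
  rewrite le_eqVlt; apply/orP; left; apply/eqP.
  apply: eq_integral => x _; rewrite !indicE; case: (_ \in _) => /=.
    by rewrite normr1 powR1.
  by rewrite normr0 powR0// pnatr_eq0.
rewrite integral_indic//; last exact: measurable_box.
by rewrite setIT ltey_eq leb3_box_fin_num.
Qed.

Let mL (v : R3 R -> R) : v \in Lfun (leb3 R) 2%:E -> measurable_fun setT v.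
Proof. by rewrite inE => /andP[]; rewrite inE. Qed.

Let iL (v : R3 R -> R) : v \in Lfun (leb3 R) 2%:E ->
  (leb3 R).-integrable setT (EFin \o (u \* v)).
Proof. by move=> vL; apply/Lfun1_integrable; exact: Lfun2_mul_Lfun1. Qed.

(** A square-integrable [u] need not be integrable on the whole space, but its product with the
    indicator of a box is, the indicator being square-integrable too; hence the argument through
    boxes. *)
Lemma test_ae_eq0 : {ae leb3 R, forall x, u x = 0}.
Proof.
apply: (@ae_eq0_pi_system _ _ R (leb3 R) u (mL uL) _ (@cube R)).
- exact: measurable_boxE.
- exact: setI_closed_box.
- by move=> n; exists ((- n.+1%:R, - n.+1%:R, - n.+1%:R), (n.+1%:R, n.+1%:R, n.+1%:R)).
- exact: cube_cover.
- move=> _ [[a b] _ <-]; apply: integrable_mul_indic; first exact: measurable_box.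
  exact/iL/indic_box_Lfun.
- move=> _ [[a b] _ <-] /=; apply: (@integral_indic_limit_eq0 _ _ R (leb3 R) u (mL uL) _ (box_bump a b)).
  + exact: measurable_box.
  + exact/iL/indic_box_Lfun.
  + by move=> n; apply: mL; exact: test_Lfun (box_bump_test a b n).
  + move=> n x; have [xab|xab] := pselect (box a b x); last by rewrite box_bump_out// normr0 indicE.
    by rewrite indicE mem_set//=; have /andP[? ?] := box_bump_itv a b n x; rewrite ger0_norm.
  + exact: cvg_box_bump.
  + by move=> n; apply: iL; exact: test_Lfun (box_bump_test a b n).
  + by move=> n; exact: u_test (box_bump_test a b n).
Qed.

End FundamentalLemma.

Section RintegralZero.
Context d (T : measurableType d) (R : realType) (mu : {measure set T -> \bar R}).
Variable u : T -> R.
Hypothesis iu : mu.-integrable setT (EFin \o u).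

Let mu_u : measurable_fun setT (EFin \o u).
Proof. exact: measurable_int iu. Qed.

Lemma Rintegral_ae_eq0 : {ae mu, forall x, u x = 0} -> \int[mu]_x u x = 0.
Proof.
move=> u0; apply/eqP; rewrite -normr_le0.
rewrite (le_trans (le_normr_Rintegral measurableT iu))// /Rintegral.
have /= -> := (ae_eq_integral_abs mu measurableT mu_u).2.
  by [].
by apply: filterS u0 => x /= ->.
Qed.

Lemma Rintegral_nneg_eq0 : (forall x, 0 <= u x) -> \int[mu]_x u x = 0 ->
  {ae mu, forall x, u x = 0}.
Proof.
move=> u0 int0.
have : (\int[mu]_x `|(EFin \o u) x| = 0)%E.
  move: int0; rewrite /Rintegral.
  have := integrable_fin_num measurableT iu.
  have -> : (\int[mu]_x `|(EFin \o u) x| = \int[mu]_x (u x)%:E)%E.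
    by apply: eq_integral => x _; rewrite /= ger0_norm.
  by move: (integral _ _ _) => [r||]//= _ ->.
move=> /(ae_eq_integral_abs mu measurableT mu_u); apply: filterS => x /= /(_ I).
by case.
Qed.

End RintegralZero.

(** * The L^2 form on square-integrable functions *)

Section L2Form.
Variable R : realType.
Implicit Types (f g h : R3 R -> R[i]^o) (a : R[i]).

Lemma ae_imp (P Q : R3 R -> Prop) : (forall x, P x -> Q x) ->
  {ae leb3 R, forall x, P x} -> {ae leb3 R, forall x, Q x}.
Proof. by have F := ae_filter_ringOfSetsType (leb3 R); exact: filterS. Qed.

Lemma ae_imp2 (P Q S : R3 R -> Prop) : (forall x, P x -> Q x -> S x) ->
  {ae leb3 R, forall x, P x} -> {ae leb3 R, forall x, Q x} ->
  {ae leb3 R, forall x, S x}.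
Proof. by have F := ae_filter_ringOfSetsType (leb3 R); exact: filterS2. Qed.

Lemma L2_lin a f g : L2 f -> L2 g -> L2 (a *: f + g).
Proof. by move=> Lf Lg; apply: Lp_lin Lf Lg; rewrite lee_fin ler1n. Qed.

Lemma L2_mul_conj f g : L2 f -> L2 g -> Lp 1 (fun x => f x * ((g x)^*)%C).
Proof.
move=> [fr fi] [gr gi]; have [_ LD] := Lfun_submod_closed (leb3 R) (lexx 1%E).
split.
  have := LD 1 _ _ (Lfun2_mul_Lfun1 fr gr) (Lfun2_mul_Lfun1 fi gi).
  move/LfunE; apply => x.
  rewrite [LHS](_ : _ = 1 * (complex.Re (f x) * complex.Re (g x)) +
    complex.Im (f x) * complex.Im (g x))// mul1r cReM.
  by case: (g x) => c d /=; rewrite mulrN opprK.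
have := LD (-1) _ _ (Lfun2_mul_Lfun1 fr gi) (Lfun2_mul_Lfun1 fi gr).
move/LfunE; apply => x.
rewrite [LHS](_ : _ = -1 * (complex.Re (f x) * complex.Im (g x)) +
  complex.Im (f x) * complex.Re (g x))// mulN1r cImM.
by case: (g x) => c d /=; rewrite mulrN.
Qed.

Lemma Lp1_integrable h : Lp 1 h ->
  (leb3 R).-integrable setT (EFin \o (fun x => complex.Re (h x))) /\
  (leb3 R).-integrable setT (EFin \o (fun x => complex.Im (h x))).
Proof. by case=> /Lfun1_integrable ? /Lfun1_integrable ?. Qed.

Lemma cint_ae0 h : Lp 1 h -> ae_zero h -> cint h = 0.
Proof.
move=> /Lp1_integrable[hr hi] h0; rewrite /cint.
apply/eqP; rewrite eq_complex /=; apply/andP; split; apply/eqP.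
  by apply: (Rintegral_ae_eq0 hr); apply: ae_imp h0 => x ->.
by apply: (Rintegral_ae_eq0 hi); apply: ae_imp h0 => x ->.
Qed.

Lemma L2dot_linl a f g h : L2 f -> L2 g -> L2 h ->
  L2dot (a *: f + g) h = a * L2dot f h + L2dot g h.
Proof.
move=> Lf Lg Lh; rewrite /L2dot -cint_lin; [|exact: L2_mul_conj|exact: L2_mul_conj].
congr cint; apply/funext => x.
by rewrite [LHS]mulrDl -[X in X + _]mulrA.
Qed.

Lemma L2dotC f g : L2 f -> L2 g -> L2dot g f = ((L2dot f g)^*)%C.
Proof.
move=> Lf Lg; have [_ ii] := Lp1_integrable (L2_mul_conj Lf Lg).
rewrite /L2dot /cint /=; apply/eqP; rewrite eq_complex /=; apply/andP; split; apply/eqP.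
  by apply: eq_Rintegral => x _; rewrite !cReM; case: (f x) (g x) => ? ? [? ?] /=; ring.
rewrite -mulN1r -RintegralZl//.
by apply: eq_Rintegral => x _; rewrite !cImM; case: (f x) (g x) => ? ? [? ?] /=; ring.
Qed.

Lemma L2dot_ae0 f g : L2 f -> L2 g -> ae_zero f -> L2dot f g = 0.
Proof.
move=> Lf Lg f0; apply: cint_ae0; first exact: L2_mul_conj.
by apply: ae_imp f0 => x ->; rewrite mul0r.
Qed.

Lemma L2dot_ge0 f : L2 f -> 0 <= L2dot f f.
Proof.
move=> Lf; have := L2dotC Lf Lf => /eqP; rewrite eq_complex /= => /andP[_ /eqP im].
rewrite lecE /=; apply/andP; split.
  by rewrite -eqNr eq_sym; apply/eqP; exact: im.
apply: Rintegral_ge0 => x _; rewrite cReM; case: (f x) => c d /=.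
by rewrite mulrN opprK -!expr2 addr_ge0 ?sqr_ge0.
Qed.

Lemma L2dot_eq0 f : L2 f -> L2dot f f = 0 -> ae_zero f.
Proof.
move=> Lf; have [ir _] := Lp1_integrable (L2_mul_conj Lf Lf).
move=> /(congr1 (@complex.Re R)) /=.
have f2 x : complex.Re (f x * ((f x)^*)%C) = complex.Re (f x) ^+ 2 + complex.Im (f x) ^+ 2.
  by rewrite cReM; case: (f x) => c d /=; rewrite mulrN opprK -!expr2.
move=> /(Rintegral_nneg_eq0 ir) h; apply: ae_imp (h _) => x /=; rewrite f2; last first.
  by rewrite addr_ge0 ?sqr_ge0.
case: (f x) => c d /= /eqP; rewrite paddr_eq0 ?sqr_ge0// !sqrf_eq0.
by move=> /andP[/eqP -> /eqP ->].
Qed.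

Lemma cint_test_ae0 h : L2 h ->
  (forall eta, test_function eta -> cint (fun x => h x * ((eta x)%:C)%C) = 0) ->
  ae_zero h.
Proof.
move=> [hr hi] h0.
have r0 : {ae leb3 R, forall x, complex.Re (h x) = 0}.
  apply: test_ae_eq0 => // eta /h0 /(congr1 (@complex.Re R)) /=.
  by move=> E; rewrite -[RHS]E; apply: eq_Rintegral => x _; rewrite cReM /= mulr0 subr0.
have i0 : {ae leb3 R, forall x, complex.Im (h x) = 0}.
  apply: test_ae_eq0 => // eta /h0 /(congr1 (@complex.Im R)) /=.
  by move=> E; rewrite -[RHS]E; apply: eq_Rintegral => x _; rewrite cImM /= mulr0 add0r.
by apply: ae_imp2 r0 i0 => x; case: (h x) => c d /= -> ->.
Qed.

Lemma weak_partial_lin i a f f' g g' : L2 f -> L2 f' -> L2 g -> L2 g' ->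
  weak_partial i f g -> weak_partial i f' g' ->
  weak_partial i (a *: f + f') (a *: g + g').
Proof.
move=> Lf Lf' Lg Lg' fg fg' eta te.
have E h h' u : (fun x => (a *: h + h') x * ((u x)%:C)%C) =
    a *: (fun x => h x * ((u x)%:C)%C) + (fun x => h' x * ((u x)%:C)%C) :> (_ -> R[i]^o).
  apply/funext => x; rewrite [LHS]mulrDl; congr (_ + _); exact: esym (mulrA _ _ _).
have [e0 e1] := conj (test_Lfun te) (test_pderiv_Lfun i te).
rewrite !E (cint_lin _ (L2M Lf e1) (L2M Lf' e1)).
rewrite (cint_lin _ (L2M Lg e0) (L2M Lg' e0)).
by rewrite fg// fg'// mulrN opprD.
Qed.

(** Applied to differences, this is the uniqueness of weak derivatives: the pairing of [g] with
    every test function vanishes. *)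
Lemma weak_partial_ae0 i f g : L2 f -> L2 g -> ae_zero f ->
  weak_partial i f g -> ae_zero g.
Proof.
move=> Lf Lg f0 fg; apply: cint_test_ae0 => // eta te.
apply: oppr_inj; rewrite -fg// oppr0; apply: cint_ae0.
  by apply: L2M => //; exact: test_pderiv_Lfun.
by apply: ae_imp f0 => x ->; rewrite mul0r.
Qed.

Lemma wderivP i f : f \in @H1fun R -> L2 (wderiv i f) /\ weak_partial i f (wderiv i f).
Proof.
move=> /H1funP[_ /(_ i)[g Lg fg]].
by apply: (@xgetPex _ (cst 0) [set g | L2 g /\ weak_partial i f g]); exists g.
Qed.

End L2Form.

Notation cabs z := (complex.Re `|z|).

(** * Inner products *)

Section ComplexModulus.
Variable R : realType.
Implicit Types a b : R[i].

Lemma cabsE a : cabs a = Num.sqrt (complex.Re a ^+ 2 + complex.Im a ^+ 2).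
Proof. by rewrite normc_def. Qed.

Lemma cabs_ge0 a : 0 <= cabs a.
Proof. by rewrite cabsE sqrtr_ge0. Qed.

Lemma sqr_cabs a : cabs a ^+ 2 = complex.Re a ^+ 2 + complex.Im a ^+ 2.
Proof. by rewrite cabsE sqr_sqrtr// addr_ge0 ?sqr_ge0. Qed.

Lemma cabs_real (r : R) : cabs (r%:C)%C = `|r|.
Proof. by rewrite cabsE /= expr0n addr0 sqrtr_sqr. Qed.

Lemma mulc_conj a : a * (a^*)%C = ((cabs a ^+ 2)%:C)%C.
Proof. by rewrite sqr_cabs; case: a => x y; apply/eqP; rewrite eq_complex/=; apply/andP; split; apply/eqP; ring. Qed.

Lemma Re_le_cabs a : complex.Re a <= cabs a.
Proof.
rewrite (le_trans (ler_norm _))// cabsE -sqrtr_sqr ler_wsqrtr//.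
by rewrite lerDl sqr_ge0.
Qed.

End ComplexModulus.

Section InnerProduct.
Variables (R : realType) (V : lmodType R[i]).
Implicit Types (b : V -> V -> R[i]) (x y z : V) (a : R[i]).

(** Abstract in the form, so that Cauchy-Schwarz and the triangle inequality serve both [l2dot] and
    [h1dot]. *)
Record inner_product b : Prop := InnerProduct {
  ip_linl : forall a x y z, b (a *: x + y) z = a * b x z + b y z;
  ip_conj : forall x y, b y x = ((b x y)^*)%C;
  ip_ge0 : forall x, 0 <= b x x;
  ip_eq0 : forall x, b x x = 0 -> x = 0 }.

Definition ip_norm b x : R := Num.sqrt (complex.Re (b x x)).

Variables (b : V -> V -> R[i]) (ipb : inner_product b).

Lemma ipDl x y z : b (x + y) z = b x z + b y z.
Proof. by have := ip_linl ipb 1 x y z; rewrite scale1r mul1r. Qed.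

Lemma ip0l z : b 0 z = 0.
Proof. by have := ipDl 0 0 z; rewrite addr0 => /eqP; rewrite -subr_eq subrr eq_sym => /eqP. Qed.

Lemma ipZl a x z : b (a *: x) z = a * b x z.
Proof. by have := ip_linl ipb a x 0 z; rewrite !addr0 ip0l addr0. Qed.

Lemma ipNl x z : b (- x) z = - b x z.
Proof. by rewrite -scaleN1r ipZl mulN1r. Qed.

Lemma ipBl x y z : b (x - y) z = b x z - b y z.
Proof. by rewrite ipDl ipNl. Qed.

Lemma ip_suml (I : Type) (r : seq I) (P : pred I) (F : I -> V) z :
  b (\sum_(i <- r | P i) F i) z = \sum_(i <- r | P i) b (F i) z.
Proof.
by elim/big_rec2 : _ => [|i x y _ <-]; rewrite ?ip0l// ipDl.
Qed.

Lemma ipDr x y z : b x (y + z) = b x y + b x z.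
Proof. by rewrite (ip_conj ipb (y + z)) ipDl rmorphD /= -!(ip_conj ipb). Qed.

Lemma ip0r x : b x 0 = 0.
Proof. by rewrite (ip_conj ipb 0) ip0l conjc0. Qed.

Lemma ipZr a x y : b x (a *: y) = (a^*)%C * b x y.
Proof. by rewrite (ip_conj ipb (a *: y)) ipZl rmorphM /= -(ip_conj ipb). Qed.

Lemma ipNr x z : b x (- z) = - b x z.
Proof. by rewrite (ip_conj ipb (- z)) ipNl rmorphN /= -(ip_conj ipb). Qed.

Lemma ipBr x y z : b x (y - z) = b x y - b x z.
Proof. by rewrite ipDr ipNr. Qed.

Lemma ip_sumr (I : Type) (r : seq I) (P : pred I) (F : I -> V) z :
  b z (\sum_(i <- r | P i) F i) = \sum_(i <- r | P i) b z (F i).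
Proof.
by elim/big_rec2 : _ => [|i x y _ <-]; rewrite ?ip0r// ipDr.
Qed.

Lemma ip_norm_ge0 x : 0 <= ip_norm b x. Proof. exact: sqrtr_ge0. Qed.

Lemma ip_self x : b x x = ((ip_norm b x ^+ 2)%:C)%C.
Proof.
have := ip_ge0 ipb x; rewrite lecE => /andP[/eqP im re].
rewrite sqr_sqrtr//; apply/eqP; rewrite eq_complex /= eqxx /=; exact/eqP/im.
Qed.

Lemma ip_norm_eq0 x : ip_norm b x = 0 -> x = 0.
Proof. by move=> x0; apply: (ip_eq0 ipb); rewrite ip_self x0 expr0n. Qed.

Lemma ip_norm0 : ip_norm b 0 = 0.
Proof. by rewrite /ip_norm ip0l sqrtr0. Qed.

Lemma ip_normZ a x : ip_norm b (a *: x) = cabs a * ip_norm b x.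
Proof.
rewrite /ip_norm ipZl ipZr mulrA mulc_conj ip_self -rmorphM /=.
by rewrite sqrtrM ?sqr_ge0// !sqrtr_sqr !ger0_norm ?cabs_ge0 ?ip_norm_ge0.
Qed.

(** Expands the nonnegative square of q^2 x - u y, where q is the norm of y and u = [b x y]. This is
    q^2 times the component of x orthogonal to y, written without division. *)
Lemma ip_cauchy_schwarz x y : cabs (b x y) <= ip_norm b x * ip_norm b y.
Proof.
have [y0|y0] := eqVneq y 0.
  by rewrite y0 ip0r normr0 /= ip_norm0 mulr0.
have q0 : 0 < ip_norm b y.
  by rewrite lt_neqAle ip_norm_ge0 andbT eq_sym; apply: contra_neq y0; exact: ip_norm_eq0.
set p := ip_norm b x; set q := ip_norm b y in q0 *; set u := b x y.
have : 0 <= b (((q ^+ 2)%:C)%C *: x - u *: y) (((q ^+ 2)%:C)%C *: x - u *: y) by exact: ip_ge0.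
rewrite ipBl !ipBr !ipZl !ipZr !ip_self -/p -/q -/u (ip_conj ipb x y) -/u.
rewrite conjc_real.
have -> : ((q ^+ 2)%:C)%C * (((q ^+ 2)%:C)%C * ((p ^+ 2)%:C)%C) - ((q ^+ 2)%:C)%C * ((u^*)%C * u) -
  (u * (((q ^+ 2)%:C)%C * (u^*)%C) - u * ((u^*)%C * ((q ^+ 2)%:C)%C)) =
  ((q ^+ 2)%:C)%C * (((q ^+ 2)%:C)%C * ((p ^+ 2)%:C)%C - u * (u^*)%C) by ring.
rewrite mulc_conj -!rmorphM -rmorphB -rmorphM ler0c pmulr_rge0 ?exprn_gt0// subr_ge0.
rewrite -exprMn ler_sqr ?nnegrE ?cabs_ge0 ?mulr_ge0 ?ip_norm_ge0//.
by rewrite mulrC.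
Qed.

Lemma ip_norm_triangle x y : ip_norm b (x + y) <= ip_norm b x + ip_norm b y.
Proof.
rewrite -ler_sqr ?nnegrE ?addr_ge0 ?ip_norm_ge0//.
have e : ip_norm b (x + y) ^+ 2 = complex.Re (b (x + y) (x + y)).
  by rewrite ip_self.
rewrite e ipDl !ipDr !ip_self (ip_conj ipb x y) !cReD /=.
have := le_trans (Re_le_cabs _) (ip_cauchy_schwarz x y).
case: (b x y) => c d /= h; rewrite sqrrD.
by nra.
Qed.

End InnerProduct.

Section H1Forms.
Variable R : realType.
Implicit Types (phi psi xi : H1 R) (a : R[i]).

Lemma L2_repr phi : L2 (repr phi).
Proof. by have /H1funP[] := valP (repr phi). Qed.

Lemma L2_wderiv i phi : L2 (wderiv i (repr phi)).
Proof. by have [] := wderivP i (valP (repr phi)). Qed.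

Lemma repr_lin a phi psi :
  ae_zero (h1fun_val (repr (a *: phi + psi)) -
    (a *: h1fun_val (repr phi) + h1fun_val (repr psi))).
Proof.
have : repr (a *: phi + psi) - (a *: repr phi + repr psi) \in @h1null R.
  rewrite Quotient.idealrBE; apply/eqP.
  by rewrite reprK pi_h1D pi_h1scale !reprK.
by move=> /asboolP.
Qed.

Lemma wderiv_lin i a phi psi :
  ae_zero (wderiv i (repr (a *: phi + psi)) -
    (a *: wderiv i (repr phi) + wderiv i (repr psi))).
Proof.
have [L1 w1] := wderivP i (valP (repr phi)).
have [L2 w2] := wderivP i (valP (repr psi)).
have [L3 w3] := wderivP i (valP (repr (a *: phi + psi))).
have Lc := L2_lin a L1 L2.
have wc := @weak_partial_lin _ i a _ _ _ _ (L2_repr phi) (L2_repr psi) L1 L2 w1 w2.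
have Lrc := L2_lin a (L2_repr phi) (L2_repr psi).
have := @weak_partial_lin _ i (-1) _ _ _ _ Lrc (L2_repr (a *: phi + psi)) Lc L3 wc w3.
rewrite !scaleN1r ![- _ + _]addrC; apply: weak_partial_ae0.
- by rewrite addrC -scaleN1r; apply: L2_lin => //; exact: L2_repr.
- by rewrite addrC -scaleN1r; exact: L2_lin.
- exact: repr_lin.
Qed.

(** [T] stands for [repr] or for a weak derivative of [repr]. Both depend on choices and are linear
    only almost everywhere, which the L^2 form does not see. *)
Section Pullback.
Variable T : H1 R -> R3 R -> R[i]^o.
Hypothesis LT : forall phi, L2 (T phi).
Hypothesis T_lin : forall a phi psi, ae_zero (T (a *: phi + psi) - (a *: T phi + T psi)).

Lemma L2dot_pull_linl a phi psi xi :
  L2dot (T (a *: phi + psi)) (T xi) = a * L2dot (T phi) (T xi) + L2dot (T psi) (T xi).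
Proof.
rewrite -L2dot_linl//; set g := a *: T phi + T psi.
have Lg : L2 g by exact: L2_lin.
have Ld : L2 (T (a *: phi + psi) - g).
  by rewrite addrC -scaleN1r; exact: L2_lin.
rewrite -[T (_ + _)](subrK g) -[X in X + g]scale1r L2dot_linl//.
have -> : L2dot (T (a *: phi + psi) - g) (T xi) = 0.
  by apply: L2dot_ae0 => //; exact: T_lin.
by rewrite mulr0 add0r.
Qed.

End Pullback.

Lemma l2_inner_product : inner_product (@l2dot R).
Proof.
split=> [a x y z|x y|x|x].
- exact: (L2dot_pull_linl L2_repr repr_lin).
- by apply: L2dotC; exact: L2_repr.
- by apply: L2dot_ge0; exact: L2_repr.
- move=> /(L2dot_eq0 (L2_repr x)) x0.
  rewrite -[x]reprK -[RHS](reprK (0 : H1 R)).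
  apply/eqP; rewrite -Quotient.idealrBE; apply/asboolP.
  (* The representative of 0 may be any null function; linearity almost everywhere with coefficient
     -1 and both vectors 0 isolates it. *)
  have z0 : ae_zero (h1fun_val (repr (0 : H1 R))).
    have := repr_lin (-1) (0 : H1 R) 0; rewrite scaleN1r addNr scaleN1r addNr subr0.
    by [].
  apply: ae_imp2 x0 z0 => y xy zy.
  have -> : (repr x - repr (0 : H1 R) : h1fun R) y =
    h1fun_val (repr x) y - h1fun_val (repr (0 : H1 R)) y by [].
  by rewrite xy zy subrr.
Qed.

Lemma h1_inner_product : inner_product (@h1dot R).
Proof.
have ge0 i (x : H1 R) : 0 <= L2dot (wderiv i (repr x)) (wderiv i (repr x)).
  by apply: L2dot_ge0; exact: L2_wderiv.
split=> [a x y z|x y|x|x].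
- rewrite /h1dot (ip_linl l2_inner_product) mulrDr addrACA; congr (_ + _).
  rewrite mulr_sumr -big_split /=; apply: eq_bigr => i _.
  exact: (L2dot_pull_linl (L2_wderiv i) (wderiv_lin i)).
- transitivity (((l2dot x y)^*)%C +
    \sum_(i < 3) ((L2dot (wderiv i (repr x)) (wderiv i (repr y)))^*)%C).
    congr (_ + _); first exact: ip_conj l2_inner_product x y.
    by apply: eq_bigr => i _; apply: L2dotC; exact: L2_wderiv.
  by rewrite -(rmorph_sum (@conjc R)); exact/esym/(rmorphD (@conjc R)).
- by apply: addr_ge0; [exact: ip_ge0 l2_inner_product _|exact: sumr_ge0].
- move=> /eqP; rewrite paddr_eq0 ?sumr_ge0//; last exact: ip_ge0 l2_inner_product _.
  by move=> /andP[/eqP x0 _]; exact: (ip_eq0 l2_inner_product).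
Qed.

Lemma l2norm_le_h1norm phi : l2norm phi <= h1norm phi.
Proof.
rewrite ler_wsqrtr// cReD lerDl.
have : 0 <= \sum_(i < 3) L2dot (wderiv i (repr phi)) (wderiv i (repr phi)).
  by apply: sumr_ge0 => i _; apply: L2dot_ge0; exact: L2_wderiv.
by rewrite lecE => /andP[].
Qed.

End H1Forms.

(** * Strict differentiability *)

Section StrictDifferentiability.
Variable R : realType.

Definition bounded_linear (E G : normedModType R) (L : E -> G) :=
  linear L /\ exists2 M, 0 <= M & forall v, `|L v| <= M * `|v|.

(* Strict differentiability at every point of an open set amounts to being C^1
   there, without having to name a continuous derivative. *)
Definition sdiff (E G : normedModType R) (f : E -> G) (x : E) (L : E -> G) :=
  bounded_linear L /\ forall e, 0 < e -> exists2 d, 0 < d &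
    forall y z, `|y - x| < d -> `|z - x| < d ->
      `|f y - f z - L (y - z)| <= e * `|y - z|.

Section BoundedLinear.
Variables E G : normedModType R.
Implicit Types L K : E -> G.

Lemma bl0 L : bounded_linear L -> L 0 = 0.
Proof.
move=> [l _]; have := l 1 0 0; rewrite !scale1r addr0 => /eqP.
by rewrite -subr_eq subrr eq_sym => /eqP.
Qed.

Lemma blD L x y : bounded_linear L -> L (x + y) = L x + L y.
Proof. by move=> [l _]; have := l 1 x y; rewrite !scale1r. Qed.

Lemma blZ L a x : bounded_linear L -> L (a *: x) = a *: L x.
Proof. by move=> l; have := l.1 a x 0; rewrite !addr0 (bl0 l) addr0. Qed.

Lemma blN L x : bounded_linear L -> L (- x) = - L x.
Proof. by move=> l; rewrite -scaleN1r blZ// scaleN1r. Qed.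

Lemma blB L x y : bounded_linear L -> L (x - y) = L x - L y.
Proof. by move=> l; rewrite blD// blN. Qed.

Lemma bl_cst0 : bounded_linear (fun _ : E => 0 : G).
Proof.
split; first by move=> a x y; rewrite scaler0 addr0.
by exists 0 => // v; rewrite normr0 mul0r.
Qed.

Lemma bl_add L K : bounded_linear L -> bounded_linear K ->
  bounded_linear (fun v => L v + K v).
Proof.
move=> [l [M M0 lM]] [k [N N0 kN]]; split.
  by move=> a x y; rewrite l k scalerDr addrACA.
exists (M + N); first exact: addr_ge0.
by move=> v; rewrite (le_trans (ler_normD _ _))// mulrDl lerD.
Qed.

Lemma bl_scale a L : bounded_linear L -> bounded_linear (fun v => a *: L v).
Proof.
move=> [l [M M0 lM]]; split.
  by move=> c x y; rewrite l scalerDr !scalerA mulrC.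
exists (`|a| * M); first exact: mulr_ge0.
by move=> v; rewrite normrZ -mulrA ler_wpM2l.
Qed.

Lemma bl_opp L : bounded_linear L -> bounded_linear (fun v => - L v).
Proof.
by move=> /(bl_scale (-1)); congr bounded_linear; apply/funext => v; rewrite scaleN1r.
Qed.

End BoundedLinear.

Lemma bl_id (E : normedModType R) : bounded_linear (@idfun E).
Proof. by split=> [a x y//|]; exists 1 => // v; rewrite mul1r. Qed.

Lemma bl_comp (E G H : normedModType R) (L : E -> G) (K : G -> H) :
  bounded_linear L -> bounded_linear K -> bounded_linear (fun v => K (L v)).
Proof.
move=> [l [M M0 lM]] [k [N N0 kN]]; split; first by move=> a x y; rewrite l k.
exists (N * M); first exact: mulr_ge0.
by move=> v; rewrite (le_trans (kN _))// -mulrA ler_wpM2l.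
Qed.

Section Sdiff.
Variables E G : normedModType R.
Implicit Types (f g : E -> G) (x : E) (L K : E -> G).

Lemma sdiff_bl f x : bounded_linear f -> sdiff f x f.
Proof.
move=> l; split=> // e e0; exists 1 => // y z _ _.
by rewrite blB// subrr normr0 mulr_ge0// ltW.
Qed.

Lemma sdiff_cst (a : G) x : sdiff (fun _ => a) x (fun _ => 0).
Proof.
split; first exact: bl_cst0.
by move=> e e0; exists 1 => // y z _ _; rewrite subrr subr0 normr0 mulr_ge0// ltW.
Qed.

Lemma sdiffD f g x L K : sdiff f x L -> sdiff g x K ->
  sdiff (fun y => f y + g y) x (fun v => L v + K v).
Proof.
move=> [l fl] [k gk]; split; first exact: bl_add.
move=> e e0; have e20 : 0 < e / 2 by rewrite divr_gt0.
have [d d0 fd] := fl _ e20; have [c c0 gc] := gk _ e20.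
exists (Num.min d c); first by rewrite lt_min d0.
move=> y z; rewrite !lt_min => /andP[yd yc] /andP[zd zc].
rewrite [e]splitr mulrDl; apply: le_trans (lerD (fd _ _ yd zd) (gc _ _ yc zc)).
apply: le_trans (ler_normD _ _); rewrite le_eqVlt; apply/orP; left; apply/eqP.
by congr `|_|; module R G.
Qed.

Lemma sdiff_lip f x L : sdiff f x L -> exists2 M, 0 <= M & exists2 d, 0 < d &
  forall y z, `|y - x| < d -> `|z - x| < d -> `|f y - f z| <= M * `|y - z|.
Proof.
move=> [[l [M M0 lM]] fl]; have [d d0 fd] := fl 1 ltr01.
exists (1 + M); first by rewrite addr_ge0.
exists d => // y z yd zd; rewrite -(subrK (L (y - z)) (f y - f z)).
by rewrite (le_trans (ler_normD _ _))// mulrDl lerD// fd.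
Qed.

Lemma sdiff_eq f x L K : (forall v, L v = K v) -> sdiff f x L -> sdiff f x K.
Proof. by move=> /funext ->. Qed.

Lemma sdiff_line f x L v e : sdiff f x L -> 0 < e ->
  exists2 c, 0 < c & forall y, `|y - x| < c -> forall t, `|t| < c ->
    `|f (t *: v + y) - f y - t *: L v| <= e * `|t| * `|v|.
Proof.
move=> [l fl] e0; have [d d0 fd] := fl e e0.
have v1 : 0 < `|v| + 1 by rewrite ltr_wpDl.
exists (Num.min (d / 2) (d / 2 / (`|v| + 1))).
  by rewrite lt_min !divr_gt0.
move=> y; rewrite lt_min => /andP[yd _] t; rewrite lt_min => /andP[_ tc].
have tv : `|t *: v| < d / 2.
  rewrite normrZ; apply: le_lt_trans (_ : `|t| * (`|v| + 1) < _).
    by rewrite ler_wpM2l// lerDl.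
  by rewrite -ltr_pdivlMr.
have := fd (t *: v + y) y; rewrite addrK blZ// normrZ mulrA; apply.
  by rewrite -addrA (le_lt_trans (ler_normD _ _))// [ltRHS]splitr ltrD.
by rewrite (lt_trans yd)// gtr_pMr// invf_lt1// ltr1n.
Qed.

End Sdiff.

Lemma sdiff_comp (E G H : normedModType R) (f : E -> G) (g : G -> H) x L K :
  sdiff f x L -> sdiff g (f x) K -> sdiff (fun y => g (f y)) x (fun v => K (L v)).
Proof.
move=> fL gK; have [M M0 [d d0 fd]] := sdiff_lip fL.
case: fL => l fl; case: gK => k gk; split; first exact: bl_comp.
move=> e e0; have [N N0 kN] := k.2.
have M1 : 0 < M + 1 by rewrite ltr_wpDl.
have N1 : 0 < N + 1 by rewrite ltr_wpDl.
have [c c0 gc] := gk (e / 2 / (M + 1)) (divr_gt0 (divr_gt0 e0 (ltr0Sn _ 1)) M1).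
have [b b0 fb] := fl (e / 2 / (N + 1)) (divr_gt0 (divr_gt0 e0 (ltr0Sn _ 1)) N1).
have cM : 0 < c / (M + 1) by rewrite divr_gt0.
exists (Num.min d (Num.min b (c / (M + 1)))); first by rewrite !lt_min d0 b0.
move=> y z; rewrite !lt_min => /and3P[yd yb yc] /and3P[zd zb zc].
have near w : `|w - x| < d -> `|w - x| < c / (M + 1) -> `|f w - f x| < c.
  move=> wd wc; apply: le_lt_trans (fd _ _ wd _) _; first by rewrite subrr normr0.
  apply: le_lt_trans (_ : (M + 1) * `|w - x| < _); first by rewrite ler_wpM2r// lerDl.
  by rewrite mulrC -ltr_pdivlMr.
have := gc (f y) (f z) (near _ yd yc) (near _ zd zc) => h1.
have h2 := fb _ _ yb zb.
have -> : g (f y) - g (f z) - K (L (y - z)) =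
    (g (f y) - g (f z) - K (f y - f z)) + K (f y - f z - L (y - z)).
  by rewrite [K (f y - f z - _)](blB _ _ k) addrA subrK.
rewrite (le_trans (ler_normD _ _))// [e]splitr mulrDl lerD//.
  rewrite (le_trans h1)// -mulrA; apply: ler_wpM2l; first by rewrite divr_ge0// ltW.
  by rewrite ler_pdivrMl// (le_trans (fd _ _ yd zd))// ler_wpM2r// lerDl.
rewrite (le_trans (kN _))//.
apply: le_trans (_ : N * (e / 2 / (N + 1) * `|y - z|) <= _); first by rewrite ler_wpM2l.
rewrite mulrA ler_wpM2r// mulrCA; apply: ler_piMr; first by rewrite divr_ge0// ltW.
by rewrite ler_pdivrMr// mul1r lerDl.
Qed.

(** The error is a sum of four products, each with a factor controlled by [e']: the increment
    [f y - f x], the remainder of [f] or of [g], or the increment [g z - g x]. *)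
Lemma sdiff_bilin (E F G H : normedModType R) (b : F -> G -> H) (C : R)
    (f : E -> F) (g : E -> G) x L K : 0 <= C ->
  (forall u, linear (b u)) -> (forall w, linear (b ^~ w)) ->
  (forall u w, `|b u w| <= C * `|u| * `|w|) ->
  sdiff f x L -> sdiff g x K ->
  sdiff (fun y => b (f y) (g y)) x (fun v => b (f x) (K v) + b (L v) (g x)).
Proof.
move=> C0 br bl bC fL gK.
have brB u w w' : b u (w - w') = b u w - b u w'.
  by have := br u (-1) w' w; rewrite !scaleN1r ![- _ + _]addrC.
have blB' u u' w : b (u - u') w = b u w - b u' w.
  by have := bl w (-1) u' u; rewrite !scaleN1r ![- _ + _]addrC.
have bbr u : bounded_linear (b u).
  by split=> //; exists (C * `|u|); [exact: mulr_ge0|exact: bC].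
have bbl w : bounded_linear (b ^~ w).
  split=> //; exists (C * `|w|); first exact: mulr_ge0.
  by move=> v; rewrite mulrAC.
have [M M0 [d d0 fd]] := sdiff_lip fL; have [N N0 [c c0 gc]] := sdiff_lip gK.
have [l [ML ML0 lM]] := fL.1.
split; first exact: bl_add (bl_comp gK.1 (bbr _)) (bl_comp fL.1 (bbl _)).
move=> e e0.
(* [q] dominates the sum of the coefficients of the four error terms; capping [e'] at 1 is what
   bounds the norm of [g z] by |g x| + 1. *)
pose q := C * (N + ML + `|f x| + `|g x| + 1) + 1.
have q0 : 0 < q by rewrite ltr_wpDl// mulr_ge0// !addr_ge0.
pose e' := Num.min 1 (e / (4 * q)).
have e'0 : 0 < e' by rewrite lt_min ltr01 divr_gt0// mulr_gt0.
have [df df0 Hf] := fL.2 e' e'0; have [dg dg0 Hg] := gK.2 e' e'0.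
pose rf := Num.min df (Num.min dg (Num.min d (Num.min c (Num.min (e' / (M + 1)) (e' / (N + 1)))))).
exists rf; first by rewrite !lt_min df0 dg0 d0 c0 !divr_gt0// ltr_wpDl.
move=> y z; rewrite !lt_min => /and5P[y1 y2 y3 y4 /andP[y5 y6]] /and5P[z1 z2 z3 z4 /andP[z5 z6]].
have h1 := Hf _ _ y1 z1; have h2 := Hg _ _ y2 z2.
have fy : `|f y - f x| <= e'.
  apply: le_trans (fd _ _ y3 _) _; first by rewrite subrr normr0.
  move: y5; rewrite ltr_pdivlMr ?ltr_wpDl// => /ltW; apply: le_trans.
  by rewrite mulrC ler_wpM2l// lerDl.
have gz : `|g z - g x| <= e'.
  apply: le_trans (gc _ _ z4 _) _; first by rewrite subrr normr0.
  move: z6; rewrite ltr_pdivlMr ?ltr_wpDl// => /ltW; apply: le_trans.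
  by rewrite mulrC ler_wpM2l// lerDl.
have gyz := gc _ _ y4 z4.
set D := `|y - z| in h1 h2 gyz *; have D0 : 0 <= D by exact: normr_ge0.
have -> : b (f y) (g y) - b (f z) (g z) - (b (f x) (K (y - z)) + b (L (y - z)) (g x)) =
  (b (f y - f x) (g y - g z) + b (f x) (g y - g z - K (y - z))) +
  (b (f y - f z - L (y - z)) (g z) + b (L (y - z)) (g z - g x)).
  by rewrite !brB !blB'; module R H.
have C1 : C * e' <= C by rewrite ler_piMr// ge_min lexx.
have gzn : `|g z| <= `|g x| + 1.
  rewrite -(subrK (g x) (g z)) (le_trans (ler_normD _ _))// addrC lerD2l.
  by rewrite (le_trans gz)// ge_min lexx.
have t1 : `|b (f y - f x) (g y - g z)| <= C * e' * (N * D).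
  by rewrite (le_trans (bC _ _))// ler_pM ?mulr_ge0// ler_wpM2l.
have t2 : `|b (f x) (g y - g z - K (y - z))| <= C * `|f x| * (e' * D).
  by rewrite (le_trans (bC _ _))// ler_wpM2l ?mulr_ge0.
have t3 : `|b (f y - f z - L (y - z)) (g z)| <= C * (e' * D) * (`|g x| + 1).
  by rewrite (le_trans (bC _ _))// ler_pM ?mulr_ge0// ler_wpM2l.
have t4 : `|b (L (y - z)) (g z - g x)| <= C * (ML * D) * e'.
  by rewrite (le_trans (bC _ _))// ler_pM ?mulr_ge0// ler_wpM2l.
apply: le_trans (ler_normD _ _) _.
apply: le_trans (lerD (ler_normD _ _) (ler_normD _ _)) _.
apply: le_trans (lerD (lerD t1 t2) (lerD t3 t4)) _.
have -> : C * e' * (N * D) + C * `|f x| * (e' * D) + (C * (e' * D) * (`|g x| + 1) + C * (ML * D) * e') =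
  (C * (N + ML + `|f x| + `|g x| + 1)) * e' * D by ring.
rewrite ler_wpM2r//; apply: le_trans (_ : q * e' <= _).
  by apply: ler_wpM2r; [exact: ltW|rewrite lerDl].
rewrite mulrC -ler_pdivlMr// ge_min; apply/orP; right.
apply: ler_wpM2l; first exact: ltW.
rewrite lef_pV2 ?posrE ?mulr_gt0//; apply: ler_peMl; first exact: ltW.
by rewrite ler1n.
Qed.
End StrictDifferentiability.

Section SdiffC1.
Variables (R : realType) (E G : normedModType R).
Implicit Types (f : E -> G) (L : E -> G).

Lemma bl_continuous L : bounded_linear L -> continuous L.
Proof.
move=> l x; have [M M0 lM] := l.2; apply/cvgrPdist_lt => e e0.
have M1 : 0 < M + 1 by rewrite ltr_wpDl.
near=> y; rewrite -blB// (le_lt_trans (lM _))//.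
apply: le_lt_trans (_ : (M + 1) * `|x - y| < _); first by rewrite ler_wpM2r// lerDl.
rewrite mulrC -ltr_pdivlMr//; near: y.
by apply: cvgr_dist_lt => //; rewrite divr_gt0.
Unshelve. all: by end_near. Qed.

Lemma diff_bl f x : differentiable f x -> bounded_linear ('d f x).
Proof.
move=> /diff_continuous /linear_bounded_continuous /linear_boundedP /pinfty_ex_gt0[M M0 fM].
by split; [exact: linearP|exists M => //; exact: ltW].
Qed.

Lemma sdiff_diff f x L : sdiff f x L -> differentiable f x /\ 'd f x = L :> (E -> G).
Proof.
move=> [l fl]; have cL := bl_continuous l.
pose L' : {linear E -> G} := HB.pack L (GRing.isLinear.Build R E G *:%R L l.1).
have fL : f \o shift x = cst (f x) + L' +o_ 0 id.
  apply/eqaddoP => e e0; have [d d0 fd] := fl _ e0.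
  apply/nbhs_norm0P; exists d => //= h hd.
  have := fd (h + x) x; rewrite addrK subrr normr0 => /(_ hd d0).
  rewrite -[(f \o shift x - (cst (f x) + L')) h]/(f (h + x) - (f x + L h)).
  by rewrite opprD addrA.
have dE := diff_unique (df := L') cL fL.
by split=> //; apply/diff_locallyP; rewrite dE.
Qed.

(** The same increment of [f], from [y] to [t *: v + y], is approximated by [L x] through strict
    differentiability at [x] and by [L y] through that at [y]. Dividing by [t] compares the two
    derivatives. *)
Lemma sdiff_c1_on (D : set E) f (L : E -> E -> G) : open D ->
  (forall x, D x -> sdiff f x (L x)) -> c1_on D f.
Proof.
move=> oD fL x Dx; have [df dE] := sdiff_diff (fL x Dx); split=> // e e0.
have e40 : 0 < e / 2 by rewrite divr_gt0.
have [l Hx] := fL x Dx; have [d d0 fd] := Hx _ e40.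
have : nbhs x (D `&` ball x d) by apply: filterI; [exact: open_nbhs_nbhs|exact: nbhsx_ballx].
apply: filterS => y [Dy]; rewrite -ball_normE /= distrC => yd v.
have [dfy dyE] := sdiff_diff (fL y Dy); rewrite dyE dE.
have [c c0 yc] := sdiff_line v (fL y Dy) e40.
have v1 : 0 < `|v| + 1 by rewrite ltr_wpDl.
(* Small enough for the estimate at [y] and for [t *: v + y] to stay in the ball of radius [d] about
   [x]. *)
pose t := Num.min (c / 2) ((d - `|y - x|) / (`|v| + 1) / 2).
have dy : 0 < d - `|y - x| by rewrite subr_gt0.
have t0 : 0 < t by rewrite lt_min !divr_gt0.
have tc : `|t| < c.
  rewrite gtr0_norm// gt_min; apply/orP; left.
  by rewrite gtr_pMr// invf_lt1// ltr1n.
have := yc y; rewrite subrr normr0 => /(_ c0 t tc) h1.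
have tvd : `|t *: v + y - x| < d.
  rewrite -addrA (le_lt_trans (ler_normD _ _))// -ltrBrDr normrZ gtr0_norm//.
  apply: le_lt_trans (_ : t * (`|v| + 1) < _); first by rewrite ler_wpM2l ?(ltW t0)// lerDl.
  rewrite -ltr_pdivlMr// gt_min; apply/orP; right.
  by rewrite gtr_pMr ?divr_gt0// invf_lt1// ltr1n.
have := fd _ _ tvd yd; rewrite addrK blZ// normrZ => h2.
rewrite -(ler_pM2l t0) -[X in X * `|_|](gtr0_norm t0) -normrZ.
have -> : t *: (L y v - L x v) = (f (t *: v + y) - f y - t *: L x v) -
  (f (t *: v + y) - f y - t *: L y v) by module R G.
rewrite (le_trans (ler_normB _ _))//; apply: le_trans (lerD h2 h1) _.
rewrite gtr0_norm//.
by have -> : e / 2 * (t * `|v|) + e / 2 * t * `|v| = t * (e * `|v|) by field.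
Qed.

Lemma c1_on_continuous (D : set E) f x : c1_on D f -> D x -> {for x, continuous f}.
Proof. by move=> fD /fD[/differentiable_continuous]. Qed.

Lemma near_eq_diff f (g : E -> G) x : differentiable f x -> differentiable g x ->
  (\forall y \near x, f y = g y) -> 'd f x = 'd g x :> (E -> G).
Proof. by move=> df dg fg; apply/funext => v; rewrite -!deriveE// (near_eq_derive _ fg). Qed.

End SdiffC1.

Lemma diff_left_inverse (R : realType) (E G : normedModType R) (f : E -> G) (g : G -> E) x :
  differentiable f x -> differentiable g (f x) -> (\forall y \near x, g (f y) = y) ->
  forall v, 'd g (f x) ('d f x v) = v.
Proof.
move=> df dg gf v; have [did idE] := sdiff_diff (sdiff_bl x (bl_id E)).
have := near_eq_diff (differentiable_comp df dg) did gf.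
by rewrite diff_comp// idE => /(congr1 (fun h => h v)).
Qed.

(** * Submanifolds of Banach spaces *)

Section Charts.
Variables (R : realType) (X B : completeNormedModType R).
Implicit Types (M W : set B) (Phi : B -> X) (phi : X -> B).

Section OneChart.
Variables (M W : set B) (Phi : B -> X) (phi : X -> B).
Hypothesis chart : c1_chart M W Phi phi.

Lemma chart_phi x : (Phi @` W) x -> W (phi x) /\ Phi (phi x) = x.
Proof. by case: chart => _ _ pP _ _ [m Wm <-]; rewrite pP. Qed.

Lemma chart_nbhs m : W m -> \forall x \near Phi m, (Phi @` W) x.
Proof. by case: chart => _ oP _ _ _ Wm; apply: open_nbhs_nbhs; split=> //; exists m. Qed.

Lemma chart_diff m : W m -> differentiable phi (Phi m).
Proof. by case: chart => _ _ _ c1 _ Wm; have [] := c1 (Phi m) (ex_intro2 _ _ m Wm erefl). Qed.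

Lemma chart_ext m : W m -> exists U (Psi : B -> X), [/\ open U, U m, M `&` U `<=` W,
  differentiable Psi m &
  (forall m', (M `&` U) m' -> Psi m' = Phi m')].
Proof.
case: chart => -[U0 oU0 WE] _ _ _ ext Wm.
have [U [Psi [oU Um c1 PsiE]]] := ext m Wm; exists (U0 `&` U), Psi; split.
- exact: openI.
- by split=> //; move: Wm; rewrite WE => -[].
- by move=> m' [Mm' [U0m' _]]; rewrite WE.
- by have [] := c1 m Um.
- by move=> m' [Mm' [U0m' Um']]; apply: PsiE; rewrite WE.
Qed.

(** The derivative of [Psi] at [m] is a bounded left inverse of the derivative of [phi]; its norm,
    increased by 1 to be positive, gives the constant. *)
Lemma chart_lower m : W m -> exists2 c, 0 < c &
  forall v, c * `|v| <= `|'d phi (Phi m) v|.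
Proof.
move=> Wm; have [U [Psi [oU Um MUW dPsi PsiE]]] := chart_ext Wm.
have dphi := chart_diff Wm; have [_ _ pP _ _] := chart.
have dPsi' : differentiable Psi (phi (Phi m)) by rewrite pP.
have inv : \forall x \near Phi m, Psi (phi x) = x.
  have cphi := differentiable_continuous dphi.
  have nU : nbhs (phi (Phi m)) U by rewrite pP//; exact: open_nbhs_nbhs.
  near=> x; have Wx : (Phi @` W) x by near: x; exact: chart_nbhs.
  have [Wpx pxE] := chart_phi Wx.
  rewrite PsiE//; split; last by near: x; exact: cphi.
  by move: Wpx; case: chart => -[U0 _ ->] _ _ _ _ [].
have [_ [K K0 dK]] := diff_bl dPsi.
have K1 : 0 < K + 1 by rewrite ltr_wpDl.
exists (K + 1)^-1; first by rewrite invr_gt0.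
move=> v; rewrite ler_pdivrMl//.
have vE := diff_left_inverse dphi dPsi' inv v; rewrite pP// in vE.
rewrite -{1}vE (le_trans (dK _))//; apply: ler_wpM2r => //; by rewrite lerDl.
Unshelve. all: by end_near. Qed.

End OneChart.

Lemma norm_fiber_norm M (T : B -> set B) : fiber_norm M T (fun _ w => `|w|).
Proof.
move=> m _; split=> [w _|w _|a w _|w w' _ _].
- exact: normr_ge0.
- exact: normr0_eq0.
- exact: normrZ.
- exact: ler_normD.
Qed.

Lemma norm_fiber_topology M : fiber_topology X M (fun _ w => `|w|).
Proof.
move=> W Phi phi chart m Wm v A.
have [c c0 low] := chart_lower chart Wm.
have [_ [K K0 up]] := diff_bl (chart_diff chart Wm).
split=> [/nbhs_ballP[r /= r0 rA]|[e e0 eA]].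
  exists (c * r); first by rewrite mulr_gt0.
  move=> u /= uv; apply: rA; rewrite -ball_normE /= distrC.
  by have := le_lt_trans (low _) uv; rewrite ltr_pM2l.
have K1 : 0 < K + 1 by rewrite ltr_wpDl.
apply/nbhs_ballP; exists (e / (K + 1)); first by rewrite /= divr_gt0.
move=> u; rewrite -ball_normE /= distrC => uv; apply: eA => /=.
rewrite (le_lt_trans (up _))//; apply: le_lt_trans (_ : (K + 1) * `|u - v| < _).
  by rewrite ler_wpM2r// lerDl.
by rewrite mulrC -ltr_pdivlMr.
Qed.

Lemma norm_fiber_continuity M : fiber_continuity X M (fun _ w => `|w|).
Proof.
move=> W Phi phi chart m0 Wm0 k k1.
have [c c0 low] := chart_lower chart Wm0.
have [U [Psi [oU Um0 MUW dPsi PsiE]]] := chart_ext chart Wm0.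
have Mm0 : M m0 by move: Wm0; case: chart => -[U0 _ ->] _ _ _ _ [].
have k0 : 0 < k by rewrite (lt_trans ltr01).
have k1' : 0 < 1 - k^-1 by rewrite subr_gt0 invf_lt1.
have [_ _ _ c1 _] := chart.
(* With a and b the derivatives of [phi] at [Phi m] and [Phi m0] applied to v, this tolerance yields
   |a - b| <= (1 - 1/k) |b|. Both inequalities follow, the first because 2 - 1/k <= k. *)
have [_ /(_ (c * (1 - k^-1)))] := c1 (Phi m0) (ex_intro2 _ _ m0 Wm0 erefl).
rewrite mulr_gt0// => /(_ isT) nN.
pose N := [set y | forall v, `|'d phi y v - 'd phi (Phi m0) v| <= c * (1 - k^-1) * `|v|].
have nPsi : nbhs m0 (Psi @^-1` N).
  apply: (differentiable_continuous dPsi).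
  by rewrite PsiE//; exact: nN.
exists (U `&` (Psi @^-1` N)^°); split.
- by apply: openI => //; exact: open_interior.
- by split.
- by move=> m [Mm [Um _]]; exact: MUW.
- move=> m [Mm [Um /interior_subset]]; rewrite /preimage /N /= PsiE// => h v.
  have {}h := h v; have lv := low v.
  set a := 'd phi (Phi m) v in h *; set b := 'd phi (Phi m0) v in h lv *.
  have hb : `|a - b| <= (1 - k^-1) * `|b|.
    by rewrite (le_trans h)// mulrAC mulrC ler_wpM2l// ltW.
  have ab : `|a| <= `|a - b| + `|b| by rewrite -{1}(subrK b a) ler_normD.
  have ba : `|b| <= `|a - b| + `|a| by rewrite distrC -{1}(subrK a b) ler_normD.
  have b0 := normr_ge0 b.
  split.
    rewrite ler_pdivrMl//; apply: le_trans ab _.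
    apply: le_trans (lerD hb (lexx _)) _.
    rewrite -[X in _ + X]mul1r -mulrDl ler_wpM2r//.
    have : 0 <= (k - 1) ^+ 2 / k by rewrite divr_ge0 ?sqr_ge0// ltW.
    have -> : (k - 1) ^+ 2 / k = k - 2 + k^-1 by field; rewrite gt_eqF.
    by lra.
  rewrite -ler_pdivrMl//.
  by have := le_trans ba (lerD hb (lexx _)); rewrite mulrBl mul1r; lra.
Qed.

(** A description of tangent vectors without charts. Only differentiability at 0 is asked of the
    curve, so that velocities can be produced by a parametrization and constrained by equations
    valid on [M]. *)
Definition velocity M (m w : B) := exists gamma : R -> B, [/\ gamma 0 = m,
  \forall t \near (0 : R), M (gamma t) & is_derive (0 : R) 1 gamma w].

(** Lines through [Phi m] produce curves in [M]. Conversely a curve in [M] equals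
    [phi \o (Psi \o gamma)] near 0, and the chain rule puts its velocity in the range. *)
Lemma chart_velocity M W Phi phi : c1_chart M W Phi phi ->
  forall m, W m -> range ('d phi (Phi m)) = velocity M m.
Proof.
move=> chart m Wm; have dphi := chart_diff chart Wm.
have pP m' : W m' -> phi (Phi m') = m' by case: chart => _ _ + _ _; exact.
have MW m' : W m' -> M m' by case: chart => -[U0 _ ->] _ _ _ _ [].
apply/seteqP; split=> [_ [v _ <-]|w [gamma [g0 Mg dg]]].
  exists (fun t => phi (t *: v + Phi m)); split.
  - by rewrite scale0r add0r pP.
  - have cl : (fun t : R => t *: v + Phi m) @ (0 : R) --> Phi m.
      rewrite -[X in _ --> X]add0r -[X in _ --> X + _](scale0r v).
      by apply: cvgD; [exact: scalel_continuous|exact: cvg_cst].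
    near=> t; have : (Phi @` W) (t *: v + Phi m).
      by near: t; exact: (cl _ (chart_nbhs chart Wm)).
    by move=> /(chart_phi chart)[/MW].
  - have dv : derivable phi (Phi m) v by exact: diff_derivable.
    apply: DeriveDef; first by apply/(derivable1P phi (Phi m) v).
    rewrite -deriveE// /derive.
    set g1 := fun h => h^-1 *: _; set g2 := fun h => h^-1 *: _.
    suff -> : g1 = g2 by [].
    by apply/funext => h; rewrite /g1 /g2 /= addr0 scale0r add0r [h *: 1]mulr1.
have [U [Psi [oU Um MUW dPsi PsiE]]] := chart_ext chart Wm.
have dg' : differentiable gamma (0 : R) by apply/derivable1_diffP; case: dg.
have dPsi0 : differentiable Psi (gamma 0) by rewrite g0.
have Phi0 : Psi (gamma 0) = Phi m by rewrite g0 PsiE//; split=> //; exact: MW.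
have dphi0 : differentiable phi (Psi (gamma 0)) by rewrite Phi0.
have inv : \forall t \near (0 : R), (phi \o (Psi \o gamma)) t = gamma t.
  have cg := differentiable_continuous dg'.
  have nU : nbhs (gamma 0) U by rewrite g0; exact: open_nbhs_nbhs.
  near=> t; have Mt : M (gamma t) by near: t.
  have Ut : U (gamma t) by near: t; exact: cg.
  by rewrite /= PsiE// pP//; exact: MUW.
have dPg := differentiable_comp dg' dPsi0.
exists ('d Psi m ('d gamma (0 : R) 1)) => //.
have := near_eq_diff (differentiable_comp dPg dphi0) dg' inv.
rewrite diff_comp// diff_comp// /= Phi0 g0 => /(congr1 (fun g => g 1)) /= ->.
by rewrite -deriveE//; case: dg.
Unshelve. all: by end_near. Qed.

Lemma tangent_spacesP M (T : B -> set B) :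
  (forall m, M m -> velocity M m = T m) -> tangent_spaces X M T.
Proof.
move=> MT W Phi phi chart m Wm; rewrite (chart_velocity chart Wm) MT//.
by move: Wm; case: chart => -[U0 _ ->] _ _ _ _ [].
Qed.

(** The two inverse identities are local: [phi] may leave [U] and [Psi] may leave [D]. The image of
    the chart domain is the part of [D] that [phi] sends into [U], which is open. *)
Lemma local_c1_chart M (D : set X) (U : set B) phi (Psi : B -> X) :
  open D -> open U -> c1_on D phi -> c1_on U Psi ->
  (forall x, D x -> M (phi x)) ->
  (forall x, D x -> U (phi x) -> Psi (phi x) = x) ->
  (forall m, M m -> U m -> D (Psi m) -> phi (Psi m) = m) ->
  c1_chart M (M `&` (U `&` Psi @^-1` D)) Psi phi.
Proof.
move=> oD oU c1phi c1Psi DM PsiK phiK; split.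
- exists (U `&` Psi @^-1` D) => //; rewrite openE => m [Um Dm].
  have := c1_on_continuous c1Psi Um => cP.
  apply: filterI; first exact: open_nbhs_nbhs.
  by apply: cP; exact: open_nbhs_nbhs.
- have -> : Psi @` (M `&` (U `&` Psi @^-1` D)) = D `&` phi @^-1` U.
    apply/seteqP; split=> [_ [m [Mm [Um Dm]] <-]|x [Dx Ux]].
      by split=> //; rewrite /preimage /= phiK.
    by exists (phi x); rewrite ?PsiK//; split; [exact: DM|split=> //; rewrite /preimage/= PsiK].
  rewrite openE => x [Dx Ux].
  apply: filterI; first exact: open_nbhs_nbhs.
  by apply: (c1_on_continuous c1phi Dx); exact: open_nbhs_nbhs.
- by move=> m [Mm [Um Dm]]; exact: phiK.
- by move=> x [m [Mm [Um Dm]] <-]; exact: c1phi.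
- by move=> m [Mm [Um Dm]]; exists U, Psi.
Qed.

End Charts.

(** * Completeness of closed submanifolds *)

Section CurveLength.
Variables (R : realType) (B : completeNormedModType R).

Lemma derivable_approx (V : normedModType R) (f : R -> V) t : derivable f t 1 ->
  forall e, 0 < e -> exists2 d, 0 < d &
    forall s, `|s - t| < d -> `|f s - f t - (s - t) *: derive1 f t| <= e * `|s - t|.
Proof.
move=> /derivable_nbhsP /eqaddoP df e e0.
have /nbhs_norm0P[d /= d0 dd] := df e e0.
exists d => // s st; have h := dd (s - t) st; rewrite derive1E.
have -> : f s - f t - (s - t) *: 'D_1 f t =
    f ((s - t) *: 1 + t) - (f t + (s - t) *: 'D_1 f t).
  by rewrite [(s - t) *: 1]mulr1 subrK opprD addrA.
exact: h.
Qed.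

(** Real induction, which needs no integration in [V]: with a slack [e * s], the inequality holds up
    to a supremum [c]; it holds at [c] by going backwards, and goes past [c] if [c < 1]. *)
Lemma mean_value_le (V : normedModType R) (gamma : R -> V) (G : R -> R) :
  (forall t, t \in `[0, 1] -> [/\ derivable gamma t 1, derivable G t 1 &
     `|derive1 gamma t| <= derive1 G t]) ->
  `|gamma 1 - gamma 0| <= G 1 - G 0.
Proof.
move=> H; apply/ler_addgt0Pr => e e0.
pose P s := `|gamma s - gamma 0| <= G s - G 0 + e * s.
pose S := [set t | 0 <= t <= 1 /\ forall s, 0 <= s <= t -> P s].
have S0 : S 0.
  split; first by rewrite lexx ler01.
  by move=> s /le_anti <-; rewrite /P !subrr normr0 mulr0 addr0.
have ubS : ubound S 1 by move=> t [/andP[]].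
have hsS : has_sup S by split; [exists 0|exists 1].
pose c := sup S.
have c0 : 0 <= c by apply: ub_le_sup => //; exists 1.
have c1 : c <= 1 by apply: ge_sup => //; exists 0.
have cI : c \in `[0, 1] by rewrite in_itv /= c0.
have Pc s : 0 <= s < c -> P s.
  move=> /andP[s0 sc]; have cs0 : 0 < c - s by rewrite subr_gt0.
  have [t [t01 St]] := sup_adherent cs0 hsS.
  by rewrite subKr => st; apply: St; rewrite s0 ltW.
have [dg dG gG] := H c cI.
set k := `|derive1 gamma c| in gG; have k0 : 0 <= k by exact: normr_ge0.
set g := derive1 G c in gG.
have e20 : 0 < e / 2 by rewrite divr_gt0.
have [d1 d10 H1] := derivable_approx dg e20.
have [d2 d20 H2] := derivable_approx dG e20.
have near_gamma s : `|s - c| < d1 -> `|gamma s - gamma c| <= (k + e / 2) * `|s - c|.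
  move=> /H1 h; rewrite -(subrK ((s - c) *: derive1 gamma c) (gamma s - gamma c)).
  by rewrite (le_trans (ler_normD _ _))// normrZ mulrDl addrC [k * _]mulrC lerD2l.
have near_G s : `|s - c| < d2 -> (s - c) * g - e / 2 * `|s - c| <= G s - G c <= (s - c) * g + e / 2 * `|s - c|.
  by move=> /H2; rewrite ler_norml /GRing.scale /= -/g => /andP[h1 h2]; apply/andP; split; lra.
(* If the inequality failed at [c] by [D], going back by a small [r] would cost less than [D] and
   contradict [P (c - r)]. *)
have Pcc : P c.
  have [->|cn0] := eqVneq c 0; first by apply: S0.2; rewrite lexx.
  have cp : 0 < c by rewrite lt_neqAle eq_sym cn0.
  rewrite /P leNgt; apply/negP; rewrite -subr_gt0; set D := _ - _ => D0.
  have q0 : 0 < g + k + e by rewrite ltr_wpDl// addr_ge0// (le_trans k0).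
  pose r := Num.min (Num.min c (d1 / 2)) (Num.min (d2 / 2) (D / (g + k + e) / 2)).
  have r0 : 0 < r by rewrite !lt_min cp !divr_gt0.
  have rc : r <= c by rewrite /r !ge_min lexx.
  have rd1 : r < d1.
    apply: (@le_lt_trans _ _ (d1 / 2)); first by rewrite /r !ge_min lexx !orbT.
    by rewrite gtr_pMr// invf_lt1// ltr1n.
  have rd2 : r < d2.
    apply: (@le_lt_trans _ _ (d2 / 2)); first by rewrite /r !ge_min lexx !orbT.
    by rewrite gtr_pMr// invf_lt1// ltr1n.
  have rD : (g + k + e) * r < D.
    rewrite mulrC -ltr_pdivlMr//; apply: (@le_lt_trans _ _ (D / (g + k + e) / 2)).
      by rewrite /r !ge_min lexx !orbT.
    by rewrite gtr_pMr ?divr_gt0// invf_lt1// ltr1n.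
  have scr : `|c - r - c| = r by rewrite addrAC subrr sub0r normrN gtr0_norm.
  have := near_gamma (c - r); rewrite scr => /(_ rd1) a1.
  have := near_G (c - r); rewrite scr => /(_ rd2) /andP[_ a2].
  have := Pc (c - r); rewrite subr_ge0 rc gtrBl r0 => /(_ isT); rewrite /P => a3.
  have a4 : `|gamma c - gamma 0| <= `|gamma (c - r) - gamma c| + `|gamma (c - r) - gamma 0|.
    have -> : gamma c - gamma 0 = (gamma (c - r) - gamma 0) - (gamma (c - r) - gamma c).
      by module R V.
    by rewrite (le_trans (ler_normB _ _))// addrC.
  have gr : 0 <= g * r by rewrite mulr_ge0//; [exact: le_trans gG|exact: ltW].
  have er : 0 <= e * r by rewrite mulr_ge0//; exact: ltW.
  by move: a1 a2 a3 a4 rD gr er; rewrite /D; lra.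
have [c_1|c_1] := eqVneq c 1; first by move: Pcc; rewrite c_1 /P mulr1.
have {c_1}c_1 : c < 1 by rewrite lt_neqAle c_1.
(* Past [c] the first-order estimates of [gamma] and [G] each lose e/2 per unit length; the slack
   [e] pays for both. *)
pose r := Num.min (1 - c) (Num.min (d1 / 2) (d2 / 2)).
have r0 : 0 < r by rewrite !lt_min subr_gt0 c_1 !divr_gt0.
have : c + r <= c.
  apply: ub_le_sup; first by exists 1.
  split.
    rewrite addr_ge0 ?(ltW r0)//= -lerBrDl /r ge_min lexx//.
  move=> s /andP[s0 sr]; have [sc|cs] := ltP s c; first by apply: Pc; rewrite s0.
  have scr : `|s - c| = s - c by rewrite ger0_norm// subr_ge0.
  have rd1 : s - c < d1.
    apply: (@le_lt_trans _ _ (d1 / 2)); last by rewrite gtr_pMr// invf_lt1// ltr1n.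
    by apply: (@le_trans _ _ r); rewrite ?lerBlDl// /r !ge_min lexx !orbT.
  have rd2 : s - c < d2.
    apply: (@le_lt_trans _ _ (d2 / 2)); last by rewrite gtr_pMr// invf_lt1// ltr1n.
    by apply: (@le_trans _ _ r); rewrite ?lerBlDl// /r !ge_min lexx !orbT.
  have := near_gamma s; rewrite scr => /(_ rd1) a1.
  have := near_G s; rewrite scr => /(_ rd2) /andP[a2 _].
  have a4 : `|gamma s - gamma 0| <= `|gamma s - gamma c| + `|gamma c - gamma 0|.
    exact: ler_distD.
  have a5 : k * (s - c) <= g * (s - c) by rewrite ler_wpM2r// subr_ge0.
  by move: Pcc a1 a2 a4 a5; rewrite /P; lra.
by rewrite gerDl leNgt r0.
Qed.

Section Clamp.
Variable f : R -> R.
Hypothesis cf : {within `[0, 1], continuous f}.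

(** The speed of a curve is continuous only within [0, 1]. Composed with [clamp] it is continuous on
    the whole line, as the two-sided fundamental theorem of calculus asks at the ends. *)
Definition clamp (t : R) : R := Num.max 0 (Num.min 1 t).

Lemma clamp_itv t : clamp t \in `[0, 1].
Proof. by rewrite in_itv /= /clamp le_max lexx ge_max ler01 ge_min lexx. Qed.

Lemma clamp_id t : t \in `[0, 1] -> clamp t = t.
Proof. by rewrite in_itv /= /clamp => /andP[t0 t1]; rewrite min_r// max_r. Qed.

Lemma continuous_clamp : continuous clamp.
Proof.
by move=> t; apply: continuous_max; [exact: cvg_cst|apply: continuous_min; [exact: cvg_cst|exact: cvg_id]].
Qed.

Lemma continuous_clamped : continuous (f \o clamp).
Proof.
move=> t N; have /subspace_continuousP/(_ (clamp t) (clamp_itv t)) := cf.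
move=> /[apply]; rewrite /= => h.
have hc := @continuous_clamp t _ h.
change (\forall s \near t, N (f (clamp s))); near=> s.
have : [set` `[0, 1]] (clamp s) -> N (f (clamp s)) by near: s; exact: hc.
by apply; exact: clamp_itv.
Unshelve. all: by end_near. Qed.

Lemma clamped_antiderivative : exists G : R -> R,
  (forall t, t \in `[0, 1] -> derivable G t 1 /\ derive1 G t = f t) /\
  G 1 - G 0 = \int[lebesgue_measure]_(t in `[0, 1]) f t.
Proof.
pose g := f \o clamp.
have ig a b : lebesgue_measure.-integrable `[a, b] (EFin \o g).
  apply: continuous_compact_integrable; first exact: segment_compact.
  by apply: continuous_subspaceT; exact: continuous_clamped.
(* Starting at -1 puts all of [0, 1] in the interior, so that [G] has two-sided derivatives at 0 and
   1. *)
pose G x := \int[lebesgue_measure]_(t in `[-1, x]) g t.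
exists G; split.
  move=> t t01; have := t01; rewrite in_itv /= => /andP[t0 t1].
  have [||||dG GE] := @continuous_FTC1_closed _ g (-1) t 2.
  - by rewrite (le_lt_trans t1)// ltr1n.
  - exact: ig.
  - by rewrite (lt_le_trans _ t0)// ltrN10.
  - exact: continuous_clamped.
  - by split=> //; rewrite -/G in GE; rewrite GE /g /= clamp_id.
rewrite /G (Rintegral_itvB _ (x := 0)) ?bnd_simp//.
rewrite Rintegral_itv_obnd_cbnd; last first.
  by apply: integrableS (ig 0 1) => //; exact: subset_itv_oc_cc.
by apply: eq_Rintegral => t; rewrite inE /= => t01; rewrite /g /= clamp_id.
Qed.

End Clamp.

Section C1Curve.
Variables (M : set B) (gamma : R -> B).
Hypothesis curve : c1_curve M gamma.

Let cspeed : {within `[0, 1], continuous (fun t => `|derive1 gamma t|)}.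
Proof.
case: curve => _ c t; apply: (@continuous_comp _ _ _ (derive1 gamma : subspace _ -> B)).
  exact: c.
exact: norm_continuous.
Qed.

Lemma curve_length_ge : `|gamma 1 - gamma 0| <= curve_length (fun _ w => `|w|) gamma.
Proof.
have [G [dG GE]] := clamped_antiderivative cspeed.
have -> : curve_length (fun _ w => `|w|) gamma = G 1 - G 0 by exact: esym GE.
apply: mean_value_le => t t01; have [dGt ->] := dG t t01; split=> //.
by have [/(_ t t01)[]] := curve.
Qed.

Lemma curve_length_le K : (forall t, t \in `[0, 1] -> `|derive1 gamma t| <= K) ->
  curve_length (fun _ w => `|w|) gamma <= K.
Proof.
move=> gK; have K1 : \int[lebesgue_measure]_(_ in `[0, 1]) K = K :> R.
  rewrite Rintegral_cst//.
  by rewrite [X in fine X](_ : _ = 1%:E) ?mulr1//= lebesgue_measure_itv /= lte_fin ltr01 oppr0 adde0.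
rewrite -[leRHS]K1; apply: le_Rintegral => //.
- by apply: continuous_compact_integrable; [exact: segment_compact|exact: cspeed].
- apply: continuous_compact_integrable; first exact: segment_compact.
  by apply: continuous_subspaceT => x; exact: cvg_cst.
Qed.

End C1Curve.

Lemma closed_submanifold_complete (X : completeNormedModType R) (M : set B) :
  c1_submanifold X M -> closed M -> finsler_complete M (fun _ w => `|w|).
Proof.
move=> subM clM u uM cu; pose F (_ w : B) := `|w|.
have dist_ge p q e : (finsler_dist M F p q < e%:E)%E -> `|p - q| < e.
  move=> /ereal_inf_lt[_ [gamma [cg g0 g1] <-]]; rewrite lte_fin; apply: le_lt_trans.
  by rewrite distrC -g0 -g1; exact: curve_length_ge cg.
have dist_ge0 p q : (0 <= finsler_dist M F p q)%E.
  apply: le_ereal_inf_tmp => _ [gamma _ <-]; rewrite lee_fin.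
  by apply: Rintegral_ge0 => t _; exact: normr_ge0.
have ucvg : cvgn u.
  apply/cauchy_cvgP/cauchy_ballP => e e0.
  have [n0 h] := cu e e0.
  exists (u @` [set n | (n0 <= n)%N], u @` [set n | (n0 <= n)%N]).
    by split; exists n0 => // n /= n0n; exists n.
  move=> [_ _] [/= [p n0p <-] [q n0q <-]].
  by rewrite /= -ball_normE; exact/dist_ge/h.
pose m := limn u.
have um : u n @[n --> \oo] --> m by exact: ucvg.
have Mm : M m by apply: (closed_cvg _ clM) um; exact: nearW.
exists m => //.
have [W [Phi [phi [chart Wm]]]] := subM m Mm.
have [U [Psi [oU Um MUW dPsi PsiE]]] := chart_ext chart Wm.
have [_ oP pP c1phi _] := chart.
have [_ [L L0 dL]] := diff_bl (chart_diff chart Wm).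
have [_ [K K0 dK]] := diff_bl dPsi.
have MW m' : W m' -> M m' by case: chart => -[U0 _ ->] _ _ _ _ [].
(* A ball in the chart on which the derivative of [phi] is bounded uniformly, by continuity of the
   derivative at [Phi m]. *)
have [r r0 Hr] : exists2 r, 0 < r & forall y, `|y - Phi m| < r ->
    (Phi @` W) y /\ forall v, `|'d phi y v| <= (L + 1) * `|v|.
  have [_ /(_ 1 ltr01) n1] := c1phi (Phi m) (ex_intro2 _ _ m Wm erefl).
  have nn : nbhs (Phi m) ([set y | (Phi @` W) y] `&`
      [set y | forall v, `|'d phi y v - 'd phi (Phi m) v| <= 1 * `|v|]).
    by apply: filterI; [exact: (chart_nbhs chart Wm)|exact: n1].
  have /nbhs_ballP[r /= r0 rP] := nn.
  exists r => // y yr; have [] := rP y; first by rewrite -ball_normE /= distrC.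
  move=> Wy h; split=> // v; rewrite mulrDl addrC.
  rewrite -(subrK ('d phi (Phi m) v) ('d phi y v)) (le_trans (ler_normD _ _))//.
  by rewrite lerD// (le_trans (h _))// mul1r.
have K1 : 0 < K + 1 by rewrite ltr_wpDl.
(* Differentiability of [Psi] at [m] gives this Lipschitz bound, since [m] is one of the two points
   compared. *)
have near_m : \forall x \near m, [/\ U x, `|Psi x - Phi m| <= (K + 1) * `|x - m| &
    `|Psi x - Phi m| < r].
  have lip : \forall x \near m, `|Psi x - Phi m| <= (K + 1) * `|x - m|.
    have /diff_locallyP[_ /eqaddoP/(_ 1 ltr01)] := dPsi.
    rewrite (PsiE m (conj Mm Um)).
    move=> /nbhs_norm0P[d /= d0 dd]; apply/nbhs_ballP; exists d => // x.
    rewrite -ball_normE /= distrC => xd; have := dd (x - m) xd => /=.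
    rewrite mul1r => h; rewrite mulrDl mul1r.
    rewrite -(subrK ('d Psi m (x - m)) (Psi x - Phi m)) (le_trans (ler_normD _ _))//.
    rewrite addrC lerD//; apply: le_trans h; rewrite le_eqVlt; apply/orP; left; apply/eqP.
    congr `|_|; rewrite -addrA -opprD.
    by rewrite -{1}(subrK m x).
  have nU : \forall x \near m, U x by exact: open_nbhs_nbhs.
  have nr : \forall x \near m, `|x - m| < r / (K + 1).
    by near=> x; rewrite distrC; near: x; apply: cvgr_dist_lt; rewrite ?divr_gt0//; exact: cvg_id.
  near=> x; have l : `|Psi x - Phi m| <= (K + 1) * `|x - m| by near: x.
  split=> //; first by near: x.
  apply: le_lt_trans l _; rewrite mulrC -ltr_pdivlMr//; near: x.
  exact: nr.
have near_dist : \forall x \near m, M x ->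
    (finsler_dist M F x m <= ((L + 1) * (K + 1) * `|x - m|)%R%:E)%E.
  apply: filterS near_m => x [Ux lip xr] Mx.
  (* The image of the segment from [Psi x] to [Phi m], which stays in the ball of radius [r] by
     convexity. *)
  pose gamma t := phi (t *: (Phi m - Psi x) + Psi x).
  have Wx : W x by exact: MUW.
  have line_r t : t \in `[0, 1] -> `|t *: (Phi m - Psi x) + Psi x - Phi m| < r.
    rewrite in_itv /= => /andP[t0 t1].
    have -> : t *: (Phi m - Psi x) + Psi x - Phi m = (1 - t) *: (Psi x - Phi m).
      by module R X.
    rewrite normrZ ger0_norm ?subr_ge0//; apply: le_lt_trans xr.
    by rewrite ler_piMl// lerBlDr lerDl.
  have gamma_diff (t : R) : t \in `[0, 1] -> is_derive t 1 gamma
      ('d phi (t *: (Phi m - Psi x) + Psi x) (Phi m - Psi x)).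
    move=> t01; set y := t *: _ + _.
    have [Wy _] := Hr _ (line_r t t01).
    have dy : differentiable phi y by have [] := c1phi y Wy.
    have sl : sdiff (fun s : R => s *: (Phi m - Psi x) + Psi x) t (fun s => s *: (Phi m - Psi x) + 0).
      apply: sdiffD; last exact: sdiff_cst.
      apply: sdiff_bl; split; first by move=> a b c; rewrite scalerDl scalerA.
      by exists `|Phi m - Psi x| => // v; rewrite normrZ mulrC.
    have [ds dsE] := sdiff_diff sl.
    have dg := differentiable_comp ds dy.
    apply: DeriveDef; first exact/derivable1_diffP.
    by rewrite deriveE// diff_comp//= dsE addr0 scale1r.
  have cg : c1_curve M gamma.
    split.
      move=> t t01; have [Wy _] := Hr _ (line_r t t01); split.
        by apply: MW; have [] := chart_phi chart Wy.
      by have [] := gamma_diff t t01.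
    apply/subspace_continuousP => t t01.
    apply/cvgrPdist_le => e e0.
    have [Wy _] := Hr _ (line_r t t01).
    set w := Phi m - Psi x; have w1 : 0 < `|w| + 1 by rewrite ltr_wpDl.
    have [_ /(_ (e / (`|w| + 1)) (divr_gt0 e0 w1)) n1] := c1phi _ Wy.
    have cl : (fun s : R => s *: w + Psi x) @ t --> t *: w + Psi x.
      by apply: cvgD; [exact: scalel_continuous|exact: cvg_cst].
    have {}n1 := cl _ n1.
    near=> s; have s01 : s \in `[0, 1] by near: s; exact: withinT.
    change (`|derive1 gamma t - derive1 gamma s| <= e).
    have [_] := gamma_diff t t01; rewrite -derive1E => ->.
    have [_] := gamma_diff s s01; rewrite -derive1E => ->.
    rewrite distrC -/w; apply: (@le_trans _ _ (e / (`|w| + 1) * `|w|)).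
      suff : forall v, `|'d phi (s *: w + Psi x) v - 'd phi (t *: w + Psi x) v| <=
        e / (`|w| + 1) * `|v| by [].
      near: s; apply: cvg_within; exact: n1.
    by rewrite mulrAC ler_pdivrMr// ler_wpM2l ?lerDl// ltW.
  apply: (@le_trans _ _ (curve_length F gamma)%:E).
    apply: ereal_inf_lbound; exists gamma => //; split=> //.
      by rewrite /gamma scale0r add0r PsiE// pP.
    by rewrite /gamma scale1r subrK pP.
  rewrite lee_fin; apply: (curve_length_le cg) => t t01.
  have [_] := gamma_diff t t01; rewrite -derive1E => ->.
  have [_ h] := Hr _ (line_r t t01); rewrite (le_trans (h _))// -mulrA ler_wpM2l ?addr_ge0//.
  by rewrite distrC.
have near_n : \forall n \near \oo, (0%:E <= finsler_dist M F (u n) m <=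
    ((L + 1) * (K + 1) * `|u n - m|)%R%:E)%E.
  near=> n; rewrite dist_ge0 /=.
  have : M (u n) -> (finsler_dist M F (u n) m <= ((L + 1) * (K + 1) * `|u n - m|)%R%:E)%E.
    by near: n; exact: um near_dist.
  exact.
apply: (squeeze_cvge near_n); first exact: cvg_cst.
apply: cvg_EFin; first exact: nearW.
rewrite -(mulr0 ((L + 1) * (K + 1))); apply: cvgM; first exact: cvg_cst.
rewrite -(normr0 B) -(subrr m); apply: cvg_norm; apply: cvgB => //; exact: cvg_cst.
Unshelve. all: by end_near. Qed.

End CurveLength.

Lemma bl_cvg (R : realType) (E G : normedModType R) (L : E -> G) (T : Type)
    (F : set_system T) (u : T -> E) a : Filter F ->
  bounded_linear L -> u x @[x --> F] --> a -> L (u x) @[x --> F] --> L a.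
Proof. by move=> FF l ua; apply: (cvg_comp u L ua); exact: bl_continuous. Qed.

(** * Model spaces: ranges of bounded idempotents *)

Section FixedSpace.
Variables (R : realType) (B : completeNormedModType R).

(** The range of a bounded idempotent is closed, hence complete, and the idempotent itself
    corestricts maps into [B] to it by a bounded linear map. *)
Record cont_projection := ContProjection {
  cproj :> B -> B;
  cproj_bl : bounded_linear cproj;
  cproj_idem : forall x, cproj (cproj x) = cproj x }.

Variable P : cont_projection.

Definition fixed_pred : {pred B} := fun x => P x == x.

Lemma fixed_predP x : reflect (P x = x) (x \in fixed_pred).
Proof. exact: eqP. Qed.

Lemma fixed_pred_submod : submod_closed fixed_pred.
Proof.
split=> [|a x y /fixed_predP Px /fixed_predP Py]; apply/fixed_predP.
  exact: bl0 (cproj_bl P).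
by rewrite blD ?blZ ?Px ?Py//; exact: cproj_bl.
Qed.

HB.instance Definition _ :=
  GRing.isSubmodClosed.Build _ _ fixed_pred fixed_pred_submod.

Record fixed_space := FixedElt { fixed_val :> B; _ : fixed_val \in fixed_pred }.
HB.instance Definition _ := [isSub for fixed_val].
HB.instance Definition _ := [Choice of fixed_space by <:].
HB.instance Definition _ := [SubChoice_isSubLmodule of fixed_space by <:].

Definition fixed_norm (x : fixed_space) : R := `|(x : B)|.

Lemma fixed_normD x y : fixed_norm (x + y) <= fixed_norm x + fixed_norm y.
Proof. exact: ler_normD. Qed.

Lemma fixed_normZ (a : R) x : fixed_norm (a *: x) = `|a| * fixed_norm x.
Proof. exact: normrZ. Qed.

Lemma fixed_norm_eq0 x : fixed_norm x = 0 -> x = 0.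
Proof. by move=> x0; apply: val_inj; exact: normr0_eq0. Qed.

HB.instance Definition _ := @Lmodule_isNormed.Build R fixed_space
  fixed_norm fixed_normD fixed_normZ fixed_norm_eq0.

Lemma fixed_valP (x : fixed_space) : P x = x.
Proof. exact/fixed_predP/(valP x). Qed.

Definition fixed_proj (x : B) : fixed_space :=
  FixedElt (introT (fixed_predP _) (cproj_idem P x)).

Lemma bl_fixed_val : bounded_linear fixed_val.
Proof. by split=> //; exists 1 => // v; rewrite mul1r. Qed.

Lemma bl_fixed_proj : bounded_linear fixed_proj.
Proof.
have [l [M M0 lM]] := cproj_bl P.
split; first by move=> a x y; apply: val_inj; exact: l.
by exists M.
Qed.

Lemma fixed_complete (F : set_system fixed_space) :
  ProperFilter F -> cauchy F -> cvg F.
Proof.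
move=> PF Fc; have Fv : cauchy (fixed_val @ F).
  move/cauchyP : Fc => Fc; apply/cauchyP => e e0.
  have [x Fx] := Fc e e0; exists (x : B).
  change (F [set y | ball (x : B) e (fixed_val y)]).
  apply: filterS Fx => y xy; change (ball (x : B) e (fixed_val y)).
  by rewrite -ball_normE /=; move: xy; rewrite -ball_normE.
have [y Fy] : exists y : B, fixed_val @ F --> y.
  by exists (lim (fixed_val @ F)); exact: (@cauchy_cvg B (fixed_val @ F) _ Fv).
have Py : P y = y.
  apply: (@cvg_unique _ (@norm_hausdorff _ B) (fixed_val @ F)) => //.
  have -> : fixed_val = P \o fixed_val by apply/funext => x; rewrite /= fixed_valP.
  by apply: cvg_comp Fy _; exact: (bl_continuous (cproj_bl P)).
apply/cvg_ex; exists (FixedElt (introT (fixed_predP y) Py)).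
apply/cvgrPdist_lt => e e0.
by move/cvgrPdist_lt : Fy => /(_ e e0).
Qed.

HB.instance Definition _ := Uniform_isComplete.Build fixed_space fixed_complete.

End FixedSpace.

(** * Inverses in Banach algebras *)

Section QuasiInverse.
Variables (R : realType) (B : completeNormedModType R) (mul : B -> B -> B).
Local Notation "x ** y" := (mul x y) (at level 40, left associativity).

Record banach_product : Prop := BanachProduct {
  bpA : forall x y z, x ** (y ** z) = x ** y ** z;
  bp_linr : forall x, linear (mul x);
  bp_linl : forall y, linear (mul^~ y);
  bp_norm : forall x y, `|x ** y| <= `|x| * `|y| }.

Hypothesis bp : banach_product.

Lemma bl_mull x : bounded_linear (mul x).
Proof. by split; [exact: bp_linr|exists `|x| => // v; exact: bp_norm]. Qed.

Lemma bl_mulr y : bounded_linear (mul^~ y).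
Proof.
by split; [exact: bp_linl|exists `|y| => // v; rewrite mulrC; exact: bp_norm].
Qed.

Lemma bpDr x y z : x ** (y + z) = x ** y + x ** z. Proof. exact: (blD _ _ (bl_mull x)). Qed.
Lemma bpDl x y z : (x + y) ** z = x ** z + y ** z. Proof. exact: (blD _ _ (bl_mulr z)). Qed.
Lemma bpBr x y z : x ** (y - z) = x ** y - x ** z. Proof. exact: (blB _ _ (bl_mull x)). Qed.
Lemma bpBl x y z : (x - y) ** z = x ** z - y ** z. Proof. exact: (blB _ _ (bl_mulr z)). Qed.
Lemma bpNr x y : x ** (- y) = - (x ** y). Proof. exact: (blN _ (bl_mull x)). Qed.
Lemma bpNl x y : (- x) ** y = - (x ** y). Proof. exact: (blN _ (bl_mulr y)). Qed.
Lemma bpZr a x y : x ** (a *: y) = a *: (x ** y). Proof. exact: (blZ _ _ (bl_mull x)). Qed.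
Lemma bpZl a x y : (a *: x) ** y = a *: (x ** y). Proof. exact: (blZ _ _ (bl_mulr y)). Qed.
Lemma bp0r x : x ** 0 = 0. Proof. exact: (bl0 (bl_mull x)). Qed.
Lemma bp0l x : 0 ** x = 0. Proof. exact: (bl0 (bl_mulr x)). Qed.

Lemma sdiff_mul (E : normedModType R) (f g : E -> B) x L K :
  sdiff f x L -> sdiff g x K ->
  sdiff (fun y => f y ** g y) x (fun v => f x ** K v + L v ** g x).
Proof.
move=> fL gK; apply: (sdiff_bilin (C := 1)) => //; [exact: bp_linr|exact: bp_linl|].
by move=> u w; rewrite mul1r; exact: bp_norm.
Qed.

(* The terms of the Neumann series of [(1 + K)^-1 - 1]. *)
Definition qterm (K : B) (n : nat) : B := iter n (fun t => - (K ** t)) (- K).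

Definition qinv (K : B) : B := limn (series (qterm K)).

Lemma qterm_norm K n : `|qterm K n| <= `|K| ^+ n.+1.
Proof.
elim: n => [|n IH]; first by rewrite /qterm /= normrN expr1.
rewrite [qterm K n.+1]/(- (K ** qterm K n)) normrN exprS.
by rewrite (le_trans (bp_norm bp _ _))// ler_wpM2l.
Qed.

Lemma qterm_comm K n : K ** qterm K n = qterm K n ** K.
Proof.
elim: n => [|n IH]; first by rewrite /qterm /= bpNr bpNl.
by rewrite [qterm K n.+1]/(- (K ** qterm K n)) bpNr bpNl {1}IH (bpA bp).
Qed.

Lemma qseries_cvg K : `|K| < 1 -> series (qterm K) n @[n --> \oo] --> qinv K.
Proof.
move=> K1; apply: normed_cvg.
apply: (@series_le_cvg _ _ (geometric `|K| `|K|)) => [n|n|n|].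
- exact: normr_ge0.
- by rewrite /geometric /= mulr_ge0// exprn_ge0.
- by rewrite /geometric /= -exprS; exact: qterm_norm.
- by apply: is_cvg_geometric_series; rewrite normr_id.
Qed.

(** With q = [qinv K], this is (1 + K) (1 + q) = 1 written without the unit; [qinvE'] is the product
    in the other order. *)
Lemma qinvE K : `|K| < 1 -> qinv K = - K - K ** qinv K.
Proof.
move=> K1; have c := qseries_cvg K1.
have c1 : series (qterm K) n.+1 @[n --> \oo] --> qinv K by rewrite (cvg_shiftS (series (qterm K))).
apply: (cvg_unique _ c1) => //.
have -> : (fun n => series (qterm K) n.+1) = (fun n => - K - K ** series (qterm K) n).
  apply/funext => n; rewrite /series /= big_nat_recl//; congr (_ + _).
  elim: n => [|n IH]; first by rewrite !big_geq// bp0r oppr0.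
  by rewrite !big_nat_recr//= IH bpDr opprD.
apply: cvgB; first exact: cvg_cst.
exact: bl_cvg (bl_mull K) c.
Qed.

Lemma qinv_comm K : `|K| < 1 -> K ** qinv K = qinv K ** K.
Proof.
move=> K1; have c := qseries_cvg K1.
have c1 := bl_cvg eventually_filter (bl_mull K) c.
have c2 := bl_cvg eventually_filter (bl_mulr K) c.
apply: (cvg_unique _ c1) => //.
have -> : (fun n => K ** series (qterm K) n) = (fun n => series (qterm K) n ** K).
  apply/funext => n; rewrite /series /=.
  elim: n => [|n IH]; first by rewrite big_geq// bp0r bp0l.
  by rewrite !big_nat_recr//= bpDr bpDl IH qterm_comm.
exact: c2.
Qed.

Lemma qinvE' K : `|K| < 1 -> qinv K = - K - qinv K ** K.
Proof. by move=> K1; rewrite -qinv_comm//; exact: qinvE. Qed.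

Lemma qinv_norm K : `|K| < 1 -> `|qinv K| <= `|K| / (1 - `|K|).
Proof.
move=> K1; rewrite ler_pdivlMr ?subr_gt0// mulrBr mulr1 lerBlDr mulrC.
rewrite {1}qinvE// (le_trans (ler_normB _ _))// normrN lerD2l.
exact: bp_norm.
Qed.

(** The resolvent identity (1 + y)^-1 - (1 + z)^-1 = - (1 + y)^-1 (y - z) (1 + z)^-1, expanded so
    that no unit occurs. *)
Lemma qinvB y z : `|y| < 1 -> `|z| < 1 ->
  qinv y - qinv z = - ((y - z) + qinv y ** (y - z) + (y - z) ** qinv z +
    qinv y ** (y - z) ** qinv z).
Proof.
move=> y1 z1; set a := qinv y; set b := qinv z.
have ay : a ** y = - y - a by rewrite [in RHS]/a (qinvE' y1) -/a; module R B.
have zb : z ** b = - z - b by rewrite [in RHS]/b (qinvE z1) -/b; module R B.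
rewrite !(bpBr, bpBl) ay zb !(bpBl, bpNl) -(bpA bp a z) zb bpBr bpNr.
by module R B.
Qed.

(** The derivative is - (1 + q) h (1 + q) with q = [qinv x]. The resolvent identity gives first a
    Lipschitz bound, then the remainder. *)
Lemma sdiff_qinv x : `|x| < 1 ->
  sdiff qinv x (fun h => - (h + qinv x ** h + h ** qinv x + qinv x ** h ** qinv x)).
Proof.
move=> x1; split.
  apply/bl_opp/bl_add; last exact: bl_comp (bl_mull _) (bl_mulr _).
  by apply: bl_add (bl_mulr _); apply: bl_add (bl_mull _); exact: bl_id.
(* [p] is the midpoint between the norm of [x] and 1: [qinv] is bounded by [C] on the ball of radius
   [p] about 0. *)
move=> e e0; pose p := (1 + `|x|) / 2.
have p1 : p < 1 by rewrite ltr_pdivrMr// mul1r -[2]/(1 + 1) ltrD2l.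
have p0 : 0 <= p by rewrite divr_ge0// addr_ge0.
have xp : `|x| < p by rewrite ltr_pdivlMr// mulr_natr mulr2n ltrD2r.
pose C := p / (1 - p); have C0 : 0 <= C by rewrite divr_ge0// subr_ge0 ltW.
have qC y : `|y| <= p -> `|qinv y| <= C.
  move=> yp; have y1 : `|y| < 1 by exact: le_lt_trans yp p1.
  rewrite (le_trans (qinv_norm y1))// ler_pM ?invr_ge0 ?subr_ge0 ?(ltW y1)//.
  by rewrite lef_pV2 ?posrE ?subr_gt0// lerD2l lerN2.
have C1 : 0 < 1 + C by rewrite ltr_pwDl.
have qlip y : `|y| <= p -> `|qinv y - qinv x| <= (1 + C) ^+ 2 * `|y - x|.
  move=> yp; rewrite qinvB ?(le_lt_trans yp)// normrN.
  have h1 : `|qinv y ** (y - x)| <= C * `|y - x|.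
    by rewrite (le_trans (bp_norm bp _ _))// ler_wpM2r// qC.
  have h2 : `|(y - x) ** qinv x| <= C * `|y - x|.
    by rewrite (le_trans (bp_norm bp _ _))// mulrC ler_wpM2r// qC// ltW.
  have h3 : `|qinv y ** (y - x) ** qinv x| <= C * `|y - x| * C.
    by rewrite (le_trans (bp_norm bp _ _))// ler_pM// qC// ltW.
  have -> : (1 + C) ^+ 2 * `|y - x| = `|y - x| + C * `|y - x| + C * `|y - x| + C * `|y - x| * C by ring.
  rewrite (le_trans (ler_normD _ _))// lerD// (le_trans (ler_normD _ _))// lerD//.
  by rewrite (le_trans (ler_normD _ _))// lerD.
have q0 : 0 < 2 * (1 + C) ^+ 3 by rewrite mulr_gt0// exprn_gt0.
(* [a - c] and [b - c] are then at most l = (1 + C)^2 e / (2 (1 + C)^3), and the four terms below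
   add up to 2 (1 + C) l |D| = e |D|. *)
exists (Num.min (p - `|x|) (e / (2 * (1 + C) ^+ 3))).
  by rewrite lt_min subr_gt0 xp divr_gt0.
move=> y z; rewrite !lt_min => /andP[yp ye] /andP[zp ze].
have near w : `|w - x| < p - `|x| -> `|w| <= p.
  move=> h; rewrite -(subrK x w) (le_trans (ler_normD _ _))// -lerBrDr ltW//.
have {}yp := near _ yp; have {}zp := near _ zp.
have y1 := le_lt_trans yp p1; have z1 := le_lt_trans zp p1.
rewrite qinvB//; set D := y - z; set a := qinv y; set b := qinv z; set c := qinv x.
have -> : - (D + a ** D + D ** b + a ** D ** b) - - (D + c ** D + D ** c + c ** D ** c) =
   - (((a - c) ** D + (a - c) ** D ** b) + (D ** (b - c) + c ** D ** (b - c))).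
  by rewrite !(bpBl, bpBr); module R B.
have lipa : `|a - c| <= (1 + C) ^+ 2 * (e / (2 * (1 + C) ^+ 3)).
  by rewrite (le_trans (qlip _ yp))// ler_wpM2l ?exprn_ge0 ?(ltW C1)// ltW.
have lipb : `|b - c| <= (1 + C) ^+ 2 * (e / (2 * (1 + C) ^+ 3)).
  by rewrite (le_trans (qlip _ zp))// ler_wpM2l ?exprn_ge0 ?(ltW C1)// ltW.
set l := (1 + C) ^+ 2 * _ in lipa lipb.
have l0 : 0 <= l by rewrite (le_trans _ lipa).
rewrite normrN; apply: (@le_trans _ _ ((l * `|D| + l * `|D| * C) + (`|D| * l + C * `|D| * l))).
  have m1 : `|(a - c) ** D| <= l * `|D|.
    by rewrite (le_trans (bp_norm bp _ _))// ler_wpM2r.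
  have m2 : `|(a - c) ** D ** b| <= l * `|D| * C.
    by rewrite (le_trans (bp_norm bp _ _))// ler_pM// qC.
  have m3 : `|D ** (b - c)| <= `|D| * l.
    by rewrite (le_trans (bp_norm bp _ _))// ler_wpM2l.
  have m4 : `|c ** D ** (b - c)| <= C * `|D| * l.
    rewrite (le_trans (bp_norm bp _ _))// ler_pM//.
    by rewrite (le_trans (bp_norm bp _ _))// ler_wpM2r// qC// ltW.
  rewrite (le_trans (ler_normD _ _))// lerD//; rewrite (le_trans (ler_normD _ _))// lerD//.
rewrite le_eqVlt; apply/orP; left; apply/eqP; rewrite /l.
by field; rewrite gt_eqF.
Qed.

End QuasiInverse.

(** * Operators on H^1 and the ideal *)

Section H1Norm.
Variable R : realType.
Implicit Types phi psi : H1 R.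

Local Notation ip := (l2_inner_product R).
Local Notation hp := (h1_inner_product R).

Lemma h1norm_ge0 phi : 0 <= h1norm phi. Proof. exact: sqrtr_ge0. Qed.

Lemma h1norm0 : h1norm (0 : H1 R) = 0. Proof. exact: ip_norm0 hp. Qed.

Lemma h1normZ a phi : h1norm (a *: phi) = cabs a * h1norm phi.
Proof. exact: ip_normZ hp _ _. Qed.

Lemma h1normD phi psi : h1norm (phi + psi) <= h1norm phi + h1norm psi.
Proof. exact: ip_norm_triangle hp _ _. Qed.

Lemma h1norm_eq0 phi : h1norm phi = 0 -> phi = 0.
Proof. exact: ip_norm_eq0 hp _. Qed.

Lemma l2norm_ge0 phi : 0 <= l2norm phi. Proof. exact: sqrtr_ge0. Qed.

Lemma l2dot_self phi : l2dot phi phi = ((l2norm phi ^+ 2)%:C)%C.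
Proof. exact: ip_self ip _. Qed.

Lemma l2norm_eq0 phi : l2norm phi = 0 -> phi = 0.
Proof. exact: ip_norm_eq0 ip _. Qed.

Lemma cabs_l2dot_le phi psi : cabs (l2dot phi psi) <= h1norm phi * l2norm psi.
Proof.
rewrite (le_trans (ip_cauchy_schwarz ip _ _))// ler_wpM2r ?sqrtr_ge0//.
exact: l2norm_le_h1norm.
Qed.

End H1Norm.

(* Unification would otherwise unfold the integrals. *)
Opaque h1norm h1dot l2norm l2dot.

Section BoundedOperators.
Variable R : realType.
Implicit Types (X Y Z : H1 R -> H1 R) (phi psi xi v f : H1 R).

Local Notation ip := (l2_inner_product R).
Local Notation hp := (h1_inner_product R).

Lemma linD X x y : linear X -> X (x + y) = X x + X y.
Proof. by move=> l; have := l 1 x y; rewrite !scale1r. Qed.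

Lemma lin0 X : linear X -> X 0 = 0.
Proof.
by move=> l; have := linD 0 0 l; rewrite addr0 => /eqP; rewrite -subr_eq subrr eq_sym => /eqP.
Qed.

Lemma linZ X a x : linear X -> X (a *: x) = a *: X x.
Proof. by move=> l; have := l a x 0; rewrite !addr0 (lin0 l) addr0. Qed.

Lemma linB X x y : linear X -> X (x - y) = X x - X y.
Proof. by move=> l; rewrite linD// -scaleN1r linZ// scaleN1r. Qed.

Lemma lin_sum X (J : Type) (r : seq J) (P : pred J) (F : J -> H1 R) : linear X ->
  X (\sum_(i <- r | P i) F i) = \sum_(i <- r | P i) X (F i).
Proof. by move=> l; elim/big_rec2 : _ => [|i x y _ <-]; rewrite ?lin0// linD. Qed.

Lemma h1norm_gt0 phi : phi <> 0 -> 0 < h1norm phi.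
Proof.
move=> phi0; rewrite lt_neqAle h1norm_ge0 andbT eq_sym.
by apply/eqP => /h1norm_eq0.
Qed.

Lemma bounded_opP X M : linear X -> (forall phi, h1norm (X phi) <= M * h1norm phi) ->
  bounded_op X.
Proof. by split=> //; exists M. Qed.

Lemma bounded_op_ge0 X : bounded_op X -> exists2 M, 0 <= M &
  forall phi, h1norm (X phi) <= M * h1norm phi.
Proof.
move=> [_ [M XM]]; exists `|M| => // phi; rewrite (le_trans (XM phi))//.
by rewrite ler_wpM2r ?h1norm_ge0// ler_norm.
Qed.

Lemma bounded_op_id : bounded_op (@idfun (H1 R)).
Proof. by apply: (@bounded_opP _ 1) => // phi; rewrite mul1r. Qed.

Lemma bounded_op_comp X Y : bounded_op X -> bounded_op Y -> bounded_op (X \o Y).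
Proof.
move=> bX bY; have [M M0 XM] := bounded_op_ge0 bX; have [N N0 YN] := bounded_op_ge0 bY.
apply: (@bounded_opP _ (M * N)); first by move=> a x y /=; rewrite bY.1 bX.1.
by move=> phi; rewrite (le_trans (XM _))// -mulrA ler_wpM2l.
Qed.

Lemma bounded_op_lin a X Y : bounded_op X -> bounded_op Y -> bounded_op (a *: X + Y).
Proof.
move=> bX bY; have [M M0 XM] := bounded_op_ge0 bX; have [N N0 YN] := bounded_op_ge0 bY.
apply: (@bounded_opP _ (cabs a * M + N)).
  move=> c x y; rewrite -[LHS]/(a *: X (c *: x + y) + Y (c *: x + y)).
  rewrite -[(a *: X + Y) x]/(a *: X x + Y x) -[(a *: X + Y) y]/(a *: X y + Y y).
  by rewrite bX.1 bY.1; module R[i] (H1 R).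
move=> phi; rewrite -[(a *: X + Y) phi]/(a *: X phi + Y phi).
rewrite (le_trans (h1normD _ _))// mulrDl lerD//.
by rewrite h1normZ -mulrA ler_wpM2l// cabs_ge0.
Qed.

Definition rk1 f v : H1 R -> H1 R := fun xi => l2dot xi f *: v.

Lemma rk1_linear f v : linear (rk1 f v).
Proof. by move=> a x y; rewrite /rk1 (ip_linl ip) scalerDl scalerA. Qed.

Lemma bounded_op_rk1 f v : bounded_op (rk1 f v).
Proof.
apply: (@bounded_opP _ (l2norm f * h1norm v)); first exact: rk1_linear.
move=> phi; rewrite h1normZ mulrC [l2norm f * _]mulrC -mulrA ler_wpM2l ?h1norm_ge0//.
by rewrite mulrC cabs_l2dot_le.
Qed.

Section OpNorm.
Variable X : H1 R -> H1 R.
Hypothesis bX : bounded_op X.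

Let E := [set h1norm (X phi) | phi in [set phi | h1norm phi <= 1]].

Let has_supE : has_sup E.
Proof.
have [M M0 XM] := bounded_op_ge0 bX; split.
  by exists (h1norm (X 0)), 0 => //=; rewrite h1norm0.
by exists M => _ [phi /= p1 <-]; rewrite (le_trans (XM _))// ler_piMr.
Qed.

Lemma opnorm_ub phi : h1norm (X phi) <= opnorm X * h1norm phi.
Proof.
have [->|/eqP/h1norm_gt0 p0] := eqVneq phi 0.
  by rewrite (lin0 bX.1) h1norm0 mulr0.
rewrite -ler_pdivrMr//; apply: ub_le_sup; first by case: has_supE.
exists (((h1norm phi)^-1)%:C%C *: phi) => /=.
  by rewrite h1normZ cabs_real ger0_norm ?invr_ge0 ?h1norm_ge0// mulVf// gt_eqF.
by rewrite (linZ _ _ bX.1) h1normZ cabs_real ger0_norm ?invr_ge0 ?h1norm_ge0// mulrC.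
Qed.

Lemma opnorm_ge0 : 0 <= opnorm X.
Proof.
apply: (@le_trans _ _ (h1norm (X 0))); first exact: h1norm_ge0.
by apply: ub_le_sup; [case: has_supE|exists 0 => //=; rewrite h1norm0].
Qed.

Lemma opnorm_le M : 0 <= M -> (forall phi, h1norm (X phi) <= M * h1norm phi) -> opnorm X <= M.
Proof.
move=> M0 XM; apply: ge_sup; first by case: has_supE.
by move=> _ [phi /= p1 <-]; rewrite (le_trans (XM _))// ler_piMr.
Qed.

End OpNorm.

Lemma opnorm_id_le1 : opnorm (@idfun (H1 R)) <= 1.
Proof. by apply: opnorm_le => //; [exact: bounded_op_id|move=> phi; rewrite mul1r]. Qed.

(** For fixed [f] the operator norm of [rk1 f v] is proportional to the norm of [v]; written without
    quotients, this covers zero vectors. *)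
Lemma opnorm_rk1_le f v w : opnorm (rk1 f v) * h1norm w <= opnorm (rk1 f w) * h1norm v.
Proof.
have [->|/eqP/h1norm_gt0 w0] := eqVneq w 0.
  by rewrite h1norm0 mulr0 mulr_ge0 ?h1norm_ge0 ?opnorm_ge0//; exact: bounded_op_rk1.
rewrite -ler_pdivlMr//; apply: opnorm_le; first exact: bounded_op_rk1.
  by rewrite mulr_ge0 ?invr_ge0 ?mulr_ge0 ?h1norm_ge0 ?opnorm_ge0//; exact: bounded_op_rk1.
move=> phi; rewrite h1normZ mulrAC ler_pdivlMr// mulrAC [leRHS]mulrAC ler_wpM2r ?h1norm_ge0//.
by have := opnorm_ub (bounded_op_rk1 f w) phi; rewrite h1normZ.
Qed.

Lemma rk1_has_rank1 f v : f <> 0 -> v <> 0 -> has_rank 1 (rk1 f v).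
Proof.
move=> f0 v0; exists (fun=> v).
  move=> c; rewrite big_ord1 => cv i; rewrite (ord1 i).
  by have /eqP := cv; rewrite scaler_eq0 => /orP[/eqP//|/eqP].
apply/seteqP; split=> [_ [xi _ <-]|_ [c _ <-]].
  by exists (fun=> l2dot xi f) => //; rewrite big_ord1.
rewrite big_ord1; exists ((c ord0 / l2dot f f) *: f) => //.
rewrite /rk1 (ipZl ip) divfK//; apply/eqP => /(ip_eq0 ip).
exact: f0.
Qed.

End BoundedOperators.

Section IdealAlgebra.
Variables (R : realType) (I : sn_ideal R).
Implicit Types (X Y Z : H1 R -> H1 R) (phi psi xi v f : H1 R) (A B C : ideal_space I).

Local Notation ip := (l2_inner_product R).

(** An element [X] of the ideal with [X eta] nonzero is placed between two rank-one operators: the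
    right one maps onto multiples of [eta], the left one sends [X eta] to [v]. *)
Lemma ideal_rk1 f v : sni_set I (rk1 f v).
Proof.
have [X IX X0] := sni_neq0 I.
have [eta Xeta] : exists eta, X eta <> 0.
  apply: contrapT => /forallNP h; apply: X0; apply/funext => x.
  exact: contrapT (h x).
have lX : linear X by have [] := sni_bounded IX.
have -> : rk1 f v = rk1 (X eta) ((l2dot (X eta) (X eta))^-1 *: v) \o X \o rk1 f eta.
  apply/funext => x; rewrite /rk1 /= (linZ _ _ lX) (ipZl ip) scalerA mulfK//.
  by apply/eqP => /(ip_eq0 ip).
by apply: sni_mulr (bounded_op_rk1 _ _); apply: sni_mull IX; exact: bounded_op_rk1.
Qed.

Lemma ideal_bounded A : bounded_op A.
Proof. exact: sni_bounded (ideal_opP A). Qed.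

(** Composing [X] with [rk1 v v] gives [rk1 v (X v)], whose ideal norm is its operator norm. That
    norm is proportional to the norm of [X v], and the factor [opnorm (rk1 v v)] cancels. *)
Lemma ideal_opnorm_le X : sni_set I X -> opnorm X <= sni_norm I X.
Proof.
move=> IX; have bX := sni_bounded IX.
have s0 : 0 <= sni_norm I X.
  exact: (normr_ge0 (IdealElt (introT (sni_predP I X) IX) : ideal_space I)).
apply: opnorm_le => // v.
have [->|/eqP v0] := eqVneq v 0; first by rewrite (lin0 bX.1) h1norm0 mulr0.
have [->|/eqP Xv0] := eqVneq (X v) 0.
  by rewrite h1norm0 mulr_ge0// h1norm_ge0.
have o0 : 0 < opnorm (rk1 v v).
  have := opnorm_ub (bounded_op_rk1 v v) v; rewrite h1normZ.
  have [v1 vv] : 0 < h1norm v /\ 0 < cabs (l2dot v v).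
    split; first exact: h1norm_gt0.
    rewrite l2dot_self cabs_real normr_gt0 expf_eq0 /=.
    by apply/eqP => /l2norm_eq0.
  by rewrite ler_pM2r//; exact: lt_le_trans.
have := sni_norm_mul (bounded_op_id R) IX (bounded_op_rk1 v v).
have -> : idfun \o X \o rk1 v v = rk1 v (X v).
  by apply/funext => x; rewrite /rk1 /= (linZ _ _ bX.1).
rewrite sni_norm_rank1; [|exact: ideal_rk1|exact: rk1_has_rank1].
move=> h1; have h2 := opnorm_rk1_le v v (X v).
rewrite -(ler_pM2l o0) (le_trans h2)// mulrA; apply: ler_wpM2r; first exact: h1norm_ge0.
rewrite (le_trans h1)// mulrC; apply: ler_wpM2l; first exact: ltW.
by rewrite ler_piMl// opnorm_id_le1.
Qed.

Lemma ideal_norm_ub A phi : h1norm (A phi) <= `|A| * h1norm phi.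
Proof.
rewrite (le_trans (opnorm_ub (ideal_bounded A) phi))// ler_wpM2r ?h1norm_ge0//.
exact: ideal_opnorm_le (ideal_opP A).
Qed.

Definition ielt X (IX : sni_set I X) : ideal_space I := IdealElt (introT (sni_predP I X) IX).

Definition imul A B : ideal_space I :=
  ielt (sni_mull (ideal_bounded A) (ideal_opP B)).

Lemma ideal_eq A B : (forall xi, A xi = B xi) -> A = B.
Proof. by move=> AB; apply: val_inj; apply/funext. Qed.

(** For multipliers outside the ideal, such as the unitaries of the group action. *)
Definition ilmul U (bU : bounded_op U) A : ideal_space I := ielt (sni_mull bU (ideal_opP A)).

Definition irmul U (bU : bounded_op U) A : ideal_space I := ielt (sni_mulr (ideal_opP A) bU).

Lemma bl_ilmul U (bU : bounded_op U) : bounded_linear (ilmul bU).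
Proof.
split.
  by move=> a x y; apply: ideal_eq => xi; exact: bU.1 (a%:C)%C (x xi) (y xi).
exists (opnorm U); first exact: opnorm_ge0.
move=> A; have := sni_norm_mul bU (ideal_opP A) (bounded_op_id R).
move=> /le_trans; apply; rewrite ler_piMr ?opnorm_id_le1// mulr_ge0 ?opnorm_ge0//.
exact: (normr_ge0 A).
Qed.

Lemma bl_irmul U (bU : bounded_op U) : bounded_linear (irmul bU).
Proof.
split; first by move=> a x y; exact: ideal_eq.
exists (opnorm U); first exact: opnorm_ge0.
move=> A; have := sni_norm_mul (bounded_op_id R) (ideal_opP A) bU.
move=> /le_trans; apply; rewrite mulrC; apply: ler_wpM2l; first exact: opnorm_ge0.
by rewrite ler_piMl ?opnorm_id_le1//; exact: (normr_ge0 A).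
Qed.

Lemma imul_banach : banach_product imul.
Proof.
split=> [A B C|A|B|A B].
- exact: ideal_eq.
- exact: (bl_ilmul (ideal_bounded A)).1.
- by move=> a x y; exact: ideal_eq.
- have := sni_norm_mul (ideal_bounded A) (ideal_opP B) (bounded_op_id R).
  move=> /le_trans; apply; apply: (@le_trans _ _ (opnorm A * `|B|)).
    by rewrite ler_piMr ?opnorm_id_le1// mulr_ge0 ?opnorm_ge0//; [exact: ideal_bounded|exact: (normr_ge0 B)].
  by rewrite ler_wpM2r//; exact: ideal_opnorm_le (ideal_opP A).
Qed.

End IdealAlgebra.

(** * Orthonormal systems and transitivity of the unitaries *)

Section Orthonormal.
Variable R : realType.
Implicit Types (x y z u v : H1 R) (n : nat).

Local Notation ip := (l2_inner_product R).

Definition orthonormal n (s : 'I_n -> H1 R) := forall i j, l2dot (s i) (s j) = (i == j)%:R.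

Definition onproj n (s : 'I_n -> H1 R) : H1 R -> H1 R :=
  fun x => \sum_i l2dot x (s i) *: s i.

Definition snoc (T : Type) n (s : 'I_n -> T) (v : T) : 'I_n.+1 -> T :=
  fun i => if unlift ord_max i is Some j then s j else v.

Lemma snoc_max T n (s : 'I_n -> T) (v : T) : snoc s v ord_max = v.
Proof. by rewrite /snoc unlift_none. Qed.

Lemma snoc_lift T n (s : 'I_n -> T) (v : T) j : snoc s v (lift ord_max j) = s j.
Proof. by rewrite /snoc liftK. Qed.

Lemma sum_ord_max (V : zmodType) n (F : 'I_n.+1 -> V) :
  \sum_i F i = \sum_i F (lift ord_max i) + F ord_max.
Proof.
rewrite big_ord_recr; congr (_ + _); apply: eq_bigr => i _; congr F.
by apply: ord_inj; rewrite lift_max.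
Qed.

Lemma lspan_gen n (b : 'I_n -> H1 R) i : lspan b (b i).
Proof.
exists (fun j => (j == i)%:R) => //; rewrite (bigD1 i)//= eqxx scale1r big1 ?addr0// => j ji.
by rewrite (negbTE ji) scale0r.
Qed.

Lemma lspan_lin n (b : 'I_n -> H1 R) a x y : lspan b x -> lspan b y -> lspan b (a *: x + y).
Proof.
move=> [c _ <-] [d _ <-]; exists (fun i => a * c i + d i) => //.
by rewrite scaler_sumr -big_split; apply: eq_bigr => i _; rewrite scalerDl scalerA.
Qed.

Lemma lspan0 n (b : 'I_n -> H1 R) : lspan b 0.
Proof. by exists (fun=> 0) => //; rewrite big1// => i _; rewrite scale0r. Qed.

Lemma lspan_sum n (b : 'I_n -> H1 R) m (c : 'I_m -> R[i]) (d : 'I_m -> H1 R) :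
  (forall i, lspan b (d i)) -> lspan b (\sum_i c i *: d i).
Proof.
move=> bd; elim/big_rec : _ => [|i x _ bx]; first exact: lspan0.
exact: lspan_lin.
Qed.

Lemma lspan_sub n m (b : 'I_n -> H1 R) (d : 'I_m -> H1 R) :
  (forall i, lspan b (d i)) -> lspan d `<=` lspan b.
Proof. by move=> bd _ [c _ <-]; exact: lspan_sum. Qed.

Section OneSystem.
Variables (n : nat) (s : 'I_n -> H1 R).
Hypothesis os : orthonormal s.

Lemma l2dot_comb c j : l2dot (\sum_i c i *: s i) (s j) = c j.
Proof.
rewrite (ip_suml ip) (bigD1 j)//= (ipZl ip) os eqxx mulr1 big1 ?addr0// => i ij.
by rewrite (ipZl ip) os (negbTE ij) mulr0.
Qed.

Lemma orthonormal_indep : lin_indep s.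
Proof. by move=> c c0 i; rewrite -(l2dot_comb c i) c0 (ip0l ip). Qed.

Lemma onproj_id x : lspan s x -> onproj s x = x.
Proof.
by move=> [c _ <-]; rewrite /onproj; apply: eq_bigr => i _; rewrite l2dot_comb.
Qed.

Lemma onproj_mem x : lspan s (onproj s x).
Proof. by exists (fun i => l2dot x (s i)). Qed.

Lemma onproj_orth x i : l2dot (x - onproj s x) (s i) = 0.
Proof. by rewrite (ipBl ip) l2dot_comb subrr. Qed.

Lemma onproj_sym x y : l2dot (onproj s x) y = l2dot x (onproj s y).
Proof.
rewrite (ip_suml ip) (ip_sumr ip); apply: eq_bigr => i _.
by rewrite (ipZl ip) (ipZr ip) -(ip_conj ip) mulrC.
Qed.

End OneSystem.

Lemma lin_indep_lift n (b : 'I_n.+1 -> H1 R) :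
  lin_indep b -> lin_indep (fun j => b (lift ord_max j)).
Proof.
move=> ib c c0 i; have := ib (snoc c 0) _ (lift ord_max i); rewrite snoc_lift; apply.
rewrite sum_ord_max snoc_max scale0r addr0 -[RHS]c0.
by apply: eq_bigr => j _; rewrite snoc_lift.
Qed.

Lemma lin_indep_last n (b : 'I_n.+1 -> H1 R) :
  lin_indep b -> ~ lspan (fun j => b (lift ord_max j)) (b ord_max).
Proof.
move=> ib [c _ cE].
have c0 : \sum_i snoc c (-1) i *: b i = 0.
  rewrite sum_ord_max snoc_max -[X in _ + _ *: X]cE scaleN1r.
  by under eq_bigr do rewrite snoc_lift; rewrite subrr.
by have /eqP := ib _ c0 ord_max; rewrite snoc_max oppr_eq0 oner_eq0.
Qed.

Lemma orthonormal_snoc n (s : 'I_n -> H1 R) v : orthonormal s -> l2dot v v = 1 ->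
  (forall i, l2dot v (s i) = 0) -> orthonormal (snoc s v).
Proof.
move=> os vv vs i j.
case: (unliftP ord_max i) => [k ->|->]; case: (unliftP ord_max j) => [l ->|->];
  rewrite ?snoc_max ?snoc_lift.
- by rewrite os (inj_eq lift_inj).
- by rewrite (ip_conj ip) vs conjc0 eq_sym (negbTE (neq_lift _ _)).
- by rewrite vs (negbTE (neq_lift _ _)).
- by rewrite vv eqxx.
Qed.

Lemma gram_schmidt n (b : 'I_n -> H1 R) : lin_indep b ->
  exists2 s : 'I_n -> H1 R, orthonormal s & lspan s = lspan b.
Proof.
elim: n b => [b _|n IH b ib]; first by exists b => // -[].
have [s os sE] := IH _ (lin_indep_lift ib).
set bl := b ord_max; pose w := bl - onproj s bl.
have w0 : w <> 0.
  move=> /eqP; rewrite subr_eq0 => /eqP wE; apply: (lin_indep_last ib).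
  by rewrite -sE -/bl wE; exact: onproj_mem.
have lw0 : l2norm w != 0 by apply/eqP => /l2norm_eq0.
pose k : R[i] := (((l2norm w)^-1)%:C)%C.
have k0 : k != 0 by rewrite -(rmorph0 (real_complex R)) (inj_eq (@complexI R)) invr_eq0.
exists (snoc s (k *: w)).
  apply: orthonormal_snoc => // [|i].
    rewrite (ipZl ip) (ipZr ip) l2dot_self conjc_real /k -!rmorphM /=.
    rewrite [X in (X%:C)%C](_ : _ = 1)//.
    by move: (l2norm w) lw0 => r r0; field.
  by rewrite (ipZl ip) onproj_orth// mulr0.
have blE : bl = k^-1 *: (k *: w) + onproj s bl by rewrite scalerA mulVf// scale1r subrK.
apply/seteqP; split; apply: lspan_sub => i; case: (unliftP ord_max i) => [j ->|->].
- rewrite snoc_lift.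
  have : lspan (fun j => b (lift ord_max j)) (s j) by rewrite -sE; exact: lspan_gen.
  by apply: lspan_sub => l; exact: lspan_gen.
- rewrite snoc_max; rewrite -[_ *: _]addr0; apply: lspan_lin; last exact: lspan0.
  rewrite /w addrC -scaleN1r; apply: lspan_lin; last exact: lspan_gen.
  have : lspan (fun j => b (lift ord_max j)) (onproj s bl) by rewrite -sE; exact: onproj_mem.
  by apply: lspan_sub => l; exact: lspan_gen.
- have : lspan s (b (lift ord_max j)) by rewrite sE; exact: lspan_gen.
  by apply: lspan_sub => l; rewrite -(snoc_lift s (k *: w)); exact: lspan_gen.
- rewrite -/bl blE; apply: lspan_lin.
    by rewrite -{2}(snoc_max s (k *: w)); exact: lspan_gen.
  have : lspan s (onproj s bl) by exact: onproj_mem.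
  by apply: lspan_sub => l; rewrite -(snoc_lift s (k *: w)); exact: lspan_gen.
Qed.

Lemma has_dim_orthonormal n (A : set (H1 R)) : has_dim n A ->
  exists2 s : 'I_n -> H1 R, orthonormal s & A = lspan s.
Proof. by move=> [b /gram_schmidt[s os sE] ->]; exists s. Qed.

(** [U'] is both inverse and L^2-adjoint; its boundedness on H^1 does not come from that of [U] and
    is part of the notion. *)
Definition l2unitary (U U' : H1 R -> H1 R) := [/\ bounded_op U, bounded_op U',
  cancel U U', cancel U' U & forall x y, l2dot (U x) y = l2dot x (U' y)].

Lemma l2unitary_comp U U' V V' : l2unitary U U' -> l2unitary V V' ->
  l2unitary (U \o V) (V' \o U').
Proof.
move=> [bU bU' UK U'K Ua] [bV bV' VK V'K Va]; split.
- exact: bounded_op_comp.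
- exact: bounded_op_comp.
- by move=> x /=; rewrite UK VK.
- by move=> x /=; rewrite V'K U'K.
- by move=> x y /=; rewrite Ua Va.
Qed.

Lemma l2unitary_id : l2unitary idfun idfun.
Proof. by split=> //; exact: bounded_op_id. Qed.

Lemma l2unitary_sym U U' : l2unitary U U' -> l2unitary U' U.
Proof.
move=> [bU bU' UK U'K Ua]; split=> // x y.
by rewrite (ip_conj ip) -Ua -(ip_conj ip).
Qed.

Lemma l2unitary_dot U U' x y : l2unitary U U' -> l2dot (U x) (U y) = l2dot x y.
Proof. by move=> [_ _ UK _ Ua]; rewrite Ua UK. Qed.

(* The complex reflection along [x - y], which is unitary because
   [2 Re l2dot x (x - y) = l2dot (x - y) (x - y)]. *)
Lemma reflection_exists x y : l2dot x x = 1 -> l2dot y y = 1 ->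
  exists U U', [/\ l2unitary U U', U x = y &
    forall z, l2dot z x = l2dot z y -> U z = z].
Proof.
move=> xx yy; have [<-|/eqP xy] := eqVneq x y.
  by exists idfun, idfun; split=> //; exact: l2unitary_id.
pose u := x - y; pose k := l2dot x u.
have kE : k = 1 - l2dot x y by rewrite /k /u (ipBr ip) xx.
have kcE : (k^*)%C = 1 - l2dot y x by rewrite -(ip_conj ip) /u (ipBl ip) xx.
have uu : l2dot u u = k + (k^*)%C.
  by rewrite kcE kE /u (ipBl ip) !(ipBr ip) xx yy; ring.
have k0 : k != 0.
  apply/eqP => kz; have : l2dot u u = 0 by rewrite uu kz conjc0 addr0.
  by move=> /(ip_eq0 ip)/eqP; rewrite subr_eq0 => /eqP.
have kc0 : (k^*)%C != 0 by rewrite conjc_eq0.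
pose T (c : R[i]) : H1 R -> H1 R := (- c^-1) *: rk1 u u + idfun.
have TE c z : T c z = z - (l2dot z u / c) *: u.
  by rewrite -[LHS]/((- c^-1) *: (l2dot z u *: u) + z) scalerA mulNr scaleNr addrC mulrC.
have bT c : bounded_op (T c) by apply: bounded_op_lin; [exact: bounded_op_rk1|exact: bounded_op_id].
(* Used with [k] and its conjugate, whose sum is [l2dot u u]: the inverse of [T k] is then [T] at
   the conjugate of [k], which is also its adjoint. *)
have TK c d : c != 0 -> d != 0 -> c + d = l2dot u u -> cancel (T c) (T d).
  move=> c0 d0 cd z; rewrite !TE (ipBl ip) (ipZl ip) -cd -addrA -opprD -scalerDl.
  rewrite [X in X *: u](_ : _ = 0) ?scale0r ?subr0//.
  by field; rewrite c0 d0.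
exists (T k), (T (k^*)%C); split.
- split=> //; [by apply: TK => //; rewrite uu|by apply: TK => //; rewrite uu addrC|].
  move=> z w; rewrite !TE; move: u k {kE kcE uu k0 kc0 T TE bT TK} => u k.
  rewrite (ipBl ip) (ipBr ip) (ipZl ip) (ipZr ip) rmorphM /= conjc_inv conjcK.
  by rewrite -(ip_conj ip); ring.
- by rewrite TE -/k divff// scale1r /u subKr.
- by move=> z zxy; rewrite TE /u (ipBr ip) zxy subrr mul0r scale0r subr0.
Qed.

(** By induction [U] handles all vectors but the last; the reflection that takes [U (s ord_max)] to
    [v ord_max] fixes the other [v j], which are orthogonal to both. *)
Lemma l2unitary_transitive n (s v : 'I_n -> H1 R) : orthonormal s -> orthonormal v ->
  exists U U', l2unitary U U' /\ forall i, U (s i) = v i.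
Proof.
elim: n s v => [s v _ _|n IH s v os ov].
  by exists idfun, idfun; split; [exact: l2unitary_id|case].
have [||U [U' [uU Us]]] := IH (fun j => s (lift ord_max j)) (fun j => v (lift ord_max j)).
- by move=> i j; rewrite os (inj_eq lift_inj).
- by move=> i j; rewrite ov (inj_eq lift_inj).
have [||H [H' [uH Hx Hfix]]] := @reflection_exists (U (s ord_max)) (v ord_max).
- by rewrite (l2unitary_dot _ _ uU) os eqxx.
- by rewrite ov eqxx.
exists (H \o U), (U' \o H'); split; first exact: l2unitary_comp.
move=> i; case: (unliftP ord_max i) => [j ->|->] //=.
rewrite Us Hfix// -{1}Us (l2unitary_dot _ _ uU) os ov.
by rewrite eq_sym.
Qed.

End Orthonormal.

(** * The corner of the ideal at a finite-rank projection *)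

Section Corner.
Variables (R : realType) (I : sn_ideal R) (N : nat) (s : 'I_N -> H1 R).
Hypothesis os : orthonormal s.

Local Notation ip := (l2_inner_product R).
Local Notation B := (ideal_space I).
Local Notation "x ** y" := (imul x y) (at level 40, left associativity).
Local Notation bp := (imul_banach I).
Implicit Types (A C K V W y p r : B) (xi eta f v : H1 R).

Definition irk1 f v : B := ielt (ideal_rk1 I f v).

Lemma ideal_sumE (J : Type) (l : seq J) (P : pred J) (F : J -> B) xi :
  (\sum_(j <- l | P j) F j : B) xi = \sum_(j <- l | P j) (F j xi).
Proof. by elim/big_rec2 : _ => // i x y _ <-. Qed.

(** The axiom on rank-one norms speaks of rank exactly one, whence the separate treatment of zero
    vectors. *)
Lemma irk1_norm f v : `|irk1 f v| <= l2norm f * h1norm v.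
Proof.
have [->|/eqP f0] := eqVneq f 0.
  have -> : irk1 0 v = 0 by apply: ideal_eq => xi; rewrite /= /rk1 (ip0r ip) scale0r.
  by rewrite normr0 mulr_ge0 ?l2norm_ge0 ?h1norm_ge0.
have [->|/eqP v0] := eqVneq v 0.
  have -> : irk1 f 0 = 0 by apply: ideal_eq => xi; rewrite /= /rk1 scaler0.
  by rewrite normr0 mulr_ge0 ?l2norm_ge0 ?h1norm_ge0.
have -> : `|irk1 f v| = opnorm (rk1 f v).
  by apply: sni_norm_rank1; [exact: ideal_rk1|exact: rk1_has_rank1].
apply: opnorm_le; first exact: bounded_op_rk1.
  by rewrite mulr_ge0 ?l2norm_ge0 ?h1norm_ge0.
move=> phi; rewrite h1normZ mulrAC ler_wpM2r ?h1norm_ge0// mulrC.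
exact: cabs_l2dot_le.
Qed.

Definition corner_unit : B := \sum_i irk1 (s i) (s i).
Local Notation e := corner_unit.

(* The L^2-adjoint of [A \o e]; [A] itself need not have a bounded adjoint. *)
Definition star A : B := \sum_i irk1 (A (s i)) (s i).

Lemma corner_unitE xi : e xi = onproj s xi.
Proof. by rewrite ideal_sumE. Qed.

Lemma starE A xi : star A xi = \sum_i l2dot xi (A (s i)) *: s i.
Proof. by rewrite ideal_sumE. Qed.

Lemma ideal_linear A : linear A.
Proof. by case: (ideal_bounded A). Qed.

(** [star] is conjugate linear, hence linear over the real scalars of the ideal. Each rank-one term
    is bounded because the L^2 norm is at most the H^1 norm. *)
Lemma bl_star : bounded_linear star.
Proof.
split.
  move=> a x y; apply: ideal_eq => xi.
  rewrite -[RHS]/((a%:C)%C *: star x xi + star y xi) !starE scaler_sumr -big_split.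
  apply: eq_bigr => i _.
  rewrite -[(a *: x + y : B) (s i)]/((a%:C)%C *: x (s i) + y (s i)).
  by rewrite (ipDr ip) (ipZr ip) conjc_real scalerDl scalerA.
exists (\sum_i h1norm (s i) * h1norm (s i)).
  by apply: sumr_ge0 => i _; rewrite mulr_ge0 ?h1norm_ge0.
move=> A; rewrite (le_trans (ler_norm_sum _ _ _))// mulr_suml ler_sum// => i _.
rewrite (le_trans (irk1_norm _ _))// mulrAC ler_wpM2r ?h1norm_ge0//.
by rewrite (le_trans (l2norm_le_h1norm _))// mulrC ideal_norm_ub.
Qed.

Lemma l2dot_ext xi eta : (forall z, l2dot xi z = l2dot eta z) -> xi = eta.
Proof.
move=> h; apply/eqP; rewrite -subr_eq0; apply/eqP/(ip_eq0 ip).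
by rewrite (ipBl ip) h subrr.
Qed.

Lemma star_adj A xi eta : l2dot (star A xi) eta = l2dot xi (A (e eta)).
Proof.
rewrite starE corner_unitE /onproj (lin_sum _ _ _ (ideal_linear A)) (ip_suml ip) (ip_sumr ip).
apply: eq_bigr => i _; rewrite (linZ _ _ (ideal_linear A)) (ipZl ip) (ipZr ip).
by rewrite -(ip_conj ip) mulrC.
Qed.

(** The usual way to identify a [star]: the rules below are checked on L^2 products rather than on
    sums over [s]. *)
Lemma star_unique A C : (forall xi eta, l2dot (C xi) eta = l2dot xi (A (e eta))) ->
  star A = C.
Proof. by move=> h; apply: ideal_eq => xi; apply: l2dot_ext => z; rewrite star_adj h. Qed.

Lemma e_sym xi eta : l2dot (e xi) eta = l2dot xi (e eta).
Proof. by rewrite !corner_unitE onproj_sym. Qed.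

Lemma e_id xi : e (e xi) = e xi.
Proof. by rewrite !corner_unitE onproj_id//; exact: onproj_mem. Qed.

Lemma ee : e ** e = e.
Proof. by apply: ideal_eq => xi; exact: e_id. Qed.

Lemma star_adj2 A xi eta : l2dot xi (star A eta) = l2dot (A (e xi)) eta.
Proof. by rewrite (ip_conj ip) star_adj -(ip_conj ip). Qed.

Lemma e_star A : e ** star A = star A.
Proof.
by apply: ideal_eq => xi; apply: l2dot_ext => z; rewrite /= e_sym !star_adj e_id.
Qed.

Lemma star_e_r A : star (A ** e) = star A.
Proof. by apply: star_unique => xi eta; rewrite star_adj /= e_id. Qed.

Lemma star_e_l A : star (e ** A) = star A ** e.
Proof. by apply: star_unique => xi eta; rewrite /= star_adj e_sym. Qed.

Lemma star_e : star e = e.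
Proof. by apply: star_unique => xi eta; rewrite e_sym e_id. Qed.

(** Only the adjoint of [A \o e] is available, and it suffices for the product when the range of [C]
    lies in that of [e]. *)
Lemma star_mul A C : e ** C = C -> star (A ** C) = star C ** star A.
Proof.
move=> eC; apply: star_unique => xi eta /=; rewrite !star_adj.
have eCx z : e (C z) = C z by rewrite -[in RHS]eC.
by rewrite eCx.
Qed.

Lemma star_star A : star (star A) = e ** A ** e.
Proof. by apply: star_unique => xi eta /=; rewrite e_sym star_adj2. Qed.

Lemma star_gram A : A ** e = A -> star (star A ** A) = star A ** A.
Proof.
move=> Ae; apply: star_unique => xi eta /=; rewrite star_adj star_adj2.
have Aex z : A (e z) = A z by rewrite -[in RHS]Ae.
by rewrite !Aex.
Qed.

Lemma star0 : star 0 = 0. Proof. exact: bl0 bl_star. Qed.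
Lemma starD A C : star (A + C) = star A + star C. Proof. exact: (blD _ _ bl_star). Qed.
Lemma starB A C : star (A - C) = star A - star C. Proof. exact: (blB _ _ bl_star). Qed.
Lemma starZ (a : R) A : star (a *: A) = a *: star A. Proof. exact: (blZ _ _ bl_star). Qed.

(* Inverse in the corner [e ** B ** e], whose unit is [e]: the ideal itself has
   no unit. *)
Definition cinv y : B := e + qinv (@imul R I) (y - e).

Section CornerInverse.
Variable y : B.
Hypotheses (ey : e ** y = y) (ye : y ** e = y) (y1 : `|y - e| < 1).

Let q := qinv (@imul R I) (y - e).
Let qE : q = - (y - e) - (y - e) ** q. Proof. exact: (qinvE bp y1). Qed.
Let qE' : q = - (y - e) - q ** (y - e). Proof. exact: (qinvE' bp y1). Qed.

Let eq : e ** q = q.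
Proof.
rewrite qE (bpBr bp) (bpNr bp) (bpBr bp) ey ee; congr (_ - _).
by rewrite (bpA bp) (bpBr bp) ey ee.
Qed.

Let qe : q ** e = q.
Proof.
rewrite qE' (bpBl bp) (bpNl bp) (bpBl bp) ye ee; congr (_ - _).
by rewrite -(bpA bp) (bpBl bp) ye ee.
Qed.

Lemma e_cinv : e ** cinv y = cinv y. Proof. by rewrite (bpDr bp) ee eq. Qed.
Lemma cinv_e : cinv y ** e = cinv y. Proof. by rewrite (bpDl bp) ee qe. Qed.

Lemma mul_cinv : y ** cinv y = e.
Proof.
rewrite (bpDr bp) ye -/q; have : (y - e) ** q = - (y - e) - q by rewrite [in RHS]qE; module R (ideal_space I).
by rewrite (bpBl bp) eq => /eqP; rewrite subr_eq => /eqP ->; module R (ideal_space I).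
Qed.

Lemma cinv_mul : cinv y ** y = e.
Proof.
rewrite (bpDl bp) ey -/q; have : q ** (y - e) = - (y - e) - q by rewrite [in RHS]qE'; module R (ideal_space I).
by rewrite (bpBr bp) qe => /eqP; rewrite subr_eq => /eqP ->; module R (ideal_space I).
Qed.

Lemma cinv_unique p : e ** p = p -> y ** p = e -> cinv y = p.
Proof. by move=> ep yp; rewrite -cinv_e -yp (bpA bp) cinv_mul. Qed.

End CornerInverse.

Lemma cinv_id : cinv e = e.
Proof. by apply: cinv_unique; rewrite ?ee// subrr normr0. Qed.

End Corner.

(** * Homogeneous submanifolds *)

Section HomogeneousSubmanifold.
Variables (R : realType) (B : completeNormedModType R) (P : cont_projection B).
Variables (M : set B) (m0 : B) (D U : set B) (phi Psi : B -> B).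

Definition sdiffable (f : B -> B) x := exists L, sdiff f x L.

(** A symmetry is bounded and linear on the ambient space, so composing with it preserves strict
    differentiability and transports velocities. *)
Record symmetry (tau tau' : B -> B) : Prop := Symmetry {
  sym_bl : bounded_linear tau;
  sym_bl' : bounded_linear tau';
  symK : cancel tau tau';
  symK' : cancel tau' tau;
  symM : forall m, M m -> M (tau m);
  symM' : forall m, M m -> M (tau' m) }.

(** [phi] and [Psi] are maps of the whole of [B], so that they can be differentiated without
    mentioning subspaces; the points fixed by [P] are the parameters of the chart. *)
Record base_chart : Prop := BaseChart {
  bc_openD : open D;
  bc_openU : open U;
  bc_phi : forall x, P x = x -> D x -> sdiffable phi x;
  bc_Psi : forall m, U m -> sdiffable Psi m;
  bc_fix : forall m, U m -> P (Psi m) = Psi m;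
  bc_M : forall x, P x = x -> D x -> M (phi x);
  bc_PsiK : forall x, P x = x -> D x -> U (phi x) -> Psi (phi x) = x;
  bc_phiK : forall m, M m -> U m -> D (Psi m) -> phi (Psi m) = m;
  bc_m0 : M m0 /\ U m0 /\ D (Psi m0) }.

Hypothesis bc : base_chart.
Hypothesis homogeneous : forall m, M m ->
  exists tau tau', symmetry tau tau' /\ tau m0 = m.

Lemma open_bl_preimage (E G : normedModType R) (L : E -> G) (O : set G) :
  bounded_linear L -> open O -> open (L @^-1` O).
Proof. by move=> l oO; apply: open_comp => // x _; exact: bl_continuous l x. Qed.

Lemma sdiff_c1_on_ex (E G : normedModType R) (O : set E) (f : E -> G) : open O ->
  (forall x, O x -> exists L, sdiff f x L) -> c1_on O f.
Proof.
move=> oO h; have /choice[L HL] : forall x, exists L, O x -> sdiff f x L.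
  move=> x; have [/h[L HL]|nOx] := pselect (O x); first by exists L.
  by exists (fun=> 0).
exact: sdiff_c1_on oO HL.
Qed.

(** Around [tau m0] the parametrization is [tau \o phi] and the chart is [Psi \o tau'], corestricted
    by [fixed_proj]. *)
Lemma homogeneous_submanifold : c1_submanifold (fixed_space P) M.
Proof.
move=> m Mm; have [tau [tau' [st tm]]] := homogeneous Mm.
have [bt bt' K K' tM tM'] := st.
have [Mm0 [Um0 Dm0]] := bc_m0 bc.
pose f (x : fixed_space P) := tau (phi x).
pose DX : set (fixed_space P) := @fixed_val _ _ P @^-1` D.
pose g (y : B) := fixed_proj P (Psi (tau' y)).
have vg y : U (tau' y) -> (g y : B) = Psi (tau' y) by move=> Uy; exact: (bc_fix bc Uy).
have chart : c1_chart M (M `&` ((tau' @^-1` U) `&` g @^-1` DX)) g f.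
  apply: local_c1_chart.
  - exact: open_bl_preimage (bl_fixed_val P) (bc_openD bc).
  - exact: open_bl_preimage bt' (bc_openU bc).
  - apply: sdiff_c1_on_ex; first exact: open_bl_preimage (bl_fixed_val P) (bc_openD bc).
    move=> x Dx; have [L HL] := bc_phi bc (fixed_valP x) Dx.
    exists (fun v => tau (L (fixed_val v))).
    apply: (sdiff_comp (f := fun y : fixed_space P => phi y)); last exact: sdiff_bl.
    by apply: (sdiff_comp (f := @fixed_val _ _ P)) HL; exact: sdiff_bl (bl_fixed_val P).
  - apply: sdiff_c1_on_ex; first exact: open_bl_preimage bt' (bc_openU bc).
    move=> y Uy; have [L HL] := bc_Psi bc Uy.
    exists (fun v => fixed_proj P (L (tau' v))).
    apply: (sdiff_comp (f := fun y => Psi (tau' y))); last exact: sdiff_bl (bl_fixed_proj P).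
    by apply: sdiff_comp HL; exact: sdiff_bl.
  - by move=> x Dx; apply: tM; exact: (bc_M bc (fixed_valP x) Dx).
  - move=> x Dx; rewrite /preimage /= /f K => Ux; apply: val_inj.
    have Ux' : U (tau' (tau (phi x))) by rewrite K.
    transitivity (Psi (tau' (tau (phi x)))); first exact: (vg _ Ux').
    by rewrite K; exact: (bc_PsiK bc (fixed_valP x) Dx Ux).
  - move=> y My Uy Dy; have Dy' : D (Psi (tau' y)) by rewrite -(vg _ Uy).
    rewrite /f (vg _ Uy) (bc_phiK bc) ?K'//.
    exact: tM'.
exists (M `&` ((tau' @^-1` U) `&` g @^-1` DX)), g, f; split=> //.
have t0 : tau' m = m0 by rewrite -tm K.
have Um : U (tau' m) by rewrite t0.
split=> //; split=> //; change (D (fixed_val (g m))).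
by rewrite (vg _ Um) t0.
Qed.

Lemma velocity_sym tau tau' m w : symmetry tau tau' -> velocity M m w ->
  velocity M (tau m) (tau w).
Proof.
move=> [bt _ _ _ tM _] [gamma [g0 gM [dg dgE]]].
exists (tau \o gamma); split; first by rewrite /= g0.
  by apply: filterS gM => t; exact: tM.
have dg' : differentiable gamma (0 : R) by exact/derivable1_diffP.
have [dt tE] := sdiff_diff (sdiff_bl (gamma 0) bt).
have dc := differentiable_comp dg' dt.
apply: DeriveDef; first exact/derivable1_diffP.
by rewrite deriveE// diff_comp//= tE -deriveE// dgE.
Qed.

Lemma velocity_phi L w : P w = w -> P 0 = 0 -> D 0 -> sdiff phi 0 L -> phi 0 = m0 ->
  velocity M m0 (L w).
Proof.
move=> Pw P0 D0 HL phi0.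
exists (fun t => phi (t *: w)); split; first by rewrite scale0r.
  have cl : (fun t : R => t *: w) @ (0 : R) --> (0 : B).
    by rewrite -[X in _ --> X](scale0r w); exact: scalel_continuous.
  near=> t; apply: (bc_M bc).
    by rewrite blZ ?Pw//; exact: cproj_bl.
  near: t; apply: cl; apply: open_nbhs_nbhs; split=> //; exact: bc_openD bc.
have sl : sdiff (fun t : R => t *: w) 0 (fun t => t *: w).
  apply: sdiff_bl; split; first by move=> a b c; rewrite scalerDl scalerA.
  by exists `|w| => // v; rewrite normrZ mulrC.
have HL' : sdiff phi (0 *: w) L by rewrite scale0r.
have [dc cE] := sdiff_diff (sdiff_comp sl HL').
apply: DeriveDef; first exact/derivable1_diffP.
by rewrite deriveE// cE scale1r.
Unshelve. all: by end_near. Qed.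

Lemma homogeneous_complete T : closed M -> (forall m, M m -> velocity M m = T m) ->
  complete_finsler_manifold M T (fun _ w => `|w|).
Proof.
move=> clM MT; have subM := homogeneous_submanifold; exists (fixed_space P); split=> //.
- exact: tangent_spacesP.
- by split; [exact: norm_fiber_norm|exact: norm_fiber_topology|exact: norm_fiber_continuity].
- exact: closed_submanifold_complete subM clM.
Qed.

End HomogeneousSubmanifold.

(** * Level sets: closedness and constraints on velocities *)

Section LevelSets.
Variables (R : realType) (B : completeNormedModType R) (G : normedModType R) (f : B -> G) (c : G).

Lemma closed_level : (forall x, exists L, sdiff f x L) -> closed [set x | f x = c].
Proof.
move=> h; apply: (@closed_comp _ _ f [set c]); last first.
  exact: accessible_closed_set1 (hausdorff_accessible (@norm_hausdorff _ G)) c.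
move=> x _; have [L /sdiff_diff[/differentiable_continuous cf _]] := h x; exact: cf.
Qed.

(** Along a curve in [M] the function [f] is constant, and the chain rule computes its derivative as
    [L w]. *)
Lemma velocity_level M m w L : (forall x, M x -> f x = c) -> velocity M m w ->
  sdiff f m L -> L w = 0.
Proof.
move=> fM [gamma [g0 gM [dg dgE]]]; rewrite -{1}g0 => HL.
have dg' : differentiable gamma (0 : R) by exact/derivable1_diffP.
have [dt tE] := sdiff_diff HL.
have dc := differentiable_comp dg' dt.
transitivity ('D_1 (f \o gamma) (0 : R)); first by rewrite deriveE// diff_comp//= tE -deriveE// dgE.
rewrite (@near_eq_derive _ _ _ _ (cst c)) ?derive_cst//.
by apply: filterS gM => t /fM.
Qed.

End LevelSets.

Section SdiffableClosure.
Variables (R : realType) (E G : normedModType R).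

Lemma sdiff_scale (f : E -> G) x L a : sdiff f x L ->
  sdiff (fun y => a *: f y) x (fun v => a *: L v).
Proof. by move=> HL; exact: sdiff_comp HL (sdiff_bl _ (bl_scale a (bl_id G))). Qed.

Lemma sdiff_continuous (f : E -> G) x L : sdiff f x L -> {for x, continuous f}.
Proof. by move=> /sdiff_diff[/differentiable_continuous]. Qed.

Lemma open_norm_lt (f : E -> G) r : (forall x, exists L, sdiff f x L) ->
  open [set x | `|f x| < r].
Proof.
move=> Hf; rewrite openE => x /= fx; have [L /sdiff_continuous cf] := Hf x.
have : nbhs (f x) [set y | `|y| < r].
  apply/nbhs_ballP; exists (r - `|f x|); first by rewrite /= subr_gt0.
  move=> y; rewrite -ball_normE /= ltrBrDr => h; apply: le_lt_trans h.
  by rewrite distrC -{1}(subrK (f x) y) ler_normD.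
exact: cf.
Qed.

End SdiffableClosure.

(** * The Stiefel manifold *)

Section Polarization.
Variable R : realType.
Local Notation ip := (l2_inner_product R).

Lemma l2norm_inj (x y : H1 R) : l2dot x x = l2dot y y -> l2norm x = l2norm y.
Proof.
rewrite !l2dot_self => /(@complexI R) /eqP.
by rewrite eqrXn2 ?l2norm_ge0// => /eqP.
Qed.

(** The coefficients 1 and i in [comb] give the sum and the difference of [l2dot (V x) (V y)] and
    [l2dot (V y) (V x)]. *)
Lemma polarization n (s : 'I_n -> H1 R) (V : H1 R -> H1 R) : linear V ->
  (forall x, lspan s x -> l2norm (V x) = l2norm x) ->
  forall x y, lspan s x -> lspan s y -> l2dot (V x) (V y) = l2dot x y.
Proof.
move=> lV isoV x y sx sy.
have iso z : lspan s z -> l2dot (V z) (V z) = l2dot z z.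
  by move=> sz; rewrite !l2dot_self isoV.
have comb a : a * l2dot (V x) (V y) + (a^*)%C * l2dot (V y) (V x) =
    a * l2dot x y + (a^*)%C * l2dot y x.
  have := iso _ (lspan_lin a sx sy); rewrite lV.
  rewrite !(ipDl ip) !(ipDr ip) !(ipZl ip) !(ipZr ip) iso// iso// => h.
  apply: (addrI (a * ((a^*)%C * l2dot x x))); apply: (addIr (l2dot y y)).
  by rewrite -!addrA; rewrite -!addrA in h.
have h1 := comb 1; have hi := comb 'i%C.
rewrite conjc1 !mul1r in h1.
have ci : (('i%C : R[i])^*)%C = - 'i%C by apply/eqP; rewrite eq_complex /= oppr0 !eqxx.
rewrite ci in hi.
have i0 : ('i%C : R[i]) != 0 by rewrite eq_complex /= oner_eq0 andbF.
have {}hi : l2dot (V x) (V y) - l2dot (V y) (V x) = l2dot x y - l2dot y x.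
  by apply: (mulfI i0); rewrite !mulrBr -!mulNr.
have n2 : (2 : R[i]) != 0 by rewrite pnatr_eq0.
clear comb iso; move: (l2dot (V x) (V y)) (l2dot (V y) (V x)) (l2dot x y) (l2dot y x) h1 hi.
move=> p q a b h1 hi; apply: (mulfI n2).
have -> : 2 * p = (p + q) + (p - q) by ring.
by rewrite h1 hi; ring.
Qed.

End Polarization.

Section StiefelChart.
Variables (R : realType) (I : sn_ideal R) (N : nat) (s : 'I_N -> H1 R).
Hypothesis os : orthonormal s.

Local Notation ip := (l2_inner_product R).
Local Notation B := (ideal_space I).
Local Notation "x ** y" := (imul x y) (at level 40, left associativity).
Local Notation bp := (imul_banach I).
Local Notation e := (corner_unit I s).
Local Notation star := (@star R I N s).
Local Notation cinv := (@cinv R I N s).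
Implicit Types (A C K V W y p r : B) (xi eta f v : H1 R).

Let mA := bpA bp.
Let mDl := bpDl bp.
Let mDr := bpDr bp.
Let mBl := bpBl bp.
Let mBr := bpBr bp.
Let mNl := bpNl bp.
Let mNr := bpNr bp.
Let mZl := bpZl bp.
Let mZr := bpZr bp.
Let m0l := bp0l bp.
Let m0r := bp0r bp.
Let ee' := ee I os.

Lemma sdiff_cinv y : `|y - e| < 1 -> sdiff cinv y
  (fun h => let q := qinv (@imul R I) (y - e) in - (h + q ** h + h ** q + q ** h ** q)).
Proof.
move=> y1; have H1 := sdiffD (sdiff_bl y (bl_id B)) (sdiff_cst (- e) y).
have H2 := sdiff_comp H1 (sdiff_qinv bp y1).
apply: sdiff_eq (sdiffD (sdiff_cst e y) H2) => v.
by rewrite add0r addr0.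
Qed.

Lemma qinv0 : qinv (@imul R I) 0 = 0.
Proof. by rewrite (qinvE bp) ?normr0// m0l !oppr0 addr0. Qed.

Lemma sdiff_cinv_e : sdiff cinv e (fun h => - h).
Proof.
have H := @sdiff_cinv e; rewrite subrr normr0 in H; apply: sdiff_eq (H ltr01) => v /=.
by rewrite qinv0 !m0l m0r !addr0.
Qed.

(** The first equation says that [V] vanishes on the orthogonal complement of the span. The second
    is the isometry, by polarization, and also bounds the kernel: [V xi = 0] forces [e xi = 0]. *)
Lemma stiefelP V : stiefel (lspan s) V <-> V ** e = V /\ star V ** V = e.
Proof.
have lV := ideal_linear V.
have eS xi : lspan s (e xi) by rewrite corner_unitE; exact: onproj_mem.
have Se xi : lspan s xi -> e xi = xi by move=> h; rewrite corner_unitE onproj_id.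
have orth xi : e xi = 0 <-> (forall t, lspan s t -> l2dot xi t = 0).
  split=> [e0 t st|h]; first by rewrite -(Se t st) -(e_sym I s) e0 (ip0l ip).
  rewrite corner_unitE /onproj big1// => i _.
  by rewrite h ?scale0r//; exact: lspan_gen.
split=> [[bV kerV isoV]|[Ve VV]].
  have Ve : V ** e = V.
    apply: ideal_eq => xi; apply/esym/eqP; rewrite /= -subr_eq0 -(linB _ _ lV); apply/eqP.
    have : [set xi | V xi = 0] (xi - e xi); last by [].
    rewrite kerV; apply/orth; rewrite (linB _ _ (ideal_linear e)) e_id//.
    by rewrite subrr.
  split=> //; apply: ideal_eq => xi; apply: l2dot_ext => z /=.
  have Vex w : V (e w) = V w by rewrite -[in RHS]Ve.
  rewrite star_adj -Vex (polarization lV isoV) ?eS//.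
  by rewrite !e_sym e_id.
have Vex w : V (e w) = V w by rewrite -[in RHS]Ve.
have VVx w : star V (V w) = e w by rewrite -VV.
split.
- exact: ideal_bounded.
- apply/seteqP; split=> xi /=.
    move=> Vxi; apply/orth; rewrite -VVx Vxi; exact: lin0 (ideal_linear _).
  by move=> /orth e0; rewrite -Vex e0; exact: lin0 lV.
- move=> xi /Se xiE; apply: l2norm_inj.
  by rewrite -[in X in l2dot _ X]Vex -star_adj VVx xiE.
Qed.

(* A tangent vector at [e] splits into its skew corner [e ** W] and [low W]. *)
Definition low W : B := W - e ** W.

Lemma bl_low : bounded_linear low.
Proof. by apply: bl_add; [exact: bl_id|apply: bl_opp; exact: bl_mull bp e]. Qed.

Lemma e_low W : e ** low W = 0.
Proof. by rewrite mBr mA ee' subrr. Qed.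

Lemma low_e W : W ** e = W -> low W ** e = low W.
Proof. by move=> We; rewrite mBl -mA We. Qed.

(** Restricts [A] to the range of [e] and removes the self-adjoint part of its corner [e ** A ** e],
    whose adjoint is [star A ** e]. *)
Definition tangent_proj A : B := A ** e - 2^-1 *: (e ** A ** e + star A ** e).

Lemma bl_tangent_proj : bounded_linear tangent_proj.
Proof.
apply: bl_add; first exact: bl_mulr bp e.
apply/bl_opp/bl_scale/bl_add; last exact: bl_comp (bl_star I s) (bl_mulr bp e).
exact: bl_comp (bl_mull bp e) (bl_mulr bp e).
Qed.

Lemma tangent_proj_fix W : W ** e = W -> e ** W + star W ** e = 0 -> tangent_proj W = W.
Proof.
by move=> We skew; rewrite /tangent_proj We -mA We skew scaler0 subr0.
Qed.

Lemma tangent_proj_spec A : tangent_proj A ** e = tangent_proj A /\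
  e ** tangent_proj A + star (tangent_proj A) ** e = 0.
Proof.
have Pe : tangent_proj A ** e = tangent_proj A.
  by rewrite /tangent_proj mBl mZl mDl -!mA ee'.
split=> //; rewrite /tangent_proj starB starZ starD star_e_r// star_e_r// star_e_l//.
rewrite star_e_r// star_star// !mBr !mBl !mZr !mZl !mDr !mDl !mA ee' e_star//.
by rewrite -!mA !ee'; module R (ideal_space I).
Qed.

Definition stiefel_proj : cont_projection B.
Proof.
apply: (@ContProjection _ _ tangent_proj bl_tangent_proj) => A.
by have [h1 h2] := tangent_proj_spec A; exact: tangent_proj_fix.
Defined.

Lemma stiefel_projP W : stiefel_proj W = W <-> W ** e = W /\ star W ** e = - (e ** W).
Proof.
split=> [<-|[We skew]].
  have [h1 h2] := tangent_proj_spec W; split=> //.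
  by apply/eqP; rewrite -addr_eq0 addrC; exact/eqP.
by apply: tangent_proj_fix => //; rewrite skew subrr.
Qed.

Definition stiefel_denom W : B := e - e ** W + star (low W) ** low W.

(* When [low W = 0] and [a := e ** W] this is [(e + a) (e - a)^-1]. In general it
   is an isometry because the denominator [y] satisfies
   [y + star y = 2 (e + star (low W) ** low W)]. *)
Definition cayley W : B :=
  2 *: cinv (stiefel_denom W) - e + 2 *: (low W ** cinv (stiefel_denom W)).

Definition cayley_dom : set B := [set W | `|stiefel_denom W - e| < 1].

Lemma sdiff_stiefel_denom W : sdiff stiefel_denom W
  (fun h => - (e ** h) + (star (low W) ** low h + star (low h) ** low W)).
Proof.
have Hc := sdiff_bl W bl_low; have Hs := sdiff_bl W (bl_comp bl_low (bl_star I s)).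
have H := sdiffD (sdiffD (sdiff_cst e W) (sdiff_bl W (bl_opp (bl_mull bp e)))) (sdiff_mul bp Hs Hc).
by apply: sdiff_eq H => v; rewrite add0r.
Qed.

Lemma sdiff_cayley W L : sdiff (fun W => cinv (stiefel_denom W)) W L ->
  sdiff cayley W (fun h => 2 *: L h + 2 *: (low W ** L h + low h ** cinv (stiefel_denom W))).
Proof.
move=> HL; have Hc := sdiff_bl W bl_low.
have H := sdiffD (sdiffD (sdiff_scale 2 HL) (sdiff_cst (- e) W)) (sdiff_scale 2 (sdiff_mul bp Hc HL)).
by apply: sdiff_eq H => v; rewrite addr0.
Qed.

Lemma stiefel_denom0 : stiefel_denom 0 = e.
Proof. by rewrite /stiefel_denom /low m0r !subr0 m0r addr0. Qed.

(** On tangent vectors at [e] this derivative is multiplication by 2. *)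
Lemma sdiff_cayley0 : sdiff cayley 0 (fun h => (- 2) *: (- (e ** h)) + 2 *: (low h ** e)).
Proof.
have H0 := sdiff_stiefel_denom 0.
have H1 : sdiff cinv (stiefel_denom 0) (fun h => - h) by rewrite stiefel_denom0; exact: sdiff_cinv_e.
apply: sdiff_eq (sdiff_cayley (sdiff_comp H0 H1)) => h.
have low0 : low 0 = 0 by rewrite /low m0r subr0.
by rewrite stiefel_denom0 cinv_id// low0 star0 !m0l !m0r; module R (ideal_space I).
Qed.

Lemma cayley0 : cayley 0 = e.
Proof.
have low0 : low 0 = 0 by rewrite /low m0r subr0.
by rewrite /cayley stiefel_denom0 cinv_id// low0 m0l; module R (ideal_space I).
Qed.

(** Free of any relation between [p] and [c], so that it serves in both directions: to prove that
    [cayley W] is an isometry, and to extract skewness from a given isometry. *)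
Lemma cayley_gram p c : e ** p = p -> e ** c = 0 ->
  star (2 *: p - e + 2 *: (c ** p)) ** (2 *: p - e + 2 *: (c ** p)) =
  e + 2 *: (2 *: (star p ** p) + 2 *: (star p ** (star c ** c) ** p) - (star p + p)).
Proof.
move=> ep ec; have pse : star p ** e = star p by rewrite -star_e_l// ep.
have cse : star c ** e = 0 by rewrite -star_e_l// ec star0.
rewrite starD starB !starZ star_e// star_mul//.
have psc : star p ** c = 0 by rewrite -pse -mA ec m0r.
have csp : star p ** star c ** p = 0 by rewrite -ep -mA (mA (star c)) cse m0l m0r.
have cse' : star p ** star c ** e = 0 by rewrite -mA cse m0r.
rewrite !(mDl, mDr, mBl, mBr, mNl, mNr, mZl, mZr) pse ee' ep !mA ec psc csp cse' m0l.
by module R (ideal_space I).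
Qed.

Section CayleyAlgebra.
Variable W : B.
Hypotheses (We : W ** e = W) (skew : star W ** e = - (e ** W)) (DW : cayley_dom W).

Let y := stiefel_denom W.
Let c := low W.
Let k := star c ** c.
Let p := cinv y.

Let ce : c ** e = c. Proof. exact: low_e We. Qed.
Let ec : e ** c = 0. Proof. exact: e_low. Qed.
Let ek : e ** k = k. Proof. by rewrite mA e_star. Qed.
Let ke : k ** e = k. Proof. by rewrite -mA ce. Qed.
Let ks : star k = k. Proof. exact: star_gram ce. Qed.
Let yE : y = e - e ** W + k. Proof. by []. Qed.
Let ey : e ** y = y. Proof. by rewrite yE mDr mBr mA ee' ek. Qed.
Let ye : y ** e = y. Proof. by rewrite yE mDl mBl -mA We ee' ke. Qed.
Let ys : star y = e + e ** W + k.
Proof. by rewrite yE starD starB star_e// star_e_l// skew ks opprK. Qed.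
Let ep : e ** p = p. Proof. exact: e_cinv. Qed.
Let pe : p ** e = p. Proof. exact: cinv_e. Qed.
Let yp : y ** p = e. Proof. exact: mul_cinv. Qed.
Let pse : star p ** e = star p. Proof. by rewrite -star_e_l// ep. Qed.
Let psys : star p ** star y = e. Proof. by rewrite -star_mul// yp star_e. Qed.

Lemma cayley_e : cayley W ** e = cayley W.
Proof. by rewrite /cayley -/y -/p -/c mDl mBl !mZl pe ee' -mA pe. Qed.

Lemma cayley_isometry : star (cayley W) ** cayley W = e.
Proof.
rewrite /cayley -/y -/p -/c cayley_gram// -/k.
(* Multiply y + star y = 2 (e + k) by [star p] on the left and by [p], the inverse of [y], on the
   right. *)
have -> : 2 *: (star p ** p) + 2 *: (star p ** k ** p) = star p + p.
  have h : star p ** (y + star y) ** p = star p + p.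
    by rewrite [X in X ** p]mDr mDl psys ep -mA yp pse addrC.
  have hk : 2 *: (e + k) = y + star y by rewrite ys yE; module R (ideal_space I).
  rewrite -h -hk; clearbody p k y c; rewrite mZr mZl mDr mDl pse.
  by module R (ideal_space I).
by rewrite subrr scaler0 addr0.
Qed.

Lemma cayley_stiefel : stiefel (lspan s) (cayley W).
Proof. by apply/stiefelP; split; [exact: cayley_e|exact: cayley_isometry]. Qed.

End CayleyAlgebra.

(* Recover from [A = cayley W] the inverse [chart_p A] of the denominator, the
   denominator [chart_r A], [low W = chart_low A] and [e ** W = chart_skew A]. *)
Definition chart_p A : B := 2^-1 *: (e ** A ** e + e).
Definition chart_r A : B := cinv (chart_p A).
Definition chart_low A : B := 2^-1 *: ((A ** e - e ** A ** e) ** chart_r A).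
Definition chart_skew A : B := e + star (chart_low A) ** chart_low A - chart_r A.
(** The projection makes the values tangent on the whole open domain, as [bc_fix] demands; on the
    manifold it changes nothing. *)
Definition stiefel_chart A : B := tangent_proj (chart_skew A + chart_low A).
Definition chart_dom : set B := [set A | `|chart_p A - e| < 1].

Let e_chart_p A : e ** chart_p A = chart_p A.
Proof. by rewrite mZr mDr ee' !mA ee'. Qed.

Let chart_p_e A : chart_p A ** e = chart_p A.
Proof. by rewrite mZl mDl ee' -mA ee'. Qed.

Lemma sdiff_chart_p A : sdiff chart_p A (fun h => 2^-1 *: (e ** h ** e)).
Proof.
have H := sdiff_bl A (bl_comp (bl_mull bp e) (bl_mulr bp e)).
apply: sdiff_eq (sdiff_scale 2^-1 (sdiffD H (sdiff_cst e A))) => h.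
by rewrite addr0.
Qed.

Lemma sdiffable_stiefel_chart A : chart_dom A -> sdiffable stiefel_chart A.
Proof.
move=> UA; have [Lr Hr] : sdiffable chart_r A.
  eexists; exact: sdiff_comp (sdiff_chart_p A) (sdiff_cinv UA).
have [Lc Hc] : sdiffable chart_low A.
  have H : bounded_linear (fun A : B => A ** e - e ** A ** e).
    apply: bl_add; first exact: bl_mulr bp e.
    apply: bl_opp; exact: bl_comp (bl_mull bp e) (bl_mulr bp e).
  eexists; exact: sdiff_scale (sdiff_mul bp (sdiff_bl A H) Hr).
have Hs := sdiff_comp Hc (sdiff_bl _ (bl_star I s)).
have Hr' := sdiff_comp Hr (sdiff_bl _ (bl_opp (bl_id B))).
have Ha := sdiffD (sdiffD (sdiff_cst e A) (sdiff_mul bp Hs Hc)) Hr'.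
eexists; exact: sdiff_comp (sdiffD Ha Hc) (sdiff_bl _ bl_tangent_proj).
Qed.

Lemma sdiffable_cayley W : cayley_dom W -> sdiffable cayley W.
Proof.
move=> DW; eexists; apply: sdiff_cayley.
exact: sdiff_comp (sdiff_stiefel_denom W) (sdiff_cinv DW).
Qed.

Lemma cayleyK W : W ** e = W -> star W ** e = - (e ** W) -> cayley_dom W ->
  chart_dom (cayley W) -> stiefel_chart (cayley W) = W.
Proof.
move=> We skew DW UV.
have ey : e ** stiefel_denom W = stiefel_denom W.
  by rewrite mDr mBr !mA ee' e_star.
have ye : stiefel_denom W ** e = stiefel_denom W.
  by rewrite mDl mBl -mA We ee' -[X in _ + X]mA low_e.
have ep := e_cinv os ey DW; have pe := cinv_e os ye DW.
have py := cinv_mul os ey ye DW.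
have eVe : e ** cayley W = 2 *: cinv (stiefel_denom W) - e.
  by rewrite /cayley mDr mBr !mZr ee' ep (mA e) e_low m0l scaler0 addr0.
have Ve := cayley_e We DW.
have eVe' : e ** cayley W ** e = 2 *: cinv (stiefel_denom W) - e.
  by rewrite -mA Ve.
have pE : chart_p (cayley W) = cinv (stiefel_denom W).
  by rewrite /chart_p eVe'; module R (ideal_space I).
have rE : chart_r (cayley W) = stiefel_denom W.
  by apply: cinv_unique; rewrite // pE.
have cE : chart_low (cayley W) = low W.
  rewrite /chart_low rE eVe' Ve /cayley [X in X - _]addrC addrK mZl -mA py.
  by rewrite low_e//; module R (ideal_space I).
rewrite /stiefel_chart /chart_skew rE cE.
have -> : e + star (low W) ** low W - stiefel_denom W + low W = W.
  by rewrite /stiefel_denom {5}/low; module R (ideal_space I).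
by rewrite tangent_proj_fix// skew subrr.
Qed.

Section ChartAlgebra.
Variable V : B.
Hypotheses (SV : stiefel (lspan s) V) (UV : chart_dom V).

(** With p, r and c the values of [chart_p], [chart_r] and [chart_low], and k = star c ** c,
    [cayley_gram] turns the isometry into 2 star p (e + k) p = star p + p. Multiplying by [star r]
    and [r] gives r + star r = 2 (e + k), which is the skewness of e + k - r. *)
Lemma chart_tangent : [/\ chart_skew V ** e = chart_skew V,
  e ** chart_skew V = chart_skew V, star (chart_skew V) = - chart_skew V &
  V = 2 *: chart_p V - e + 2 *: (chart_low V ** chart_p V)].
Proof.
have [Ve VV] := (stiefelP V).1 SV.
have ep := e_chart_p V; have pe := chart_p_e V.
have er := e_cinv os ep UV; have re := cinv_e os pe UV.
have pr := mul_cinv os ep pe UV; have rp := cinv_mul os ep pe UV.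
rewrite -/(chart_r V) in er re pr rp.
have ce : chart_low V ** e = chart_low V by rewrite mZl -mA re.
have ec : e ** chart_low V = 0.
  by rewrite mZr mA mBr !mA ee' subrr m0l scaler0.
have VE : V = 2 *: chart_p V - e + 2 *: (chart_low V ** chart_p V).
  rewrite /chart_low mZl -(mA _ (chart_r V)) rp mBl -!mA ee' !Ve /chart_p -mA Ve.
  by module R (ideal_space I).
split=> //; last 1 first.
- have rsps : star (chart_r V) ** star (chart_p V) = e by rewrite -star_mul// pr star_e.
  have rse : star (chart_r V) ** e = star (chart_r V) by rewrite -star_e_l// er.
  have := VV; rewrite {1 2}VE cayley_gram// /chart_skew starB starD star_e// star_gram//.
  have : e ** (star (chart_low V) ** chart_low V) = star (chart_low V) ** chart_low V.
    by rewrite mA e_star.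
  have : star (chart_low V) ** chart_low V ** e = star (chart_low V) ** chart_low V.
    by rewrite -mA ce.
  move: (star (chart_low V) ** chart_low V) (star (chart_r V)) (star (chart_p V)) rsps rse.
  move: (chart_r V) (chart_p V) pr rp er re => r p pr rp er re k rs ps rsps rse ke ek G.
  have {}G : 2 *: (ps ** p) + 2 *: (ps ** k ** p) = ps + p.
    apply/eqP; rewrite -subr_eq0; apply/eqP.
    transitivity (2^-1 *: (e + 2 *: (2 *: (ps ** p) + 2 *: (ps ** k ** p) - (ps + p)) - e)).
      by module R (ideal_space I).
    by rewrite G subrr scaler0.
  have : rs ** (2 *: (ps ** p) + 2 *: (ps ** k ** p)) ** r = rs ** (ps + p) ** r by rewrite G.
  rewrite !(mDl, mDr, mZl, mZr) !mA rsps er ek -!mA pr rse ke ee' => G'.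
  have -> : rs = 2 *: e + 2 *: k - r by rewrite G'; module R (ideal_space I).
  by module R (ideal_space I).
- by rewrite /chart_skew mBl mDl ee' -mA ce re.
- by rewrite /chart_skew mBr er mDr ee' mA e_star.
Qed.

Lemma stiefel_chart_fix : [/\ stiefel_chart V ** e = stiefel_chart V,
  star (stiefel_chart V) ** e = - (e ** stiefel_chart V),
  low (stiefel_chart V) = chart_low V & stiefel_denom (stiefel_chart V) = chart_r V].
Proof.
have [ae ea sa _] := chart_tangent.
have ce : chart_low V ** e = chart_low V.
  by rewrite mZl -mA (cinv_e os (chart_p_e V) UV).
have ec : e ** chart_low V = 0 by rewrite mZr mA mBr !mA ee' subrr m0l scaler0.
have skew : star (chart_skew V + chart_low V) ** e = - (e ** (chart_skew V + chart_low V)).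
  by rewrite -star_e_l// mDr ea ec addr0 sa.
have we : (chart_skew V + chart_low V) ** e = chart_skew V + chart_low V by rewrite mDl ae ce.
have lowE : low (chart_skew V + chart_low V) = chart_low V.
  by rewrite /low mDr ea ec addr0 [X in X - _]addrC addrK.
rewrite /stiefel_chart tangent_proj_fix ?skew ?subrr//; split=> //.
by rewrite /stiefel_denom lowE mDr ea ec addr0 /chart_skew; module R (ideal_space I).
Qed.

Lemma stiefel_chartK : cayley_dom (stiefel_chart V) -> cayley (stiefel_chart V) = V.
Proof.
have [_ _ lowE dE] := stiefel_chart_fix; have [_ _ _ VE] := chart_tangent.
rewrite /cayley_dom /= /cayley lowE dE => r1; rewrite [RHS]VE.
have ep := e_chart_p V; have pe := chart_p_e V.
rewrite (@cinv_unique _ _ _ _ os (chart_r V) _ _ _ (chart_p V))//.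
- exact: e_cinv.
- exact: cinv_e.
- exact: cinv_mul.
Qed.

End ChartAlgebra.

Lemma stiefel_e : stiefel (lspan s) e.
Proof. by apply/stiefelP; rewrite star_e// ee'. Qed.

Lemma stiefel_base_chart : base_chart stiefel_proj [set V : B | stiefel (lspan s) V] e
  cayley_dom chart_dom cayley stiefel_chart.
Proof.
split.
- apply: (@open_norm_lt _ _ _ (fun W => stiefel_denom W - e)) => W.
  eexists; exact: sdiffD (sdiff_stiefel_denom W) (sdiff_cst (- e) W).
- apply: (@open_norm_lt _ _ _ (fun A => chart_p A - e)) => A.
  eexists; exact: sdiffD (sdiff_chart_p A) (sdiff_cst (- e) A).
- by move=> W _; exact: sdiffable_cayley.
- exact: sdiffable_stiefel_chart.
- by move=> A _; exact: cproj_idem.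
- by move=> W /stiefel_projP[We skew] DW; exact: cayley_stiefel.
- by move=> W /stiefel_projP[We skew]; exact: cayleyK.
- by move=> V SV UV; exact: stiefel_chartK.
have pE : chart_p e = e by rewrite /chart_p !ee'; module R (ideal_space I).
have rE : chart_r e = e by rewrite /chart_r pE cinv_id.
have Ue : chart_dom e by rewrite /chart_dom /= pE subrr normr0.
split; first exact: stiefel_e.
split=> //; have [_ _ _ dE] := stiefel_chart_fix stiefel_e Ue.
by rewrite /cayley_dom /= dE rE subrr normr0.
Qed.

Lemma star_adjl A xi eta : A ** e = A -> l2dot (star A xi) eta = l2dot xi (A eta).
Proof. by move=> Ae; rewrite star_adj -[in RHS]Ae. Qed.

Lemma star_adjr A xi eta : A ** e = A -> l2dot (A xi) eta = l2dot xi (star A eta).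
Proof. by move=> Ae; rewrite star_adj2 -[in LHS]Ae. Qed.

Lemma star_unitary U U' (uU : l2unitary U U') (bU : bounded_op U) V :
  star (ilmul bU V) ** ilmul bU V = star V ** V.
Proof.
apply: ideal_eq => xi; apply: l2dot_ext => z /=.
by rewrite !star_adj /= (l2unitary_dot _ _ uU).
Qed.

Lemma stiefel_symmetry U U' (uU : l2unitary U U') (bU : bounded_op U) (bU' : bounded_op U') :
  symmetry [set V : B | stiefel (lspan s) V] (ilmul bU) (ilmul bU').
Proof.
have [_ _ UK U'K _] := uU; split.
- exact: bl_ilmul.
- exact: bl_ilmul.
- by move=> A; apply: ideal_eq => xi; exact: UK.
- by move=> A; apply: ideal_eq => xi; exact: U'K.
- move=> V /stiefelP[Ve VV]; apply/stiefelP; rewrite (star_unitary uU); split=> //.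
  by rewrite -[in RHS]Ve; exact: ideal_eq.
- move=> V /stiefelP[Ve VV]; apply/stiefelP; rewrite (star_unitary (l2unitary_sym uU)).
  by split=> //; rewrite -[in RHS]Ve; exact: ideal_eq.
Qed.

Lemma e_s i : e (s i) = s i.
Proof. by rewrite corner_unitE onproj_id//; exact: lspan_gen. Qed.

(** The vectors [V (s i)] are orthonormal, so some unitary [U] takes each [s i] to [V (s i)]; then
    [U \o e] and [V \o e = V] agree. *)
Lemma stiefel_homogeneous V : stiefel (lspan s) V ->
  exists U U' (bU : bounded_op U), l2unitary U U' /\ ilmul bU e = V.
Proof.
move=> /stiefelP[Ve VV]; have VVx w : star V (V w) = e w by rewrite -VV.
have ov : orthonormal (fun i => V (s i)).
  by move=> i j; rewrite star_adjr// VVx e_s os.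
have [U [U' [uU Us]]] := l2unitary_transitive os ov.
have [bU _ _ _ _] := uU; exists U, U', bU; split=> //.
rewrite -Ve; apply: ideal_eq => xi /=; rewrite corner_unitE /onproj.
rewrite (lin_sum _ _ _ (ideal_linear V)) (lin_sum _ _ _ bU.1).
by apply: eq_bigr => i _; rewrite (linZ _ _ (ideal_linear V)) (linZ _ _ bU.1) Us.
Qed.

Lemma stiefel_velocity_skew V w : stiefel (lspan s) V ->
  velocity [set V : B | stiefel (lspan s) V] V w ->
  w ** e = w /\ star V ** w + star w ** V = 0.
Proof.
move=> SV vw; split.
  have H : sdiff (fun A : B => A ** e - A) V (fun h => h ** e - h).
    by apply: sdiff_bl; apply: bl_add; [exact: bl_mulr bp e|exact: bl_opp (bl_id B)].
  apply/eqP; rewrite -subr_eq0; apply/eqP; apply: velocity_level vw H => A.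
  by move=> /stiefelP[-> _]; rewrite subrr.
have H := sdiff_mul bp (sdiff_bl V (bl_star I s)) (sdiff_bl V (bl_id B)).
by apply: velocity_level vw H => A /stiefelP[_ AA]; exact: AA.
Qed.

Lemma skew_of_velocity V w : V ** e = V -> star V ** V = e -> w ** e = w ->
  star V ** w + star w ** V = 0 ->
  exists2 X, skew_op X & (w : H1 R -> H1 R) = X \o V.
Proof.
move=> Ve VV we skew.
(* [w ** star V] already satisfies X V = w. Subtracting [V ** star w] makes it skew, and the last
   term, skew because [star V ** w] is, cancels the error this causes in X V. *)
pose X := w ** star V - V ** star w - V ** (star V ** w) ** star V.
have wsV : star w ** V = - (star V ** w) by apply/eqP; rewrite -addr_eq0 addrC skew.
exists X; last first.
  rewrite -[RHS]/(X ** V : H1 R -> H1 R); congr ideal_op; rewrite !mBl -!mA VV.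
  rewrite wsV we mNr; module R (ideal_space I).
split; first exact: ideal_bounded.
move=> phi psi.
have XE f : X f = w (star V f) - V (star w f) - V (star V (w (star V f))) by [].
have VwV f : V (star w (V f)) = - V (star V (w f)).
  rewrite -[LHS]/((V ** (star w ** V)) f) wsV mNr.
  by rewrite -[LHS]/(- (V ** (star V ** w)) f).
have [aV aw] := (fun f g => star_adjr f g Ve, fun f g => star_adjr f g we).
have [aV' aw'] := (fun f g => star_adjl f g Ve, fun f g => star_adjl f g we).
rewrite !XE !(ipBl ip) !(ipBr ip) !(aV, aw, aV', aw') VwV (ipNr ip).
by move: (l2dot _ _) (l2dot _ _) (l2dot _ _) => x y z; ring.
Qed.

Lemma skew_velocity V (w : B) X : stiefel (lspan s) V -> skew_op X ->
  (w : H1 R -> H1 R) = X \o V -> velocity [set V : B | stiefel (lspan s) V] V w.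
Proof.
move=> SV [bX skX] wE; have [Ve VV] := (stiefelP V).1 SV.
have we : w ** e = w.
  by apply: ideal_eq => xi; rewrite /= wE /= -[in RHS]Ve.
have [U [U' [bU [uU UV]]]] := stiefel_homogeneous SV.
have [_ bU' UK U'K _] := uU.
pose w' := ilmul bU' w.
have we' : w' ** e = w' by rewrite /w' -[in RHS]we; exact: ideal_eq.
have Uw' : ilmul bU w' = w by apply: ideal_eq => xi; exact: U'K.
have skew : star w' ** e = - (e ** w').
  apply: ideal_eq => xi; apply: l2dot_ext => z.
  rewrite -[(- (e ** w')) xi]/(- (e (w' xi))) (ipNl ip) [LHS]star_adjl// [in RHS]e_sym.
  have UVx f : U (e f) = V f by rewrite -UV.
  rewrite -(l2unitary_dot (w' xi) (e z) uU) -(l2unitary_dot (e xi) (w' z) uU) !UVx.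
  by rewrite /= !U'K wE /= skX opprK.
(* The factor 1/2 compensates the derivative of [cayley] at 0, which doubles tangent vectors. *)
have fix' : stiefel_proj (2^-1 *: w') = 2^-1 *: w'.
  by apply/stiefel_projP; rewrite starZ mZl we' mZl skew mZr scalerN.
have D0 : cayley_dom 0 by rewrite /cayley_dom /= stiefel_denom0 subrr normr0.
have P0 : stiefel_proj 0 = 0 by exact: bl0 bl_tangent_proj.
have := velocity_phi stiefel_base_chart fix' P0 D0 sdiff_cayley0 cayley0.
move=> /(velocity_sym (stiefel_symmetry uU bU bU')); rewrite UV.
congr velocity; rewrite -[RHS]Uw'; congr ilmul.
rewrite low_e; first by rewrite /low mZr; module R (ideal_space I).
by rewrite mZl we'.
Qed.

Lemma closed_stiefel : closed [set V : B | stiefel (lspan s) V].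
Proof.
have -> : [set V : B | stiefel (lspan s) V] =
    [set V : B | V ** e - V = 0] `&` [set V : B | star V ** V = e].
  apply/seteqP; split=> V /=; first by move=> /stiefelP[-> ->]; rewrite subrr.
  by move=> [/eqP + VV]; rewrite subr_eq0 => /eqP Ve; apply/stiefelP.
apply: closedI.
  apply: closed_level => V; eexists.
  by apply: sdiff_bl; apply: bl_add; [exact: bl_mulr bp e|exact: bl_opp (bl_id B)].
apply: closed_level => V.
have H := sdiff_mul bp (sdiff_bl V (bl_star I s)) (sdiff_bl V (bl_id B)).
by eexists; exact: H.
Qed.

Lemma stiefel_complete : complete_finsler_manifold [set V : B | stiefel (lspan s) V]
  (fun V => [set w : B | exists2 X, skew_op X & (w : H1 R -> H1 R) = X \o V])
  (fun _ w => `|w|).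
Proof.
apply: (homogeneous_complete stiefel_base_chart) closed_stiefel _ => [V SV|V SV].
  have [U [U' [bU [uU UV]]]] := stiefel_homogeneous SV.
  have [_ bU' _ _ _] := uU.
  by exists (ilmul bU), (ilmul bU'); split=> //; exact: stiefel_symmetry.
have [Ve VV] := (stiefelP V).1 SV.
apply/seteqP; split=> w.
  by move=> /(stiefel_velocity_skew SV)[we skew]; exact: skew_of_velocity.
by move=> [X skX wE]; exact: skew_velocity skX wE.
Qed.

End StiefelChart.

(** * The Grassmann manifold *)

Section GrassmannOperators.
Variables (R : realType) (I : sn_ideal R) (N : nat).

Local Notation ip := (l2_inner_product R).
Local Notation B := (ideal_space I).
Local Notation "x ** y" := (imul x y) (at level 40, left associativity).
Local Notation bp := (imul_banach I).
Implicit Types (A C K Q w : B) (X P : H1 R -> H1 R).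

Definition l2sym X := forall x y, l2dot (X x) y = l2dot x (X y).

(** In this form the finite rank, membership in the ideal and invariance under unitary conjugation
    are all visible. *)
Lemma grassmannP P : grassmann N P <-> exists2 v : 'I_N -> H1 R, orthonormal v & P = onproj v.
Proof.
split=> [[[lP _] rP PP sP]|[v ov ->]].
  have [v ov rE] := has_dim_orthonormal rP; exists v => //.
  apply/funext => x; have Pv i : P (v i) = v i.
    have : range P (v i) by rewrite rE; exact: lspan_gen.
    by move=> [y _ <-]; rewrite -[LHS]/((P \o P) y) PP.
  rewrite -[LHS](onproj_id ov); last by rewrite -rE; exists x.
  by apply: eq_bigr => i _; rewrite sP Pv.
split.
- suff <- : (corner_unit I v : H1 R -> H1 R) = onproj v by exact: ideal_bounded.
  by apply/funext => x; exact: corner_unitE.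
- exists v; first exact: orthonormal_indep.
  apply/seteqP; split=> [_ [x _ <-]|x vx]; first exact: onproj_mem.
  by exists x => //; exact: onproj_id.
- by apply/funext => x /=; rewrite onproj_id//; exact: onproj_mem.
- by move=> x y; exact: onproj_sym.
Qed.

Lemma onproj_unitary U U' (uU : l2unitary U U') (v : 'I_N -> H1 R) x :
  U (onproj v (U' x)) = onproj (U \o v) x.
Proof.
have [[lU _] _ _ _ Ua] := uU; rewrite /onproj (lin_sum _ _ _ lU).
apply: eq_bigr => i _; rewrite (linZ _ _ lU).
by have [_ _ _ _ ->] := l2unitary_sym uU.
Qed.

Lemma orthonormal_unitary U U' (uU : l2unitary U U') (v : 'I_N -> H1 R) :
  orthonormal v -> orthonormal (U \o v).
Proof. by move=> ov i j; rewrite /= (l2unitary_dot _ _ uU) ov. Qed.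

Lemma grassmann_idem A : grassmann N A -> A ** A = A.
Proof. by case=> _ _ AA _; apply: ideal_eq => x; rewrite -[in RHS]AA. Qed.

Lemma contraction_fix C x : `|C| < 1 -> C x = x -> x = 0.
Proof.
move=> C1 Cx; apply: contrapT => x0; have := ideal_norm_ub C x.
by rewrite Cx leNgt gtr_pMl ?C1//; exact: h1norm_gt0.
Qed.

(* Pairs [A] and its adjoint with [t]; vanishes for all [t] iff [A] is symmetric. *)
Definition sym_defect (t : H1 R) A : B :=
  star (fun _ : 'I_1 => t) A - corner_unit I (fun _ : 'I_1 => t) ** A.

Lemma sym_defectE t A x : sym_defect t A x = l2dot x (A t) *: t - l2dot (A x) t *: t.
Proof.
rewrite -[LHS]/(star (fun _ : 'I_1 => t) A x - corner_unit I (fun _ : 'I_1 => t) (A x)).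
by rewrite starE corner_unitE /onproj !big_ord1.
Qed.

Lemma bl_sym_defect t : bounded_linear (sym_defect t).
Proof. by apply: bl_add (bl_star _ _) (bl_opp _); exact: bl_mull bp _. Qed.

Lemma l2sym_defect A : (forall t, sym_defect t A = 0) -> l2sym A.
Proof.
move=> h x t; have := congr1 (fun C : B => C x) (h t); rewrite sym_defectE.
have [->|/eqP t0] := eqVneq t 0.
  by rewrite (lin0 (ideal_linear A)) !(ip0r ip).
move=> /eqP; rewrite subr_eq0 => /eqP E; apply/esym/eqP; rewrite -subr_eq0.
have /eqP : (l2dot x (A t) - l2dot (A x) t) *: t = 0 by rewrite scalerBl E subrr.
by rewrite scaler_eq0 => /orP[//|/eqP].
Qed.

Lemma grassmann_defect t A : grassmann N A -> sym_defect t A = 0.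
Proof.
by move=> [_ _ _ sA]; apply: ideal_eq => x; rewrite sym_defectE sA subrr.
Qed.

(** The norm bound preserves the rank. [A] is injective on the range of [Q], as [A x = 0] gives (Q -
    A) x = x there. A vector y in the range of [A] orthogonal to all [A (v i)] is orthogonal to all
    [v i], so (A - Q) y = y and y = 0. *)
Lemma grassmann_near A Q : A ** A = A -> l2sym A -> grassmann N Q -> `|A - Q| < 1 ->
  grassmann N A.
Proof.
move=> AA sA /grassmannP[v ov QE] AQ.
have lA := ideal_linear A; have AAx x : A (A x) = A x by rewrite -[in RHS]AA.
split; [exact: ideal_bounded| |exact: (congr1 (@ideal_op R I) AA)|exact: sA].
pose d i := A (v i).
have d_indep : lin_indep d.
  move=> c; rewrite -[LHS](_ : A (\sum_i c i *: v i) = _); last first.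
    by rewrite (lin_sum _ _ _ lA); apply: eq_bigr => i _; rewrite (linZ _ _ lA).
  set x := \sum_i _ => Ax0; apply: (orthonormal_indep ov); rewrite -/x.
  apply: (@contraction_fix (Q - A)); first by rewrite distrC.
  rewrite -[LHS]/(Q x - A x) Ax0 subr0 QE onproj_id//.
  by exists c.
exists d => //; have [u ou dE] := gram_schmidt d_indep.
have ud : lspan u `<=` range A.
  rewrite dE => _ [c _ <-]; exists (\sum_i c i *: v i) => //.
  by rewrite (lin_sum _ _ _ lA); apply: eq_bigr => i _; rewrite (linZ _ _ lA).
have Afix z : range A z -> A z = z by move=> [t _ <-]; exact: AAx.
apply/seteqP; split=> [_ [x _ <-]|z]; last by rewrite -dE => /ud.
suff y0 : A x - onproj u (A x) = 0.
  by move/eqP: y0; rewrite subr_eq0 => /eqP ->; rewrite -dE; exact: onproj_mem.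
set y := A x - _; have Ay : A y = y.
  by rewrite (linB _ _ lA) AAx (Afix (onproj u (A x)))//; apply: ud; exact: onproj_mem.
apply: (@contraction_fix (A - Q)) => //.
rewrite -[LHS]/(A y - Q y) Ay QE /onproj big1 ?subr0// => i _.
suff -> : l2dot y (v i) = 0 by rewrite scale0r.
rewrite -{1}Ay sA -/(d i); have : lspan u (d i) by rewrite dE; exact: lspan_gen.
move=> [c _ <-]; rewrite (ip_sumr ip) big1// => j _.
by rewrite (ipZr ip) onproj_orth ?mulr0.
Qed.

End GrassmannOperators.

Section GrassmannChart.
Variables (R : realType) (I : sn_ideal R) (N : nat) (s : 'I_N -> H1 R).
Hypothesis os : orthonormal s.

Local Notation ip := (l2_inner_product R).
Local Notation B := (ideal_space I).
Local Notation "x ** y" := (imul x y) (at level 40, left associativity).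
Local Notation bp := (imul_banach I).
Local Notation e := (corner_unit I s).
Local Notation star := (@star R I N s).
Local Notation cinv := (@cinv R I N s).
Local Notation M := [set P : B | grassmann N P].
Implicit Types (A C K P V W w y p r : B) (xi eta f v : H1 R).

Let mA := bpA bp.
Let mDl := bpDl bp.
Let mDr := bpDr bp.
Let mBl := bpBl bp.
Let mBr := bpBr bp.
Let m0l := bp0l bp.
Let m0r := bp0r bp.
Let ee' := ee I os.

(** The block (1 - e) A e. A tangent vector at [e] is the sum of such a block and its adjoint. *)
Definition off_diag A : B := A ** e - e ** A ** e.

Lemma bl_off_diag : bounded_linear off_diag.
Proof.
apply: bl_add; first exact: bl_mulr bp e.
apply: bl_opp; exact: bl_comp (bl_mull bp e) (bl_mulr bp e).
Qed.

Lemma off_diag_e A : off_diag A ** e = off_diag A.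
Proof. by rewrite mBl -(mA A) -(mA (e ** A)) ee'. Qed.

Lemma e_off_diag A : e ** off_diag A = 0.
Proof. by rewrite mBr !mA ee' subrr. Qed.

Lemma off_diag_fix K : K ** e = K -> e ** K = 0 -> off_diag K = K.
Proof. by move=> Ke eK; rewrite /off_diag Ke eK m0l subr0. Qed.

Definition grassmann_proj : cont_projection B.
Proof.
apply: (@ContProjection _ _ off_diag bl_off_diag) => A.
by apply: off_diag_fix; [exact: off_diag_e|exact: e_off_diag].
Defined.

Lemma grassmann_projP K : grassmann_proj K = K -> K ** e = K /\ e ** K = 0.
Proof. by move=> <-; split; [exact: off_diag_e|exact: e_off_diag]. Qed.

(* The orthogonal projection onto the graph of [K], which maps [lspan s] into its
   orthogonal complement. *)
Definition graph_denom K : B := e + star K ** K.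
Definition graph_proj K : B := (e + K) ** cinv (graph_denom K) ** (e + star K).
Definition graph_dom : set B := [set K | `|star K ** K| < 1].

(** If P projects onto the graph of K and d is the inverse of the denominator, then P e = (e + K) d
    and e P e = d, so K is the off-diagonal block times the inverse of d. The outer [off_diag] puts
    the values in the model space on the whole domain. *)
Definition graph_chart A : B := off_diag (off_diag A ** cinv (e ** A ** e)).
(** The first condition inverts the corner; the second rules out a part of the projection that its
    graph does not see, in [graph_chartK]. *)
Definition graph_chart_dom : set B := [set A | `|e ** A ** e - e| < 1] `&` [set A | `|A - e| < 1].

Lemma graph_denom_e K : graph_denom K - e = star K ** K.
Proof. by rewrite /graph_denom addrC addKr. Qed.

Lemma sdiff_gram K : sdiff (fun K => star K ** K) K
  (fun h => star K ** h + star h ** K).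
Proof. exact: sdiff_eq (sdiff_mul bp (sdiff_bl K (bl_star I s)) (sdiff_bl K (bl_id B))). Qed.

Lemma sdiff_graph_proj K L : sdiff cinv (graph_denom K) L ->
  sdiff graph_proj K (fun h => (e + K) ** cinv (graph_denom K) ** star h +
    ((e + K) ** L (star K ** h + star h ** K) + h ** cinv (graph_denom K)) ** (e + star K)).
Proof.
move=> HL; have Hd := sdiffD (sdiff_cst e K) (sdiff_gram K).
have Hc := sdiff_comp Hd HL.
have H1 := sdiffD (sdiff_cst e K) (sdiff_bl K (bl_id B)).
have H2 := sdiffD (sdiff_cst e K) (sdiff_bl K (bl_star I s)).
apply: sdiff_eq (sdiff_mul bp (sdiff_mul bp H1 Hc) H2) => h.
by rewrite !add0r.
Qed.

Lemma sdiffable_graph_proj K : graph_dom K -> sdiffable graph_proj K.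
Proof.
move=> DK; eexists; apply: sdiff_graph_proj; apply: sdiff_cinv.
by rewrite graph_denom_e.
Qed.

Lemma graph_denom0 : graph_denom 0 = e.
Proof. by rewrite /graph_denom m0r addr0. Qed.

Lemma sdiff_graph_proj0 : sdiff graph_proj 0 (fun h => h ** e + star h).
Proof.
have H : sdiff cinv (graph_denom 0) (fun h => - h).
  by rewrite graph_denom0; exact: sdiff_cinv_e.
apply: sdiff_eq (sdiff_graph_proj H) => h.
rewrite graph_denom0 star0 !addr0 cinv_id// m0l m0r addr0 oppr0 m0r add0r ee' e_star//.
by rewrite -mA ee' addrC.
Qed.

Lemma sdiffable_graph_chart A : graph_chart_dom A -> sdiffable graph_chart A.
Proof.
move=> [UA _]; have Hp := sdiff_bl A (bl_comp (bl_mull bp e) (bl_mulr bp e)).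
have Hc := sdiff_comp Hp (sdiff_cinv UA).
eexists; exact: sdiff_comp (sdiff_mul bp (sdiff_bl A bl_off_diag) Hc) (sdiff_bl _ bl_off_diag).
Qed.

Section GraphProj.
Variable K : B.
Hypotheses (Ke : K ** e = K) (eK : e ** K = 0) (DK : graph_dom K).

Let y := graph_denom K.
Let ske : star K ** e = 0. Proof. by rewrite -star_e_l// eK star0. Qed.
Let ey : e ** y = y. Proof. by rewrite mDr ee' mA e_star. Qed.
Let ye : y ** e = y. Proof. by rewrite mDl ee' -mA Ke. Qed.
Let y1 : `|y - e| < 1. Proof. by rewrite graph_denom_e. Qed.

Lemma graph_proj_e : graph_proj K ** e = (e + K) ** cinv y.
Proof. by rewrite /graph_proj -/y -!mA [(_ + _) ** e]mDl ee' ske addr0 cinv_e. Qed.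

Lemma graph_gram : (e + star K) ** (e + K) = y.
Proof. by rewrite mDl !mDr ee' eK ske addr0 add0r. Qed.

Lemma graph_proj_idem : graph_proj K ** graph_proj K = graph_proj K.
Proof.
rewrite /graph_proj -/y -!mA (mA (e + star K) (e + K)) graph_gram (mA y) mul_cinv//.
by rewrite mDr ee' e_star.
Qed.

Lemma star_cinv p : e ** p = p -> p ** e = p -> star p = p -> `|p - e| < 1 ->
  star (cinv p) = cinv p.
Proof.
move=> ep pe sp p1; apply/esym; apply: cinv_unique => //; first exact: e_star.
by rewrite -[X in X ** _]sp -star_mul ?cinv_mul ?star_e.
Qed.

Lemma graph_proj_sym : l2sym (graph_proj K).
Proof.
have sy : star y = y by rewrite starD star_e// star_gram.
have sc : star (cinv y) = cinv y by exact: star_cinv.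
have ce := cinv_e os ye y1.
have eK' : (e + K) ** e = e + K by rewrite mDl ee' Ke.
have sK : star (e + K) = e + star K by rewrite starD star_e.
rewrite /graph_proj -/y -sK.
move: (e + K) (cinv y) eK' ce sc => F c Fe ce sc xi eta /=.
by rewrite (star_adjr _ _ Fe) (star_adjr _ _ ce) sc (star_adjl _ _ Fe).
Qed.

(** The range is that of [e + K], which the projection fixes, and [e ** (e + K) = e] makes the
    images of the [s i] independent. *)
Lemma grassmann_graph_proj : grassmann N (graph_proj K).
Proof.
split; [exact: ideal_bounded| |exact: (congr1 (@ideal_op R I) graph_proj_idem)|
  exact: graph_proj_sym].
have lK := ideal_linear (e + K).
have eKx x : e ((e + K) x) = e x.
  by rewrite -[LHS]/((e ** (e + K)) x) mDr ee' eK addr0.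
exists (fun i => (e + K) (s i)).
  move=> a; rewrite -[LHS](_ : (e + K) (\sum_i a i *: s i) = _); last first.
    by rewrite (lin_sum _ _ _ lK); apply: eq_bigr => i _; rewrite (linZ _ _ lK).
  set x := \sum_i _ => h; apply: (orthonormal_indep os); rewrite -/x.
  rewrite -[LHS](onproj_id os); last by exists a.
  by rewrite -(corner_unitE I) -eKx h (lin0 (ideal_linear e)).
have fixE : graph_proj K ** (e + K) = e + K.
  rewrite /graph_proj -/y -mA graph_gram -mA cinv_mul// mDl ee' Ke //.
apply/seteqP; split=> [_ [x _ <-]|_ [a _ <-]].
  have [a _ aE] := onproj_mem s (cinv y ((e + star K) x)).
  exists a => //; rewrite -[RHS]/((e + K) (cinv y ((e + star K) x))).
  have <- : (e + K) (e (cinv y ((e + star K) x))) = (e + K) (cinv y ((e + star K) x)).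
    by rewrite -[LHS]/(((e + K) ** e) _) mDl ee' Ke.
  rewrite (corner_unitE I) -aE (lin_sum _ _ _ lK); apply: eq_bigr => i _.
  by rewrite (linZ _ _ lK).
exists (\sum_i a i *: (e + K) (s i)) => //.
rewrite (lin_sum _ _ _ (ideal_linear _)); apply: eq_bigr => i _.
by rewrite (linZ _ _ (ideal_linear _)) -[in RHS]fixE.
Qed.

Lemma graph_projK : graph_chart_dom (graph_proj K) -> graph_chart (graph_proj K) = K.
Proof.
move=> [UP _]; have ec := e_cinv os ey y1; have ce := cinv_e os ye y1.
have pE : e ** graph_proj K ** e = cinv y.
  by rewrite -mA graph_proj_e mA [e ** (e + K)]mDr ee' eK addr0 ec.
rewrite /graph_chart pE /off_diag pE graph_proj_e.
have rE : cinv (cinv y) = y.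
  by apply: cinv_unique => //; [rewrite -pE|exact: cinv_mul].
have -> : (e + K) ** cinv y - cinv y = K ** cinv y.
  by rewrite [X in X - _]mDl ec [LHS]addrC addKr.
by rewrite rE -(mA K) cinv_mul// Ke; exact: off_diag_fix.
Qed.

End GraphProj.

Section ChartGraph.
Variable P : B.
Hypotheses (MP : grassmann N P) (UP : graph_chart_dom P).

(** With K the chart of [P] and r the corner inverse of e P e, one has e + K = P r and e + star K =
    r P, so the projection onto the graph is P r P; it remains to see that this is [P]. *)
Lemma graph_chartK : graph_dom (graph_chart P) -> graph_proj (graph_chart P) = P.
Proof.
have PP := grassmann_idem MP; have [_ _ _ sP] := MP.
have stP : star P = e ** P.
  by apply: star_unique => xi eta; rewrite /= e_sym sP.
have [p1 Pe1] := UP; have pe : e ** P ** e ** e = e ** P ** e by rewrite -mA ee'.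
have ep : e ** (e ** P ** e) = e ** P ** e by rewrite !mA ee'.
have sp : star (e ** P ** e) = e ** P ** e by rewrite star_e_r// star_e_l// stP.
have sr := star_cinv ep pe sp p1.
have er := e_cinv os ep p1; have re := cinv_e os pe p1.
have pr := mul_cinv os ep pe p1; have rp := cinv_mul os ep pe p1.
rewrite /graph_chart; move: (cinv (e ** P ** e)) sr er re pr rp => r sr er re pr rp.
have KE : off_diag (off_diag P ** r) = P ** r - e.
  rewrite off_diag_fix; first by rewrite /off_diag mBl pr -mA er.
  - by rewrite -mA re.
  - by rewrite mA e_off_diag m0l.
rewrite KE; have eKE : e + (P ** r - e) = P ** r by rewrite addrC subrK.
have sKE : e + star (P ** r - e) = r ** P.
  by rewrite starB star_e// star_mul// sr stP mA re addrC subrK.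
rewrite /graph_dom /= -graph_denom_e => r1.
have dE : graph_denom (P ** r - e) = r.
  have Ke : (P ** r - e) ** e = P ** r - e by rewrite mBl ee' -mA re.
  have eK : e ** (P ** r - e) = 0.
    by rewrite mBr ee' -{1}er !mA pr subrr.
  rewrite -(graph_gram eK) eKE sKE mA -(mA r P P) PP.
  have <- : r ** (e ** P ** e ** r) = r ** P ** r by rewrite !mA re -(mA (r ** P)) er.
  by rewrite pr.
rewrite dE in r1; rewrite /graph_proj eKE sKE dE.
rewrite (cinv_unique os er re r1 ep rp) -(mA P r) rp.
have -> : P ** e ** (r ** P) = P ** r ** P by rewrite mA -(mA P e) er.
(* The difference D = P - P r P satisfies D P = D and D e = 0, hence D (P - e) = D; since |P - e| <
   1, it vanishes. *)
have rest : (P - P ** r ** P) ** (P - e) = P - P ** r ** P.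
  rewrite mBr; suff -> : (P - P ** r ** P) ** e = 0.
    by rewrite mBl PP -(mA (P ** r)) PP subr0.
  rewrite mBl; have <- : P ** (r ** (e ** P ** e)) = P ** r ** P ** e by rewrite !mA -(mA P r e) re.
  by rewrite rp subrr.
apply/esym/eqP; rewrite -subr_eq0 -normr_le0 leNgt; apply/negP => R0.
have := bp_norm bp (P - P ** r ** P) (P - e); rewrite rest leNgt gtr_pMr ?Pe1//.
Qed.

End ChartGraph.

Lemma grassmann_e : grassmann N e.
Proof.
by apply/(grassmannP I); exists s => //; apply/funext => x; exact: corner_unitE.
Qed.

Lemma grassmann_base_chart : base_chart grassmann_proj M e
  graph_dom graph_chart_dom graph_proj graph_chart.
Proof.
have bp_ := bl_comp (bl_mull bp e) (bl_mulr bp e).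
split.
- apply: (@open_norm_lt _ _ _ (fun K => star K ** K)) => K.
  by eexists; exact: sdiff_gram.
- apply: openI.
    apply: (@open_norm_lt _ _ _ (fun A => e ** A ** e - e)) => A.
    eexists; exact: sdiffD (sdiff_bl A bp_) (sdiff_cst (- e) A).
  apply: (@open_norm_lt _ _ _ (fun A => A - e)) => A.
  eexists; exact: sdiffD (sdiff_bl A (bl_id B)) (sdiff_cst (- e) A).
- by move=> K _; exact: sdiffable_graph_proj.
- exact: sdiffable_graph_chart.
- by move=> A _; exact: cproj_idem.
- by move=> K /grassmann_projP[Ke eK]; exact: grassmann_graph_proj.
- by move=> K /grassmann_projP[Ke eK]; exact: graph_projK.
- by move=> P MP UP; exact: graph_chartK.
split; first exact: grassmann_e.
split; first by rewrite /graph_chart_dom /= !ee' subrr normr0.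
rewrite /graph_dom /= /graph_chart.
have -> : off_diag e = 0 by rewrite /off_diag !ee' subrr.
by rewrite m0l (bl0 bl_off_diag) m0r normr0.
Qed.

Definition conj_op U U' (bU : bounded_op U) (bU' : bounded_op U') A : B :=
  ilmul bU (irmul bU' A).

Lemma grassmann_conj U U' (uU : l2unitary U U') (bU : bounded_op U) (bU' : bounded_op U') P :
  grassmann N P -> grassmann N (conj_op bU bU' P).
Proof.
move=> /(grassmannP I)[v ov PE]; apply/(grassmannP I); exists (U \o v).
  exact: orthonormal_unitary uU _ ov.
by apply/funext => x; rewrite -(onproj_unitary uU) /= PE.
Qed.

Lemma grassmann_symmetry U U' (uU : l2unitary U U') (bU : bounded_op U) (bU' : bounded_op U') :
  symmetry M (conj_op bU bU') (conj_op bU' bU).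
Proof.
have [_ _ UK U'K _] := uU; split.
- exact: bl_comp (bl_irmul _ bU') (bl_ilmul _ bU).
- exact: bl_comp (bl_irmul _ bU) (bl_ilmul _ bU').
- by move=> A; apply: ideal_eq => xi; rewrite /= UK UK.
- by move=> A; apply: ideal_eq => xi; rewrite /= U'K U'K.
- by move=> P; exact: grassmann_conj.
- by move=> P; apply: grassmann_conj; exact: l2unitary_sym.
Qed.

Lemma grassmann_homogeneous P : grassmann N P ->
  exists U U' (bU : bounded_op U) (bU' : bounded_op U'), l2unitary U U' /\ conj_op bU bU' e = P.
Proof.
move=> /(grassmannP I)[v ov PE]; have [U [U' [uU Us]]] := l2unitary_transitive os ov.
have [bU bU' _ _ _] := uU; exists U, U', bU, bU'; split=> //.
apply: ideal_eq => x; rewrite PE; have <- : U \o s = v by exact/funext.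
by rewrite -(onproj_unitary uU) /= corner_unitE.
Qed.

(** Idempotence and symmetry are equations between continuous maps and pass to the limit; the rank
    is recovered from an element at distance less than 1. *)
Lemma closed_grassmann : closed M.
Proof.
move=> A clA.
have level (f : B -> B) c : (forall x, exists L, sdiff f x L) ->
    (forall P, grassmann N P -> f P = c) -> f A = c.
  move=> fd fc; have /closure_id E := @closed_level _ _ _ f c fd.
  suff : [set x | f x = c] A by [].
  by rewrite E; exact: closure_subset clA.
have AA : A ** A = A.
  apply/eqP; rewrite -subr_eq0; apply/eqP; apply: (level (fun A => A ** A - A)).
    move=> x; have H := sdiffD (sdiff_mul bp (sdiff_bl x (bl_id B)) (sdiff_bl x (bl_id B)))
      (sdiff_bl x (bl_opp (bl_id B))).
    by eexists; exact: H.
  by move=> P /grassmann_idem ->; rewrite subrr.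
have sA : l2sym A.
  apply: l2sym_defect => t; apply: level => x.
    by eexists; exact: sdiff_bl x (bl_sym_defect I t).
  exact: grassmann_defect.
have [Q [MQ AQ]] : exists Q : B, grassmann N Q /\ `|A - Q| < 1.
  by have [Q [MQ]] := clA _ (nbhsx_ballx A 1 ltr01); rewrite -ball_normE; exists Q.
exact: grassmann_near AQ.
Qed.

Lemma velocity_grassmann P w : velocity M P w -> l2sym w /\ w ** P + P ** w = w.
Proof.
move=> vw; split.
  apply: l2sym_defect => t.
  apply: velocity_level vw (sdiff_bl P (bl_sym_defect I t)) => Q; exact: grassmann_defect.
have H := sdiffD (sdiff_mul bp (sdiff_bl P (bl_id B)) (sdiff_bl P (bl_id B)))
  (sdiff_bl P (bl_opp (bl_id B))).
apply/eqP; rewrite -subr_eq0 [w ** P + _]addrC; apply/eqP; apply: velocity_level vw H => Q.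
by move=> /grassmann_idem /= ->; rewrite subrr.
Qed.

Lemma grassmann_velocity P w : grassmann N P -> l2sym w -> w ** P + P ** w = w ->
  velocity M P w.
Proof.
move=> MP sw wP.
have [U [U' [bU [bU' [uU UP]]]]] := grassmann_homogeneous MP.
have [_ _ UK U'K Ua] := uU.
pose w' := conj_op bU' bU w.
have Uw' : conj_op bU bU' w' = w by apply: ideal_eq => x; rewrite /= !U'K.
have ePE : e = conj_op bU' bU P by rewrite -UP; apply: ideal_eq => x; rewrite /= !UK.
have sw' : l2sym w'.
  by move=> x y; rewrite /= -(Ua x) -sw; have [_ _ _ _ ->] := l2unitary_sym uU.
have we : w' ** e + e ** w' = w'.
  rewrite [in LHS]ePE; apply: ideal_eq => x.
  rewrite -[LHS]/(U' (w (U (U' (P (U x))))) + U' (P (U (U' (w (U x)))))) !U'K.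
  rewrite /w' -[in RHS]wP -[RHS]/(U' (w (P (U x)) + P (w (U x)))).
  by rewrite (linD _ _ bU'.1).
(* Cutting w' = w' e + e w' by [e] on both sides gives e w' e = 2 e w' e. *)
have ewe : e ** w' ** e = 0.
  have : e ** (w' ** e + e ** w') ** e = e ** w' ** e by rewrite we.
  rewrite mDr mDl !mA ee' -(mA _ e e) ee'.
  by move=> /eqP; rewrite addrC -subr_eq0 addrK => /eqP.
have fix' : grassmann_proj (w' ** e) = w' ** e.
  by apply: off_diag_fix; [rewrite -mA ee'|rewrite mA ewe].
have D0 : graph_dom 0 by rewrite /graph_dom /= m0r normr0.
have P0 : grassmann_proj 0 = 0 by exact: bl0 bl_off_diag.
have phi0 : graph_proj 0 = e.
  by rewrite /graph_proj graph_denom0 cinv_id// star0 !addr0 !ee'.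
have := velocity_phi grassmann_base_chart fix' P0 D0 sdiff_graph_proj0 phi0.
move=> /(velocity_sym (grassmann_symmetry uU bU bU')); rewrite UP.
congr velocity; rewrite -[RHS]Uw'; congr conj_op.
rewrite -[RHS]we star_e_r// -mA ee'; congr (_ + _).
by apply: star_unique => x y; rewrite /= e_sym sw'.
Qed.

(** The skew operator is the commutator w P - P w: its own commutator with P is w P + P w, because P
    w P = 0. *)
Lemma grassmann_tangent P w : grassmann N P ->
  (l2sym w /\ w ** P + P ** w = w) <->
  exists2 X, skew_op X & (w : H1 R -> H1 R) = (X \o P) - (P \o X).
Proof.
move=> MP; have PP := grassmann_idem MP; have [_ _ _ sP] := MP.
have PPx x : P (P x) = P x by rewrite -[in RHS]PP.
have lP := ideal_linear P; split=> [[sw wP]|[X [bX skX] wE]].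
  have PwP : P ** w ** P = 0.
    have : P ** (w ** P + P ** w) ** P = P ** w ** P by rewrite wP.
    rewrite mDr mDl !mA PP -(mA _ P P) PP.
    by move=> /eqP; rewrite addrC -subr_eq0 addrK => /eqP.
  exists (w ** P - P ** w : B).
    split=> [|x y]; first exact: ideal_bounded.
    rewrite -[(w ** P - P ** w) x]/(w (P x) - P (w x)).
    rewrite -[(w ** P - P ** w) y]/(w (P y) - P (w y)).
    by rewrite (ipBl ip) (ipBr ip) !sw !sP !sw opprB.
  rewrite -[RHS]/((w ** P - P ** w) ** P - P ** (w ** P - P ** w) : H1 R -> H1 R).
  congr ideal_op; rewrite mBl mBr !mA PP PwP -(mA w) PP.
  by rewrite subr0 sub0r opprK wP.
have wx x : w x = X (P x) - P (X x) by rewrite wE.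
split=> [x y|].
  by rewrite !wx (ipBl ip) (ipBr ip) skX !sP skX opprK addrC.
apply: ideal_eq => x; rewrite -[LHS]/(w (P x) + P (w x)) !wx PPx (linB _ _ lP) PPx.
by rewrite addrA subrK.
Qed.

Lemma grassmann_complete : complete_finsler_manifold M
  (fun P => [set w : B | exists2 X, skew_op X & (w : H1 R -> H1 R) = (X \o P) - (P \o X)])
  (fun _ w => `|w|).
Proof.
apply: (homogeneous_complete grassmann_base_chart) closed_grassmann _ => [P MP|P MP].
  have [U [U' [bU [bU' [uU UP]]]]] := grassmann_homogeneous MP.
  by exists (conj_op bU bU'), (conj_op bU' bU); split=> //; exact: grassmann_symmetry.
apply/seteqP; split=> w; first by move=> /velocity_grassmann/(grassmann_tangent _ MP).
by move=> /(grassmann_tangent _ MP)[sw wP]; exact: grassmann_velocity.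
Qed.

End GrassmannChart.

(** [V] vanishes on the orthogonal complement of the span, so it factors through the finite-rank
    projection [corner_unit]. *)
Lemma stiefel_ideal (R : realType) (I : sn_ideal R) (N : nat) (s : 'I_N -> H1 R) :
  orthonormal s -> stiefel (lspan s) `<=` I.
Proof.
move=> os V [bV kerV _]; suff -> : V = V \o corner_unit I s.
  exact: sni_mull bV (ideal_opP _).
apply/funext => x /=; apply/eqP; rewrite -subr_eq0 -(linB _ _ bV.1) corner_unitE; apply/eqP.
have : [set xi | V xi = 0] (x - onproj s x); last by [].
rewrite kerV => _ [c _ <-]; rewrite (ip_sumr (l2_inner_product R)) big1// => i _.
by rewrite (ipZr (l2_inner_product R)) onproj_orth ?mulr0.
Qed.

Lemma grassmann_ideal (R : realType) (I : sn_ideal R) (N : nat) : @grassmann R N `<=` I.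
Proof.
move=> P /(grassmannP I)[v _ ->].
suff <- : (corner_unit I v : H1 R -> H1 R) = onproj v by exact: ideal_opP.
by apply/funext => x; exact: corner_unitE.
Qed.

Unset Implicit Arguments.

Theorem corollary5p2 (R : realType) (I : sn_ideal R) (N : nat)
    (S : set (H1 R)) (dimS : has_dim N S) :
  (stiefel S `<=` I /\
   complete_finsler_manifold
     [set V : ideal_space I | stiefel S V]
     (fun V => [set w : ideal_space I |
        exists2 X, skew_op X & (w : H1 R -> H1 R) = X \o V])
     (fun _ w => `|w|)) /\
  (@grassmann R N `<=` I /\
   complete_finsler_manifold
     [set P : ideal_space I | grassmann N P]
     (fun P => [set w : ideal_space I |
        exists2 X, skew_op X & (w : H1 R -> H1 R) = (X \o P) - (P \o X)])
     (fun _ w => `|w|)).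
Proof.
have [s os ->] := has_dim_orthonormal dimS.
split; split; first exact: stiefel_ideal.
- exact: stiefel_complete.
- exact: grassmann_ideal.
- exact: grassmann_complete os.
Qed.
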